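(* There exists a sequence $\epsilon_k \to 0$ such that for every $k$ and every $d$ with $$(1+\epsilon_k)\, k\ln k \le d \le (2-\epsilon_k)\, k\ln k,$$ the set of $k$-colorings of the random graph $G(n,m)$ with $m = dn/2$ edges shatters.
   Context: $G(n,m)$ denotes a graph chosen uniformly at random among all graphs on the vertex set $V=\{1,\dots,n\}$ with exactly $m$ edges. A $k$-coloring of a graph is a map $\sigma: V\to\{1,\dots,k\}$ with $\sigma(u)\ne\sigma(v)$ for every edge $uv$. View $\{1,\dots,k\}^n$ as a graph in which $\sigma,\tau$ are adjacent iff their Hamming distance $\mathrm{dist}(\sigma,\tau)$ equals 1. For a graph $G$ let $H=H_G:\{1,\dots,k\}^n\to\mathbb{N}$ count the edges of $G$ that are monochromatic under $\sigma$, and let $\mathcal{S}(G)=\{\sigma: H(\sigma)=0\}$ be the set of $k$-colorings. The height of a path $\sigma_0,\dots,\sigma_t$ is $\max_i H(\sigma_i)$. Clusters are the connected components of $\mathcal{S}(G)$ (as an induced subgraph), and a region is a nonempty union of clusters. An event holds with high probability (w.h.p.) if its probability tends to 1 as $n\to\infty$. The set of solutions shatters if there exist constants $\beta,\gamma,\zeta,\theta>0$ such that w.h.p. $\mathcal{S}(G(n,m))$ can be partitioned into regions such that: (1) there are at least $e^{\beta n}$ regions; (2) each region contains at most an $e^{-\gamma n}$ fraction of all solutions; (3) the Hamming distance between any two distinct regions is at least $\zeta n$; (4) every path between vertices of $\{1,\dots,k\}^n$ lying in distinct regions has height at least $\theta n$.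
   Formalization: The claim is proved for every k ≥ 2: for k = 1 the inequalities hold with d = 0, where the edgeless graph has a single 1-coloring and cannot shatter (and ln 0 is undefined for k = 0); the number of edges m is taken as the integer part of dn/2. *)

(* Defs.v *)
From HB Require Import structures.
From mathcomp Require Import all_boot all_order all_algebra.
From mathcomp Require Import all_classical all_reals all_analysis.

Set Implicit Arguments.
Unset Strict Implicit.
Unset Printing Implicit Defensive.

Import Order.TTheory GRing.Theory Num.Theory.
Import numFieldNormedType.Exports.

Local Open Scope ring_scope.
Local Open Scope set_scope.

(* A simple graph on the vertex set 'I_n is given by its set of edges, each
   edge being a two-element set of vertices. *)
Definition graphs (n m : nat) : {set {set {set 'I_n}}} :=
  [set G : {set {set 'I_n}} |
     [forall e in G, #|e| == 2%N] && (#|G| == m)].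

Section Landscape.
Variables n k : nat.
Implicit Types (G : {set {set 'I_n}}) (s t : {ffun 'I_n -> 'I_k})
  (e : {set 'I_n}).

Definition hamming s t : nat := #|[set v | s v != t v]|.

Definition hamming_adjacent : rel {ffun 'I_n -> 'I_k} :=
  [rel s t | hamming s t == 1%N].

Definition monochromatic s e : bool :=
  [forall u in e, forall v in e, s u == s v].

Definition energy G s : nat := #|[set e in G | monochromatic s e]|.

Definition solutions G : {set {ffun 'I_n -> 'I_k}} :=
  [set s | energy G s == 0%N].

(* [height G s p] is the height of the path s :: p. *)
Definition height G s (p : seq {ffun 'I_n -> 'I_k}) : nat :=
  (\max_(t <- s :: p) energy G t)%N.

Definition solution_adjacent G : rel {ffun 'I_n -> 'I_k} :=
  [rel s t | [&& s \in solutions G, t \in solutions G & hamming_adjacent s t]].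

Definition clusters G : {set {set {ffun 'I_n -> 'I_k}}} :=
  equivalence_partition (connect (solution_adjacent G)) (solutions G).

Definition is_region G (A : {set {ffun 'I_n -> 'I_k}}) : Prop :=
  A != finset.set0 /\
  exists2 C : {set {set {ffun 'I_n -> 'I_k}}},
    C \subset clusters G & A = finset.cover C.

Definition shattered (R : realType) (beta gamma zeta theta : R) G : Prop :=
  exists P : {set {set {ffun 'I_n -> 'I_k}}},
    [/\ finset.partition P (solutions G),
        forall A, A \in P -> is_region G A &
     [/\ expR (beta * n%:R) <= #|P|%:R,
         forall A, A \in P ->
           #|A|%:R <= expR (- (gamma * n%:R)) * #|solutions G|%:R,
         forall A B s t, A \in P -> B \in P -> A != B ->
           s \in A -> t \in B -> zeta * n%:R <= (hamming s t)%:R &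
         forall A B s p, A \in P -> B \in P -> A != B ->
           s \in A -> last s p \in B -> path hamming_adjacent s p ->
           theta * n%:R <= (height G s p)%:R]].

End Landscape.

(* Probability that the uniformly random element of [graphs n m] satisfies Q;
   the value is 0 when there is no graph with n vertices and m edges. *)
Definition Gnm_prob (R : realType) (n m : nat)
    (Q : {set {set 'I_n}} -> Prop) : R :=
  #|[set G in graphs n m | `[< Q G >]]|%:R / #|graphs n m|%:R.

(* [m n] is the number of edges of the random graph on n vertices. *)
Definition shatters (R : realType) (k : nat) (m : nat -> nat) : Prop :=
  exists beta gamma zeta theta : R,
    [/\ 0 < beta, 0 < gamma, 0 < zeta, 0 < theta &
     (Gnm_prob R (m n) (@shattered n k R beta gamma zeta theta)
        @[n --> \oo] --> (1 : R))%classic].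

(* Main.v *)
Require Import Defs.
From mathcomp Require Import all_boot all_order all_algebra.
From mathcomp Require Import perm reals sequences exp.
From mathcomp Require Import ring lra zify.

Set Implicit Arguments.
Unset Strict Implicit.
Unset Printing Implicit Defensive.

Import Order.TTheory GRing.Theory Num.Theory.

Local Open Scope ring_scope.

(* Graphs are replaced by sequences of [m] independent uniform pairs of
   vertices, which are simple with probability bounded below.  Two colorings
   lie in the same region when they are joined by a path of height below
   [theta n], so distinct regions are separated by construction, and they are
   far apart because few vertices touch few edges; it remains to see that every
   region is an exponentially small fraction of all colorings.

   Upper bound on a region: for a fixed coloring [s], all but an
   [exp (- 12 n ln k / k)] fraction of the sequences that [s] properly colors
   have the following property.  In almost every color class almost every
   vertex has many neighbors in every other class, so that a coloring of small
   energy reached from [s] by single recolorings can never unalign a bounded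
   number of further classes; hence [s] is trapped in a small set.  By the first
   moment the other colorings are at most [exp (- 11.5 n ln k / k)] times the
   expected number of colorings.

   Lower bound on the number of colorings: the second moment method with
   [k - 4] colors and nearly equal classes loses only a subexponential factor,
   concentration of measure moves a typical sequence into the resulting event by
   changing few pairs, and the few violated vertices span a 4-colorable graph,
   which is recolored with the four spare colors.  Passing from [k - 4] to [k]
   colors costs a factor at most [exp (11 n ln k / k)]. *)

(** Write [l = ln k], [N = n / k] and [m = c k l n / 2]. Two facts govern the window. A vertex has
    about [c l] neighbors in each foreign class, and [c > 1] makes the chance that one of these
    [k - 1] counts is tiny a negative power of [k], so few vertices can be recolored freely. For
    [c < 2] there are about [exp ((1 - c / 2) l n)] colorings, far more than a trapped set holds,
    whose exponent is a small multiple of [eps l n]. The numerical exponents are measured in units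
    of [l N]. The four spare colors cost a fixed multiple of it, whatever [eps], so the planted
    failure probability has to beat a fixed constant, whereas losing a single class costs only a
    small multiple of [l N]. This is why a trap counts as left only when a large constant number [K]
    of classes is lost: their costs add up. The second moment alone gives a probability
    [exp (- a n)] with [a] as small as desired; concentration turns it into one close to 1 at the
    price of altering a small linear number of pairs. *)

Ltac nonneg := repeat first
  [ exact: expR_ge0 | exact: sqr_ge0 | exact: ler0n | by []
  | apply: mulr_ge0 | rewrite invr_ge0 | by apply: ltW ].

(** * Exponential moments and union bounds in counting form *)

Section Counting.
Variable R : realType.

Lemma natr_card_pred (T : finType) (P : pred T) :
  (#|[set x | P x]|)%:R = \sum_(x | P x) 1 :> R.
Proof. by rewrite -sum1_card natr_sum; apply: eq_bigl => x; rewrite inE. Qed.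

Lemma natr_cards (T : finType) (A : {set T}) :
  #|A|%:R = \sum_(x in A) 1 :> R.
Proof. by rewrite -sum1_card natr_sum. Qed.

Lemma sum_prod_ffun (m : nat) (T : finType) (g : 'I_m -> T -> R) :
  \sum_(e : {ffun 'I_m -> T}) \prod_i g i (e i) = \prod_i \sum_p g i p.
Proof. by rewrite bigA_distr_bigA. Qed.

(** Exponential Markov inequality for independent coordinates: an indicator dominated by a product
    weight sums to at most a product of one-coordinate sums. The large deviation bounds below differ
    only in the choice of [g]. *)
Lemma card_le_prod (m : nat) (T : finType) (P : pred {ffun 'I_m -> T})
    (g : 'I_m -> T -> R) (a : R) :
  (forall i p, 0 <= g i p) ->
  (forall e, P e -> a <= \prod_i g i (e i)) ->
  a * #|[set e | P e]|%:R <= \prod_i \sum_p g i p.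
Proof.
move=> g0 ag; rewrite -sum_prod_ffun natr_card_pred mulr_sumr.
rewrite [leRHS](bigID P) /= -[leLHS]addr0; apply: lerD.
  by apply: ler_sum => e Pe; rewrite mulr1; exact: ag.
by apply: sumr_ge0 => e _; apply: prodr_ge0.
Qed.

(** Union bound over witnesses [phi], with the entropy of the choice carried by the weights [w]. The
    bound on a witness is asked only when some [e] realises it, so that structural properties of
    [phi] can be read off such an [e]. *)
Lemma card_union_le (T Phi : finType) (P : pred T) (Q : Phi -> pred T)
    (w : Phi -> R) (X : R) :
  0 <= X ->
  (forall e, P e -> exists phi, Q phi e) ->
  (forall phi, 0 <= w phi) ->
  (forall phi, (exists e, Q phi e) -> #|[set e | Q phi e]|%:R <= w phi * X) ->
  #|[set e | P e]|%:R <= (\sum_phi w phi) * X.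
Proof.
move=> X0 PQ w0 QX; rewrite mulr_suml.
apply: (@le_trans _ _ (\sum_phi #|[set e | Q phi e]|%:R)); last first.
  apply: ler_sum => phi _; have [->|[e]] := set_0Vmem [set e | Q phi e].
    by rewrite cards0 mulr_ge0.
  by rewrite inE => Qe; apply: QX; exists e.
have -> : \sum_phi #|[set e | Q phi e]|%:R =
    \sum_e \sum_(phi | Q phi e) (1 : R).
  rewrite (exchange_big_dep predT) //=; apply: eq_bigr => phi _.
  by rewrite natr_card_pred.
rewrite natr_card_pred [leRHS](bigID P) /= -[leLHS]addr0; apply: lerD.
  apply: ler_sum => e Pe; have [phi Qphi] := PQ _ Pe.
  by rewrite (bigD1 phi) //= lerDl sumr_ge0.
by apply: sumr_ge0 => e _; apply: sumr_ge0.
Qed.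

(** A partial labelling decides independently at each vertex, so product weights sum to a product. A
    weight of one over the number of labels makes the choice of label free, leaving only the choice
    of the labelled vertices. *)
Lemma sum_prod_option (V L : finType) (w : V -> option L -> R) :
  \sum_(phi : {ffun V -> option L}) \prod_v w v (phi v) =
  \prod_v (w v None + \sum_l w v (Some l)).
Proof.
rewrite -(bigA_distr_bigA w); apply: eq_bigr => v _.
rewrite (bigD1 None) //=; congr (_ + _).
rewrite (reindex_omap Some id) /=; last by case.
by apply: eq_bigl => i; rewrite eqxx.
Qed.

Lemma prod_1D_le_exp (V : finType) (P : pred V) (a : V -> R) :
  (forall v, 0 <= a v) ->
  \prod_(v | P v) (1 + a v) <= expR (\sum_(v | P v) a v).
Proof.
move=> a0; rewrite expR_sum; apply: ler_prod => v _.
by rewrite addr_ge0 //= expR_ge1Dx.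
Qed.

Lemma expRX (x : R) (n : nat) : expR x ^+ n = expR (x * n%:R).
Proof. by rewrite expRM_natr. Qed.

Lemma prod_expR_card (T : finType) (A : {set T}) (x : R) :
  \prod_(v in A) expR x = expR (x * #|A|%:R).
Proof. by rewrite prodr_const expRX. Qed.

Lemma sum_const_pred (T : finType) (P : pred T) (x : R) :
  \sum_(i | P i) x = #|[set i | P i]|%:R * x.
Proof.
by rewrite natr_card_pred mulr_suml; apply: eq_bigr => i _; rewrite mul1r.
Qed.

Lemma sum_const_set (T : finType) (A : {set T}) (x : R) :
  \sum_(i in A) x = #|A|%:R * x.
Proof. by rewrite sumr_const mulr_natl. Qed.

End Counting.

(** * Concentration in product spaces *)

Section Blowup.
Variables (R : realType) (T : finType).

Definition ffun_cons m (x : T) (e : {ffun 'I_m -> T}) : {ffun 'I_m.+1 -> T} :=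
  [ffun i => if unlift ord0 i is Some j then e j else x].

Lemma ffun_cons0 m x (e : {ffun 'I_m -> T}) : ffun_cons x e ord0 = x.
Proof. by rewrite ffunE unlift_none. Qed.

Lemma ffun_consS m x (e : {ffun 'I_m -> T}) j :
  ffun_cons x e (lift ord0 j) = e j.
Proof. by rewrite ffunE liftK. Qed.

Lemma ffun_cons_bij m :
  bijective (fun p : T * {ffun 'I_m -> T} => ffun_cons p.1 p.2).
Proof.
exists (fun e : {ffun 'I_m.+1 -> T} => (e ord0, [ffun j => e (lift ord0 j)])).
  case=> x e /=; rewrite ffun_cons0; congr (_, _).
  by apply/ffunP => j; rewrite ffunE ffun_consS.
move=> e; apply/ffunP => i /=; case: (unliftP ord0 i) => [j ->|->].
  by rewrite ffun_consS ffunE.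
by rewrite ffun_cons0.
Qed.

Lemma sum_ffun_cons (A : nmodType) m (F : {ffun 'I_m.+1 -> T} -> A) :
  \sum_e F e = \sum_x \sum_(e : {ffun 'I_m -> T}) F (ffun_cons x e).
Proof.
by rewrite pair_big (reindex _ (onW_bij _ (ffun_cons_bij m))).
Qed.

Definition edist m (e e' : {ffun 'I_m -> T}) : nat :=
  #|[set i | e i != e' i]|.

Lemma edistE m (e e' : {ffun 'I_m -> T}) :
  edist e e' = (\sum_i (e i != e' i))%N.
Proof.
rewrite /edist -sum1_card big_mkcond /=; apply: eq_bigr => i _.
by rewrite inE; case: eqP.
Qed.

Lemma edist_cons m x y (e e' : {ffun 'I_m -> T}) :
  edist (ffun_cons x e) (ffun_cons y e') = ((x != y) + edist e e')%N.
Proof.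
rewrite !edistE big_ord_recl !ffun_cons0; congr (_ + _)%N.
by apply: eq_bigr => i _; rewrite !ffun_consS.
Qed.

Lemma card_set_cons m (A : {set {ffun 'I_m.+1 -> T}}) :
  #|A| = (\sum_x #|[set e | ffun_cons x e \in A]|)%N.
Proof.
rewrite -sum1_card big_mkcond sum_ffun_cons; apply: eq_bigr => x _.
by rewrite -big_mkcond -sum1_card; apply: eq_bigl => e; rewrite inE.
Qed.

(** Induction step of the concentration bound. With [v] the sections [a] divided by their maximum,
    the two hypotheses bound [u] by a multiple of the smaller of [1 / v] and [q], and both cases lie
    below the line [q + 1 - q v]. The product of sums is then a quadratic in [w], whose maximum
    gives the constant [(q + 1) ^ 2 / (4 q)]. *)
Lemma two_point_bound (q M : R) (u a : T -> R) :
  1 <= q -> 0 <= M -> (forall x, 0 <= a x) ->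
  (forall x, u x * a x <= M) -> (forall x y, u x * a y <= q * M) ->
  (\sum_x u x) * (\sum_x a x) <= (q + 1) ^+ 2 / (4 * q) * #|T|%:R ^+ 2 * M.
Proof.
move=> q1 M0 a0 uaM uaqM.
have C0 : 0 <= (q + 1) ^+ 2 / (4 * q) * #|T|%:R ^+ 2 * M.
  have q4 : 0 <= (4 * q)^-1 by rewrite invr_ge0; lra.
  by apply: mulr_ge0 => //; apply: mulr_ge0; rewrite ?sqr_ge0 // mulr_ge0 ?sqr_ge0.
have [x0 _|T0] := pickP (fun _ : T => true); last first.
  by rewrite big1 ?mul0r // => x; have := T0 x.
pose xm := [arg max_(x > x0) a x]%O.
have amax x : a x <= a xm.
  by rewrite /xm; case: arg_maxP => // i _ /(_ x isT).
have [am0|am0] := leP (a xm) 0.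
  rewrite [X in _ * X]big1 ?mulr0 // => x _; apply: le_anti.
  by rewrite a0 (le_trans (amax x)).
pose v x := a x / a xm.
have v01 x : 0 <= v x <= 1.
  by rewrite divr_ge0 //= ?ler_pdivrMr ?mul1r ?amax // ltW.
have uv x : u x * a xm <= M * (q + 1 - q * v x).
  have /andP[v0 v1] := v01 x.
  have av : a x = v x * a xm by rewrite /v divfK // gt_eqF.
  have [qv|qv] := leP 1 (q * v x); last first.
    apply: (le_trans (uaqM _ _)); rewrite mulrC ler_wpM2l //; lra.
  have vp : 0 < v x by rewrite lt_neqAle v0 andbT; apply/eqP => v00; move: qv; rewrite -v00; lra.
  have h := uaM x; rewrite av mulrCA in h.
  rewrite -(ler_pM2l vp); apply: (le_trans h).
  rewrite mulrCA -[leLHS]mulr1 ler_wpM2l //.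
  have : 0 <= (q * v x - 1) * (1 - v x) by rewrite mulr_ge0; lra.
  by lra.
rewrite -(ler_pM2r am0) mulrAC mulr_suml.
have -> : \sum_x a x = a xm * \sum_x v x.
  rewrite mulr_sumr; apply: eq_bigr => x _; rewrite /v mulrCA mulfV ?mulr1 //.
  by rewrite gt_eqF.
set w := \sum_x v x.
have w0 : 0 <= w by apply: sumr_ge0 => x _; case/andP: (v01 x).
apply: (@le_trans _ _ ((\sum_x M * (q + 1 - q * v x)) * (a xm * w))).
  by rewrite ler_wpM2r ?(mulr_ge0 (ltW am0)) //; exact: ler_sum.
rewrite -mulr_sumr big_split /= sumr_const sumrN -mulr_sumr -/w -[X in M * (X - _)]mulr_natr.
have key : (( q + 1) * #|T|%:R - q * w) * w <=
   ((q + 1) * #|T|%:R) ^+ 2 / (4 * q).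
  rewrite ler_pdivlMr; last by lra.
  have := sqr_ge0 ((q + 1) * #|T|%:R - 2 * q * w); rewrite !expr2; lra.
rewrite -subr_ge0.
have := key; rewrite -subr_ge0 => key0.
rewrite (_ : _ - M * _ * _ = M * a xm * (((q + 1) * #|T|%:R) ^+ 2 / (4 * q) -
  ((q + 1) * #|T|%:R - q * w) * w)); last by rewrite exprMn; ring.
by rewrite mulr_ge0 // mulr_ge0 // ltW.
Qed.

(* [D] need not be the distance to [A]: a lower bound for it is enough, and
   this makes the statement pass to sections of [A]. *)
Lemma blowup (q : R) m (A : {set {ffun 'I_m -> T}})
    (D : {ffun 'I_m -> T} -> nat) :
  1 <= q -> (forall e e', e' \in A -> (D e <= edist e e')%N) ->
  (\sum_e q ^+ D e) * #|A|%:R <=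
    ((q + 1) ^+ 2 / (4 * q) * #|T|%:R ^+ 2) ^+ m.
Proof.
move=> q1; elim: m A D => [|m IH] A D DA.
  rewrite expr0; have [->|[e0 e0A]] := set_0Vmem A; first by rewrite cards0 mulr0.
  have D0 e : D e = 0%N.
    apply/eqP; rewrite -leqn0 (leq_trans (DA e e0 e0A)) // edistE big_ord0 //.
  rewrite (eq_bigr (fun=> 1)) => [|e _]; last by rewrite D0 expr0.
  have c1 : #|{ffun 'I_0 -> T}| = 1%N by rewrite card_ffun card_ord expn0.
  rewrite sumr_const c1 mul1r -[leRHS]/(1%:R) ler_nat.
  by rewrite (leq_trans (max_card _)) // c1.
rewrite sum_ffun_cons card_set_cons natr_sum exprS.
set C := (_ + 1) ^+ 2 / _ * _; pose M := C ^+ m.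
have C0 : 0 <= C.
  have q4 : 0 <= (4 * q)^-1 by rewrite invr_ge0; lra.
  by apply: mulr_ge0; rewrite ?sqr_ge0 // mulr_ge0 ?sqr_ge0.
apply: two_point_bound => //; first exact: exprn_ge0.
- move=> x; apply: IH => e e'; rewrite inE => /(DA (ffun_cons x e)).
  by rewrite edist_cons eqxx.
move=> x y.
(* A different first coordinate accounts for at most one unit of distance, so the predecessor of [D]
   is a valid lower bound between two sections; restoring that unit costs the factor [q]. *)
have h : (\sum_e q ^+ (D (ffun_cons x e)).-1) *
    #|[set e | ffun_cons y e \in A]|%:R <= M.
  apply: IH => e e'; rewrite inE => /(DA (ffun_cons x e)).
  rewrite edist_cons; case: (x != y) => //=; lia.
apply: le_trans (ler_wpM2l _ h); last by lra.
rewrite mulrA ler_wpM2r // mulr_sumr ler_sum // => e _.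
case: (D _) => [|d] /=; last by rewrite exprS.
by rewrite expr0 mulr1.
Qed.

End Blowup.

(** * First moments in the planted model *)

Section PlantedCount.
Variables (R : realType) (n k m : nat).
Local Notation V := 'I_n.
Local Notation pairs := ('I_n * 'I_n)%type.
Local Notation edges := {ffun 'I_m -> 'I_n * 'I_n}.
Implicit Types (s t : {ffun V -> 'I_k}) (e : edges).

Definition mono s : {set pairs} := [set p | s p.1 == s p.2].
Definition proper s e : bool := [forall i, e i \notin mono s].
Definition hits e (F : {set pairs}) : nat := #|[set i | e i \in F]|.
Definition cls s (i : 'I_k) : {set V} := [set v | s v == i].

Lemma sum_card_cls s : (\sum_i #|cls s i|)%N = n.
Proof.
rewrite -[RHS]card_ord -sum1_card (partition_big s predT) //=.
by apply: eq_bigr => i _; rewrite -sum1_card; apply: eq_bigl => v; rewrite inE.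
Qed.

Lemma card_monoE s : #|mono s| = (\sum_i #|cls s i| ^ 2)%N.
Proof.
rewrite -sum1_card (partition_big (fun p : pairs => s p.1) predT) //=.
apply: eq_bigr => i _.
rewrite expnS expn1 -cardsX -sum1_card; apply: eq_bigl => -[u v].
rewrite !inE /= -[LHS]/((s u == s v) && (s u == i)).
by case: (s u =P i) => [->|]; rewrite ?andbF //= andbT eq_sym.
Qed.

Lemma sum_sqr_ge (I : finType) (a : I -> R) :
  (\sum_i a i) ^+ 2 <= #|I|%:R * \sum_i a i ^+ 2.
Proof.
set A := \sum_i a i; set Q := \sum_i _; set c : R := #|I|%:R.
have : 0 <= \sum_i (c * a i - A) ^+ 2 by apply: sumr_ge0 => i _; exact: sqr_ge0.
have -> : \sum_i (c * a i - A) ^+ 2 = c * (c * Q - A ^+ 2).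
  transitivity (\sum_i (c ^+ 2 * a i ^+ 2 - (c * A * 2) * a i + A ^+ 2)).
    by apply: eq_bigr => i _; ring.
  rewrite big_split /= big_split /= sumrN -!mulr_sumr sumr_const -/Q -/A.
  by rewrite -[_ *+ #|_|]mulr_natr -/c; ring.
have [c0|c0] := ltP 0 c; first by rewrite pmulr_rge0 // subr_ge0.
have {}c0 : c = 0 by apply: le_anti; rewrite c0 ler0n.
have I0 : #|I| = 0%N by apply/eqP; rewrite -(eqr_nat R) -/c c0.
move=> _; rewrite /A big1 ?expr0n ?mulr_ge0 ?sumr_ge0 // => [|i _].
  by move=> i _; exact: sqr_ge0.
by have := card0_eq I0 i; rewrite inE.
Qed.

Lemma card_mono_ge s : (0 < k)%N -> n%:R ^+ 2 / k%:R <= #|mono s|%:R :> R.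
Proof.
move=> k0; rewrite ler_pdivrMr ?ltr0n // mulrC card_monoE.
have := sum_sqr_ge (fun i => #|cls s i|%:R).
rewrite -natr_sum sum_card_cls card_ord natr_sum.
by under [X in _ <= _ * X -> _]eq_bigr do rewrite -natrX.
Qed.

(** Equal classes minimise the number of monochromatic pairs, so this bounds the number of sequences
    that any one coloring properly colors. *)
Definition base : R := (n%:R ^+ 2 * (1 - k%:R^-1)) ^+ m.

Lemma expRN1_ge : 1 / 4 <= expR (-1) :> R.
Proof.
have -> : -1 = - (1 / 2) + - (1 / 2) :> R by lra.
have h : 1 / 2 <= expR (- (1 / 2)) :> R.
  by apply: le_trans (expR_ge1Dx _); lra.
rewrite expRD; apply: le_trans (ler_pM _ _ h h); lra.
Qed.

(** The two coefficients differ on purpose: losing a factor 2 on [a] is harmless, but the gain from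
    [b] has to keep its coefficient 1, since the condition [c > 1] leaves no constant factor to
    spare. *)
Lemma perturb_le (X N2 a b : R) : 0 < N2 -> N2 / 2 <= X -> X <= N2 ->
  0 <= a -> 0 <= b -> X + a - b <= X * expR ((2 * a - b) / N2).
Proof.
move=> N0 XN XN' a0 b0.
apply: (@le_trans _ _ (X * (1 + (2 * a - b) / N2))); last first.
  by rewrite ler_wpM2l ?expR_ge1Dx //; lra.
rewrite -(ler_pM2r N0) -mulrA [_ * N2 in leRHS]mulrDl divfK ?gt_eqF // mul1r.
have h1 : a * N2 <= X * (2 * a).
  have : 0 <= a * (2 * X - N2) by rewrite mulr_ge0 //; lra.
  by lra.
have h2 : X * b <= b * N2.
  have : 0 <= b * (N2 - X) by rewrite mulr_ge0 //; lra.
  by lra.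
by lra.
Qed.

(** Large deviations among the sequences that [s] properly colors: pairs in [Fp] are rewarded by
    [al], pairs in [Fm] penalised by [be]. In addition a vertex [w] may designate a position [iot w]
    whose pair must lie in [Fw w]; each such constraint contributes the probability of a single
    pair, with the tilt included. *)
Lemma planted_count s (Fp Fm : {set pairs}) (al be t : R)
    (iot : {ffun V -> option 'I_m}) (Fw : V -> {set pairs}) (P : pred edges) :
  (0 < n)%N -> (1 < k)%N -> 0 <= al -> 0 <= be ->
  [disjoint Fp & Fm] -> [disjoint Fm & mono s] ->
  (forall w, Fw w \subset Fp) ->
  (forall w w', w != w' -> [disjoint Fw w & Fw w']) ->
  (forall e, P e -> [/\ proper s e,
      t <= al * (hits e Fp)%:R - be * (hits e Fm)%:R &
      forall w i, iot w = Some i -> e i \in Fw w]) ->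
  #|[set e | P e]|%:R <= base *
    expR (- t + m%:R / n%:R ^+ 2 *
      (2 * expR al * #|Fp|%:R - (1 - expR (- be)) * #|Fm|%:R)) *
    \prod_(w | iot w != None) (8 * expR al * #|Fw w|%:R / n%:R ^+ 2).
Proof.
move=> n0 k1 al0 be0 dFpm dFmM FwFp dFw HP.
pose N2 : R := n%:R ^+ 2.
have N20 : 0 < N2 by rewrite exprn_gt0 // ltr0n.
pose u (p : pairs) : R := al * (p \in Fp)%:R - be * (p \in Fm)%:R.
pose ok i (p : pairs) := (p \notin mono s) &&
  [forall w, (iot w == Some i) ==> (p \in Fw w)].
pose g i p : R := if ok i p then expR (u p) else 0.
have g0 i p : 0 <= g i p by rewrite /g; case: ifP => // _; exact: expR_ge0.
have eb1 : expR (- be) <= 1 by rewrite expR_le1; lra.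
pose a : R := expR al * #|Fp|%:R.
pose b : R := (1 - expR (- be)) * #|Fm|%:R.
have a0 : 0 <= a by rewrite mulr_ge0 ?expR_ge0.
have b0 : 0 <= b by rewrite mulr_ge0 //; lra.
have bN2 : b <= N2.
  rewrite /b /N2 -natrX; apply: (@le_trans _ _ (1 * #|Fm|%:R)).
    by rewrite ler_wpM2r //; have := expR_ge0 (- be); lra.
  rewrite mul1r ler_nat (leq_trans (max_card _)) // card_prod card_ord.
  by rewrite expnS expn1.
have kinv : k%:R^-1 <= 1 / 2 :> R.
  have k2 : 2 <= k%:R :> R by rewrite (ler_nat R 2).
  by rewrite -div1r ler_pdivrMr ?ltr0n; [lra|exact: ltnW].
have kinv0 : 0 <= k%:R^-1 :> R by rewrite invr_ge0.
pose X := N2 * (1 - k%:R^-1).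
have XN : N2 / 2 <= X.
  by rewrite /X ler_pM2l //; lra.
have XN' : X <= N2 by rewrite /X -[leRHS]mulr1 ler_pM2l //; lra.
pose Ss := X * expR ((2 * a - b) / N2).
have Ss8 : N2 / 8 <= Ss.
  apply: (@le_trans _ _ (N2 / 2 * (1 / 4))); first by lra.
  apply: ler_pM => //; try lra.
  apply: (le_trans expRN1_ge); rewrite ler_expR.
  by rewrite ler_pdivlMr //; lra.
have Ss0 : 0 < Ss by lra.
have sumg i : \sum_p g i p <= Ss *
    \prod_(w | iot w == Some i) (8 * expR al * #|Fw w|%:R / N2).
  have [w0 /eqP w0i|none] := pickP (fun w => iot w == Some i); last first.
    rewrite big_pred0 // mulr1.
    apply: (@le_trans _ _ (\sum_(p | p \notin mono s)
       (1 + expR al * (p \in Fp)%:R - (1 - expR (- be)) * (p \in Fm)%:R))).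
      rewrite [leRHS]big_mkcond /=; apply: ler_sum => p _; rewrite /g /ok.
      case: (boolP (p \in mono s)) => //= pM.
      case: ifP => _.
        rewrite /u; case: (boolP (p \in Fp)) => pFp.
          have -> : (p \in Fm) = false by exact: disjointFr pFp.
          rewrite mulr1 !mulr0 !subr0 mulr1; lra.
        rewrite !mulr0 add0r addr0; case: (p \in Fm); rewrite ?mulr1 ?mulr0 ?oppr0 ?expR0; lra.
      have := expR_ge0 al; have := expR_ge0 (- be).
      case: (p \in Fp); case: (p \in Fm); rewrite ?mulr1 ?mulr0; lra.
    rewrite big_split /= big_split /= sumrN.
    have h1 : \sum_(p | p \notin mono s) (1 : R) <= X.
      rewrite -natr_card_pred /X mulrBr mulr1.
      have -> : [set p | p \notin mono s] = ~: mono s by apply/setP => p; rewrite !inE.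
      have := cardsC (mono s); rewrite card_prod card_ord => /(congr1 (fun x => x%:R : R)).
      rewrite natrD natrM -expr2 -/N2 => h.
      have := card_mono_ge s (ltnW k1); rewrite -/N2; lra.
    have h2 : \sum_(p | p \notin mono s) expR al * (p \in Fp)%:R <= a.
      rewrite -mulr_sumr ler_wpM2l ?expR_ge0 // natr_cards big_mkcond [leRHS]big_mkcond /=.
      by apply: ler_sum => p _; case: (_ \notin _); case: (_ \in Fp); rewrite ?ler01.
    have h3 : \sum_(p | p \notin mono s) (1 - expR (- be)) * (p \in Fm)%:R = b.
      rewrite -mulr_sumr /b natr_cards; congr (_ * _).
      rewrite big_mkcond [RHS]big_mkcond /=; apply: eq_bigr => p _.
      case: (boolP (p \in Fm)) => pFm; last by case: (_ \notin _).
      by rewrite (disjointFr dFmM pFm).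
    apply: le_trans (perturb_le N20 XN XN' a0 b0); rewrite h3; lra.
  (* If two vertices designate the same position, no pair lies in both of the disjoint sets [Fw],
     and the sum vanishes. *)
  have [w1 /andP[/eqP w1i w10]|uniq0] :=
      pickP (fun w => (iot w == Some i) && (w != w0)).
    rewrite big1 => [|p _].
      apply: mulr_ge0; first exact: ltW.
      by apply: prodr_ge0 => w _; rewrite divr_ge0 ?mulr_ge0 ?expR_ge0 // ltW.
    rewrite /g; case: (boolP (ok i p)) => // /andP[_ /forallP h].
    have := h w0; have := h w1; rewrite w0i w1i eqxx /= => p1 p0.
    by rewrite (disjointFr (dFw _ _ w10) p1) in p0.
  rewrite [X in _ <= _ * X](bigD1 w0) ?w0i //=.
  rewrite [X in _ <= _ * (_ * X)]big_pred0 ?mulr1 //.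
  apply: (@le_trans _ _ (expR al * #|Fw w0|%:R)).
    rewrite natr_cards mulr_sumr [leRHS]big_mkcond /=; apply: ler_sum => p _.
    rewrite /g /ok; case: (boolP (p \in Fw w0)) => pw; last first.
      case: ifP => // /andP[_ /forallP /(_ w0)]; rewrite w0i eqxx /= => pw'.
      by rewrite pw' in pw.
    rewrite mulr1; case: ifP => _; last exact: expR_ge0.
    rewrite ler_expR /u (subsetP (FwFp w0) _ pw) mulr1.
    have be' : 0 <= be * (p \in Fm)%:R by rewrite mulr_ge0.
    lra.
  have -> : Ss * (8 * expR al * #|Fw w0|%:R / N2) =
     (expR al * #|Fw w0|%:R) * (Ss / (N2 / 8)) by field; lra.
  rewrite -[leLHS]mulr1 ler_wpM2l ?mulr_ge0 ?expR_ge0 // ler_pdivlMr; lra.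
have main : expR t * #|[set e | P e]|%:R <= \prod_i \sum_p g i p.
  apply: card_le_prod => // e /HP[pe te ie].
  have -> : \prod_i g i (e i) = expR (\sum_i u (e i)).
    rewrite expR_sum; apply: eq_bigr => i _; rewrite /g /ok.
    rewrite (forallP pe) /=; case: forallP => // -[w]; apply/implyP => /eqP.
    exact: ie.
  rewrite ler_expR; apply: (le_trans te).
  rewrite /u big_split /= sumrN -!mulr_sumr /hits.
  rewrite !natr_card_pred [X in al * X]big_mkcond [X in be * X]big_mkcond /=.
  rewrite le_eqVlt; apply/orP; left; apply/eqP; congr (_ * _ - _ * _);
    by apply: eq_bigr => i _; case: (_ \in _).
have main2 : \prod_i \sum_p g i p <= \prod_(i < m) (Ss *
    \prod_(w | iot w == Some i) (8 * expR al * #|Fw w|%:R / N2)).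
  by apply: ler_prod => i _; rewrite sumg andbT sumr_ge0.
rewrite big_split /= prodr_const card_ord in main2.
have pE : \prod_(i < m) \prod_(w | iot w == Some i)
     (8 * expR al * #|Fw w|%:R / N2) =
  \prod_(w | iot w != None) (8 * expR al * #|Fw w|%:R / N2).
  rewrite (exchange_big_dep (fun w => iot w != None)) /=; last first.
    by move=> i w _ /eqP ->.
  apply: eq_bigr => w; case: (iot w) => [i|] // _.
  by rewrite (big_pred1 i) // => j; rewrite -[RHS]/(j == i) eq_sym.
rewrite pE in main2.
set Pr := \prod_(w | _) _ in main2 *.
have -> : base * expR (- t + m%:R / n%:R ^+ 2 *
      (2 * expR al * #|Fp|%:R - (1 - expR (- be)) * #|Fm|%:R)) * Pr =
    (expR t)^-1 * (Ss ^+ m * Pr).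
  rewrite expRD expRN /Ss exprMn expRX /base -/N2 -/X.
  have -> : (2 * a - b) / N2 * m%:R = m%:R / N2 *
      (2 * expR al * #|Fp|%:R - (1 - expR (- be)) * #|Fm|%:R).
    by rewrite /a /b; ring.
  by ring.
rewrite ler_pdivlMl ?expR_gt0 //; exact: le_trans main main2.
Qed.

Lemma planted_count0 s (Fp Fm : {set pairs}) (al be t : R) (P : pred edges) :
  (0 < n)%N -> (1 < k)%N -> 0 <= al -> 0 <= be ->
  [disjoint Fp & Fm] -> [disjoint Fm & mono s] ->
  (forall e, P e -> proper s e /\
      t <= al * (hits e Fp)%:R - be * (hits e Fm)%:R) ->
  #|[set e | P e]|%:R <= base *
    expR (- t + m%:R / n%:R ^+ 2 *
      (2 * expR al * #|Fp|%:R - (1 - expR (- be)) * #|Fm|%:R)).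
Proof.
move=> n0 k1 al0 be0 dFpm dFmM HP.
have none (w : V) : ([ffun=> None] : {ffun V -> option 'I_m}) w = None.
  by rewrite ffunE.
have := @planted_count s Fp Fm al be t [ffun=> None] (fun=> set0) P n0 k1 al0 be0
  dFpm dFmM (fun=> sub0set _).
rewrite big_pred0 => [|w]; last by rewrite none.
rewrite mulr1; apply; first by move=> w w' _; rewrite -setI_eq0 set0I.
by move=> e /HP[pe te]; split=> // w i; rewrite none.
Qed.

End PlantedCount.

(** * Pairs between relabelled vertices and their target classes *)

Section Links.
Variables (n k m : nat).
Local Notation V := 'I_n.
Local Notation pairs := ('I_n * 'I_n)%type.
Local Notation edges := {ffun 'I_m -> 'I_n * 'I_n}.
Variable s : {ffun V -> 'I_k}.
Implicit Types (e : edges) (f : {ffun V -> option 'I_k}) (A B : {set V})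
  (F : {set pairs}).

Definition star (v : V) A : {set pairs} :=
  [set p | (p.1 == v) && (p.2 \in A) || (p.2 == v) && (p.1 \in A)].

Definition deg e v A : nat := hits e (star v A).

Definition supp (L : eqType) (f : {ffun V -> option L}) : {set V} :=
  [set v | f v != None].

(* The vertices of [A] lying in the class that the label of [v] designates. *)
Definition lkset f A (v : V) : {set V} := [set w in A | f v == Some (s w)].

(** Reading [f v = Some j] as a move of [v] into class [j], these are the pairs joining a moved
    vertex to the part of its target class inside [A]. *)
Definition lk f A : {set pairs} :=
  [set p | (p.2 \in lkset f A p.1) || (p.1 \in lkset f A p.2)].

Lemma lkset_supp f A v w : w \in lkset f A v -> v \in supp f.
Proof. by rewrite !inE => /andP[_ /eqP ->]. Qed.

Lemma lksetE f A v j : f v = Some j -> lkset f A v = A :&: cls s j.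
Proof. by move=> fv; apply/setP => w; rewrite !inE fv eq_sym. Qed.

Lemma lkset0 f A v : f v = None -> lkset f A v = set0.
Proof. by move=> fv; apply/setP => w; rewrite !inE fv andbF. Qed.

Lemma hitsE e F : hits e F = (\sum_i (e i \in F))%N.
Proof.
rewrite /hits -sum1_card big_mkcond /=; apply: eq_bigr => i _.
by rewrite inE; case: (_ \in _).
Qed.

Lemma hits_subset e F F' : F \subset F' -> (hits e F <= hits e F')%N.
Proof.
move=> FF'; apply: subset_leq_card; apply/subsetP => i; rewrite !inE.
exact: (subsetP FF').
Qed.

Lemma deg_subset e v A B : A \subset B -> (deg e v A <= deg e v B)%N.
Proof.
move=> AB; apply: hits_subset; apply/subsetP => p; rewrite !inE.
by case/orP=> /andP[-> /(subsetP AB) ->]; rewrite ?orbT.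
Qed.

Lemma hits_setU e F F' : (hits e (F :|: F') <= hits e F + hits e F')%N.
Proof.
apply: leq_trans (leq_card_setU _ _); apply: subset_leq_card.
by apply/subsetP => i; rewrite !inE.
Qed.

Lemma deg_setU e v A B : (deg e v (A :|: B) <= deg e v A + deg e v B)%N.
Proof.
apply: leq_trans (hits_setU _ _ _); apply: hits_subset.
apply/subsetP => p; rewrite !inE.
by case/orP=> /andP[->] /orP[] ->; rewrite ?orbT.
Qed.

Lemma deg0 e v : deg e v set0 = 0%N.
Proof.
apply/eqP; rewrite cards_eq0; apply/eqP/setP => i.
by rewrite !inE !andbF.
Qed.

Definition lk_incidence f A (p : pairs) : nat :=
  (\sum_v (p \in star v (lkset f A v)))%N.

Lemma lk_incidence_le f A p : (lk_incidence f A p <=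
  (p.2 \in lkset f A p.1) + (p.1 \in lkset f A p.2))%N.
Proof.
rewrite /lk_incidence.
apply: (@leq_trans (\sum_v ((p.1 == v) && (p.2 \in lkset f A v)) +
                    \sum_v ((p.2 == v) && (p.1 \in lkset f A v)))).
  rewrite -big_split /=; apply: leq_sum => v _; rewrite inE.
  by case: (_ && _) => //; case: (_ && _).
apply: leq_add.
  rewrite (bigD1 p.1) //= eqxx big1 ?addn0 // => v /negPf.
  by rewrite eq_sym => ->.
rewrite (bigD1 p.2) //= eqxx big1 ?addn0 // => v /negPf.
by rewrite eq_sym => ->.
Qed.

Lemma lk_incidence_ge f A p : ((p \in lk f A) <= lk_incidence f A p)%N.
Proof.
rewrite [_ \in lk _ _]inE /lk_incidence; case/boolP: (p.2 \in lkset _ _ _) => [h|_] /=.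
  by rewrite (bigD1 p.1) //= [_ \in star _ _]inE eqxx h.
case/boolP: (p.1 \in lkset _ _ _) => [h|//].
by rewrite (bigD1 p.2) //= [_ \in star _ _]inE eqxx h orbT.
Qed.

Lemma sum_deg_lk e f A :
  (\sum_v deg e v (lkset f A v) = \sum_i lk_incidence f A (e i))%N.
Proof.
rewrite exchange_big /=; apply: eq_bigr => v _.
by rewrite /deg hitsE.
Qed.

Lemma hits_lk_le e f A : (hits e (lk f A) <= \sum_v deg e v (lkset f A v))%N.
Proof.
by rewrite sum_deg_lk hitsE; apply: leq_sum => i _; exact: lk_incidence_ge.
Qed.

Lemma hits_lk_ge2 e f A :
  (\sum_v deg e v (lkset f A v) <= 2 * hits e (lk f A))%N.
Proof.
rewrite sum_deg_lk hitsE big_distrr /=; apply: leq_sum => i _.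
apply: leq_trans (lk_incidence_le _ _ _) _; rewrite [_ \in lk _ _]inE.
by case: (_ \in lkset _ _ _); case: (_ \in lkset _ _ _).
Qed.

(** Disjointness prevents a pair from being counted at both of its ends, which saves the factor 2 of
    the general bound. *)
Lemma hits_lk_ge e f A : [disjoint supp f & A] ->
  (\sum_v deg e v (lkset f A v) <= hits e (lk f A))%N.
Proof.
move=> dA; rewrite sum_deg_lk hitsE; apply: leq_sum => i _.
apply: leq_trans (lk_incidence_le _ _ _) _; rewrite [_ \in lk _ _]inE.
case/boolP: (_ \in lkset f A (e i).1) => [h1|_];
  case/boolP: (_ \in lkset f A (e i).2) => [h2|_] //=.
have := lkset_supp h1; have : (e i).1 \in A by move: h2; rewrite inE => /andP[].
by move=> hA hs; rewrite (disjointFr dA hs) in hA.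
Qed.

Definition lk_dir f A : {set pairs} := [set p | p.2 \in lkset f A p.1].

Definition lk_rev f A : {set pairs} := [set p | p.1 \in lkset f A p.2].

Lemma lkU f A : lk f A = lk_dir f A :|: lk_rev f A.
Proof. by apply/setP => p; rewrite !inE. Qed.

Lemma card_lk_dir f A : #|lk_dir f A| = (\sum_v #|lkset f A v|)%N.
Proof.
rewrite -sum1_card (partition_big fst predT) //=; apply: eq_bigr => v _.
rewrite -sum1_card (reindex_onto (fun w => (v, w)) snd) /=.
  by apply: eq_bigl => w; rewrite [(_, _) \in _]inE !eqxx !andbT.
by case=> a b /= /andP[_ /eqP ->].
Qed.

Lemma card_lk_rev f A : #|lk_rev f A| = (\sum_v #|lkset f A v|)%N.
Proof.
rewrite -sum1_card (partition_big snd predT) //=; apply: eq_bigr => v _.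
rewrite -sum1_card (reindex_onto (fun w => (w, v)) fst) /=.
  by apply: eq_bigl => w; rewrite [(_, _) \in _]inE !eqxx !andbT.
by case=> a b /= /andP[_ /eqP ->].
Qed.

Lemma card_lk_le f A : (#|lk f A| <= 2 * \sum_v #|lkset f A v|)%N.
Proof.
rewrite lkU.
apply: leq_trans (leq_card_setU _ _) _.
by rewrite card_lk_dir card_lk_rev mul2n addnn.
Qed.

Lemma card_lk f A : [disjoint supp f & A] ->
  #|lk f A| = (2 * \sum_v #|lkset f A v|)%N.
Proof.
move=> dA; apply/eqP; rewrite eqn_leq card_lk_le /=.
rewrite lkU.
rewrite cardsU card_lk_dir card_lk_rev [X in (_ - X)%N](_ : _ = 0%N).
  by rewrite subn0 mul2n addnn.
apply/eqP; rewrite cards_eq0; apply/eqP/setP => p; rewrite !inE.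
apply/negP => /andP[/andP[_ fp] /andP[pA _]].
have : p.1 \in supp f by rewrite inE (eqP fp).
by move=> hs; rewrite (disjointFr dA hs) in pA.
Qed.

Lemma lk_mono f A : (forall v j, f v = Some j -> j != s v) ->
  [disjoint lk f A & mono s].
Proof.
move=> fs; rewrite disjoint_subset; apply/subsetP => p; rewrite !inE.
by case/orP=> /andP[_ /eqP /fs]; rewrite // eq_sym.
Qed.

End Links.

Lemma exists_subset_card (T : finType) (A : {set T}) (j : nat) :
  (j <= #|A|)%N -> exists2 B : {set T}, B \subset A & #|B| = j.
Proof.
case/card_geqP => l [ul sl lA]; exists [set x in l].
  by apply/subsetP => x; rewrite inE => /lA.
by rewrite cardsE (card_uniqP _).
Qed.

Lemma exists_fiberwise_subset (T I : finType) (h : T -> I) (A : {set T})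
    (J : {set I}) (j : nat) :
  (forall i, i \in J -> (j <= #|A :&: [set v | h v == i]|)%N) ->
  exists B : {set T}, [/\ B \subset A, forall v, v \in B -> h v \in J &
    forall i, i \in J -> #|B :&: [set v | h v == i]| = j].
Proof.
move=> HA.
have HB i : exists B : {set T}, (i \in J) ==>
    ((B \subset A :&: [set v | h v == i]) && (#|B| == j)).
  case: (boolP (i \in J)) => [/HA /exists_subset_card [B BA Bj]|_].
    by exists B; rewrite BA Bj eqxx.
  by exists set0.
pose Bf i := xchoose (HB i).
have Bfi i : i \in J -> (Bf i \subset A :&: [set v | h v == i]) /\ #|Bf i| = j.
  by move=> iJ; have /implyP/(_ iJ)/andP[? /eqP ?] := xchooseP (HB i).
exists [set v | (h v \in J) && (v \in Bf (h v))]; split.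
- apply/subsetP => v; rewrite inE => /andP[/Bfi[/subsetP h1 _] /h1].
  by rewrite inE => /andP[].
- by move=> v; rewrite inE => /andP[].
move=> i iJ; have [/subsetP h1 <-] := Bfi _ iJ; congr #|pred_of_set _|.
apply/setP => v; rewrite !inE; apply/idP/idP.
  by case/andP=> /andP[_ vB] /eqP <-.
move=> vB; have := h1 v vB; rewrite !inE => /andP[_ /eqP hv].
by rewrite hv iJ vB eqxx.
Qed.

(** * Weak vertices, heavy classes, and vertices attached to weak ones *)

Section Weak.
Variables (R : realType) (n k m : nat).
Local Notation V := 'I_n.
Local Notation pairs := ('I_n * 'I_n)%type.
Local Notation edges := {ffun 'I_m -> 'I_n * 'I_n}.
Variable s : {ffun V -> 'I_k}.
Variables (x L : R).
Implicit Types (e : edges) (f : {ffun V -> option 'I_k}) (A B : {set V}).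

Definition Nr : R := n%:R / k%:R.

Definition unbal : {set 'I_k} :=
  [set i | ~~ ((1 - x) * Nr <= #|cls s i|%:R <= (1 + x) * Nr)].

(** The mean of this degree is about [c ln k], while [L = ep ln k] with [ep] small: a lower tail
    event of probability close to [k ^ (- c)]. *)
Definition weak_to e v j : bool := (deg e v (cls s j))%:R < 2 * L.

Definition weak e : {set V} :=
  [set v | [exists j, [&& j \notin unbal, j != s v & weak_to e v j]]].

Definition heavy e : {set 'I_k} :=
  [set i | (i \notin unbal) && (x * Nr < #|weak e :&: cls s i|%:R)].

Lemma card_lk_out_ge f (X : {set V}) (a : R) : supp f \subset X ->
  (forall v j, f v = Some j -> a <= #|cls s j :\: X|%:R) ->
  2 * a * #|supp f|%:R <= #|lk s f (~: X)|%:R.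
Proof.
move=> fX aX; rewrite card_lk; last first.
  by rewrite disjoint_sym disjoints_subset setCS.
rewrite natrM -mulrA ler_wpM2l // natr_sum natr_cards mulr_sumr.
rewrite big_mkcond /=; apply: ler_sum => v _; rewrite inE.
case fv : (f v) => [j|] //=; rewrite mulr1 (lksetE _ _ fv).
by rewrite setIC -setDE; exact: aX fv.
Qed.

Lemma hits_lk_weak e f A : (forall v j, f v = Some j -> weak_to e v j) ->
  (hits e (lk s f A))%:R <= 2 * L * #|supp f|%:R.
Proof.
move=> fw; apply: (@le_trans _ _ (\sum_v deg e v (lkset s f A v))%:R).
  by rewrite ler_nat hits_lk_le.
rewrite natr_sum natr_cards mulr_sumr [leRHS]big_mkcond /=.
apply: ler_sum => v _; rewrite inE.
case fv : (f v) => [j|] /=; last by rewrite lkset0 // deg0.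
rewrite mulr1 (lksetE _ _ fv); apply: le_trans (ltW (fw v j fv)).
by rewrite ler_nat deg_subset // subsetIr.
Qed.

Lemma card_supp_weight f (I : {set 'I_k}) (y : R) :
  (forall v, f v != None -> s v \in I) ->
  \prod_v (if f v is Some _ then (if s v \in I then y else 0) else 1) =
  y ^+ #|supp f|.
Proof.
move=> fI; rewrite -prodr_const [RHS]big_mkcond /=; apply: eq_bigr => v _.
by rewrite inE; have := fI v; case: (f v) => //= j ->.
Qed.

Lemma card_cls_setU_le (I : {set 'I_k}) : [disjoint I & unbal] ->
  \sum_(v | s v \in I) (1 : R) <= #|I|%:R * ((1 + x) * Nr).
Proof.
move=> dI; rewrite (partition_big s (mem I)) //= natr_cards mulr_suml.
apply: ler_sum => i iI; rewrite mul1r.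
have := disjointFr dI iI; rewrite inE => /negbFE /andP[_].
apply: le_trans; rewrite natr_cards le_eqVlt; apply/orP; left; apply/eqP.
by apply: eq_bigl => v; rewrite inE; case: eqP => [->|]; rewrite ?iI ?andbF.
Qed.

Variables (c be ep g tau : R).
Hypotheses (n0 : (0 < n)%N) (k1 : (1 < k)%N).
Hypothesis mE : m%:R = c * k%:R * ln k%:R * n%:R / 2.
Hypotheses (LE : L = ep * ln k%:R) (be0 : 0 <= be) (x0 : 0 < x) (tau0 : 0 <= tau).
(** The right-hand side is the exponent, in base [1 / k], of the probability of being weak to a
    given class, after tilting by [be] and removing a few exceptional vertices from that class. The
    1 pays for choosing the class; [g] is the surplus that makes weak vertices rare. *)
Hypothesis Hg : 1 + g <= c * (1 - expR (- be)) * (1 - 3 * x - 2 * tau) - 2 * ep * be.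
Hypotheses (c0 : 0 <= c) (g0 : 0 <= g).

Let l : R := ln k%:R.

Lemma Nr_gt0 : 0 < Nr.
Proof. by rewrite divr_gt0 ?ltr0n // ltnW. Qed.

Lemma lnk_gt0 : 0 < l.
Proof. by rewrite ln_gt0 // ltr1n. Qed.

Lemma expR_lnk : expR l = k%:R.
Proof. by rewrite lnK // posrE ltr0n ltnW. Qed.

Lemma m_over_n2 : m%:R / n%:R ^+ 2 = c * l / (2 * Nr).
Proof.
rewrite mE /Nr -/l; field.
by rewrite !pnatr_eq0 -!lt0n n0 (ltnW k1).
Qed.

Lemma rho_ge0 : 0 <= 1 - expR (- be).
Proof. by rewrite subr_ge0 expR_le1 oppr_le0. Qed.

(** Each of the chosen weak vertices costs [k ^ (- (1 + g))], of which one factor [1 / k] pays for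
    the class to which it is weak. The surplus [k ^ (- g)] beats the exponential cost of choosing
    the vertices inside [B1] classes. *)
Lemma heavy_count (B1 : nat) : 1 <= x * Nr ->
  #|[set e | proper s e && (B1 <= #|heavy e|)%N]|%:R <=
  2 ^+ k * expR (B1%:R * ((1 + x) * Nr)) *
  (base R n k m * expR (- (g * l * (B1%:R * (x * Nr))))).
Proof.
move=> xN1.
have l0 := lnk_gt0; have N0 := Nr_gt0.
(* The least integer above [x * Nr]: a heavy class contains at least this many weak vertices, and
   exactly this many are picked in each class. *)
pose s1 := (Num.truncn (x * Nr)).+1.
have [s1l s1u] : x * Nr < s1%:R /\ s1%:R <= 2 * (x * Nr).
  have /andP[h1 h2] := truncn_itv (ltW (mulr_gt0 x0 N0)).
  by split=> //; rewrite /s1 -natr1; lra.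
pose Q (phi : {set 'I_k} * {ffun V -> option 'I_k}) e :=
  [&& proper s e, #|phi.1| == B1, [disjoint phi.1 & unbal],
    [forall v, (phi.2 v != None) ==> (s v \in phi.1)],
    [forall i in phi.1, #|supp phi.2 :&: cls s i| == s1] &
    [forall v, if phi.2 v is Some j then
       [&& j \notin unbal, j != s v & weak_to e v j] else true]].
(* The labels at a vertex of a chosen class have total weight 1, so such a vertex contributes
   [1 + 1 <= expR 1], and all other vertices contribute 1. *)
pose w (phi : {set 'I_k} * {ffun V -> option 'I_k}) : R :=
  if (#|phi.1| == B1) && [disjoint phi.1 & unbal] then
    \prod_v (if phi.2 v is Some _ then (if s v \in phi.1 then k%:R^-1 else 0) else 1)
  else 0.
pose X := base R n k m * expR (- (g * l * (B1 * s1)%:R)).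
have base0 : 0 <= base R n k m.
  apply: exprn_ge0; rewrite mulr_ge0 ?sqr_ge0 // subr_ge0.
  by rewrite invf_le1 ?ltr0n ?ler1n ltnW // ltnW.
have X0 : 0 <= X by rewrite mulr_ge0 ?expR_ge0.
have w0 phi : 0 <= w phi.
  rewrite /w; case: ifP => // _; apply: prodr_ge0 => v _.
  by case: (phi.2 v) => // _; case: ifP => // _; rewrite invr_ge0.
have PQ e : proper s e && (B1 <= #|heavy e|)%N -> exists phi, Q phi e.
  case/andP=> pe /exists_subset_card[I IH cI].
  have Ih i : i \in I -> (s1 <= #|weak e :&: [set v | s v == i]|)%N.
    move=> /(subsetP IH); rewrite inE => /andP[_ hi].
    have /andP[h1 _] := truncn_itv (ltW (mulr_gt0 x0 N0)).
    by rewrite /s1 -(ltr_nat R); exact: le_lt_trans hi.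
  have [S [SW SI cS]] := exists_fiberwise_subset Ih.
  pose f : {ffun V -> option 'I_k} := [ffun v => if v \in S then
    [pick j | [&& j \notin unbal, j != s v & weak_to e v j]] else None].
  have fS : supp f = S.
    apply/setP => v; rewrite inE ffunE; case: (boolP (v \in S)) => // vS.
    case: pickP => // h; have := subsetP SW v vS; rewrite inE => /existsP[j].
    by rewrite h.
  exists (I, f); rewrite /Q /= pe cI eqxx /=; apply/and4P; split.
  - rewrite disjoint_subset; apply/subsetP => i /(subsetP IH).
    by rewrite inE => /andP[].
  - apply/forallP => v; apply/implyP => fv; apply: SI.
    by rewrite -fS inE.
  - apply/forallP => i; apply/implyP => iI; rewrite fS; apply/eqP.
    by rewrite -[in RHS](cS i iI).
  - apply/forallP => v; rewrite ffunE; case: ifP => // _.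
    by case: pickP.
have QX phi : (exists e, Q phi e) -> #|[set e | Q phi e]|%:R <= w phi * X.
  case: phi => I f [e0 /and5P[_ /= cI dI /forallP fI /andP[/forallP cS /forallP f0]]].
  have fI' v : f v != None -> s v \in I by move=> fv; exact: (implyP (fI v)).
  have f0' v j : f v = Some j -> (j \notin unbal) && (j != s v).
    by move=> fv; have := f0 v; rewrite fv => /and3P[-> -> _].
  have cf : #|supp f| = (B1 * s1)%N.
    rewrite -sum1_card (partition_big s (mem I)) /=; last first.
      by move=> v; rewrite inE => /fI'.
    rewrite -(eqP cI) -sum_nat_const; apply: eq_bigr => i iI.
    rewrite -(eqP (implyP (cS i) iI)) -sum1_card; apply: eq_bigl => v.
    by rewrite !inE.
  pose Fm := lk s f (~: supp f).
  have := @planted_count0 R n k m s set0 Fm 0 be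
    (- (be * (2 * L * #|supp f|%:R))) (Q (I, f)) n0 k1 (lexx _) be0.
  move=> H; apply: (le_trans (H _ _ _)) => {H}.
  - by rewrite -setI_eq0 set0I.
  - by apply: lk_mono => v j /f0' /andP[].
  - move=> e /and5P[pe _ _ _ /andP[_ /forallP fe]]; split => //.
    rewrite mul0r add0r lerN2 ler_wpM2l // hits_lk_weak // => v j fv.
    by have := fe v; rewrite /= fv => /and3P[].
  rewrite cards0 mulr0 sub0r opprK /w /= cI dI /= (card_supp_weight _ fI') cf.
  rewrite /X [leRHS]mulrCA ler_wpM2l // exprVn -expR_lnk expRX -expRN -expRD ler_expR.
  rewrite m_over_n2 LE -/l.
  set S1 : R := (B1 * s1)%:R.
  have cFm : 2 * ((1 - 3 * x - 2 * tau) * Nr) * S1 <= #|Fm|%:R.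
    rewrite /S1 -cf; apply: card_lk_out_ge => // v j fv.
    have /andP[ju _] := f0' v j fv; move: ju; rewrite inE negbK => /andP[jl _].
    have hD : (#|cls s j :\: supp f| + s1 >= #|cls s j|)%N.
      rewrite -(cardsID (supp f) (cls s j)) addnC leq_add2l.
      case: (boolP (j \in I)) => jI.
        by rewrite setIC (eqP (implyP (cS j) jI)).
      rewrite (_ : _ :&: _ = set0) ?cards0 //; apply/setP => v'; rewrite !inE.
      by apply/negP => /andP[/eqP sv /fI']; rewrite sv (negPf jI).
    have : (#|cls s j|)%:R <= #|cls s j :\: supp f|%:R + s1%:R :> R.
      by rewrite -natrD ler_nat.
    have : 0 <= tau * Nr by rewrite mulr_ge0 // ltW.
    lra.
  have S10 : 0 <= S1 by [].
  have h1 : c * l / (2 * Nr) * ((1 - expR (- be)) * (2 * ((1 - 3 * x - 2 * tau) * Nr) * S1))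
     <= c * l / (2 * Nr) * ((1 - expR (- be)) * #|Fm|%:R).
    apply: ler_wpM2l; last by rewrite ler_wpM2l // rho_ge0.
    apply: divr_ge0; apply: mulr_ge0 => //; exact: ltW.
  have h2 : c * l / (2 * Nr) * ((1 - expR (- be)) * (2 * ((1 - 3 * x - 2 * tau) * Nr) * S1))
    = l * S1 * (c * (1 - expR (- be)) * (1 - 3 * x - 2 * tau)).
    by field; rewrite gt_eqF.
  have h3 : l * S1 * (1 + g) <= l * S1 * (c * (1 - expR (- be)) * (1 - 3 * x - 2 * tau) - 2 * ep * be).
    by rewrite ler_wpM2l // mulr_ge0 // ltW.
  rewrite h2 in h1; lra.
have := card_union_le X0 PQ w0 QX; move/le_trans; apply.
apply: ler_pM => //; first exact: sumr_ge0.
  rewrite -(pair_big predT predT (fun I f => w (I, f))) /=.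
  have -> : 2 ^+ k = \sum_(I : {set 'I_k}) (1 : R).
    rewrite sumr_const -natrX; congr (_%:R).
    by rewrite -cardsT -powersetT card_powerset cardsT card_ord.
  rewrite mulr_suml; apply: ler_sum => I _; rewrite mul1r /w /=.
  case: (boolP (_ && _)) => [/andP[/eqP cI dI]|_]; last by rewrite big1 // expR_ge0.
  rewrite (sum_prod_option (fun v o => if o is Some _ then (if s v \in I then k%:R^-1 else 0) else 1)).
  rewrite -cI; apply: le_trans (_ : expR (\sum_v (if s v \in I then 1 else 0)) <= _).
    apply: le_trans (prod_1D_le_exp _ _); last by move=> v; case: ifP.
    apply: ler_prod => v _; case: ifP => _.
      have -> : \sum_(j : 'I_k) k%:R^-1 = 1 :> R.
        rewrite sumr_const card_ord -[LHS]mulr_natr mulVf //.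
        by rewrite pnatr_eq0 -lt0n ltnW.
      by rewrite lexx addr_ge0.
    by rewrite big1 // addr0 ler01 lexx.
  by rewrite ler_expR -big_mkcond /= card_cls_setU_le.
rewrite /X ler_wpM2l // ler_expR lerN2 ler_wpM2l //.
  by rewrite mulr_ge0 // ltW.
by rewrite natrM ler_wpM2l // ltW.
Qed.

Hypotheses (c2 : c <= 2) (x1 : x <= 1).

Lemma card_lk1_le f w : (#|lk s f [set w]| <= 2 * #|[set v | f v == Some (s w)]|)%N.
Proof.
apply: leq_trans (card_lk_le _ _ _) _; rewrite leq_mul2l /=.
rewrite -sum1_card [leqRHS]big_mkcond /=; apply: leq_sum => v _; rewrite inE.
case: eqP => fv.
  by apply: leq_trans (subset_leq_card (_ : _ \subset [set w])) _; 
     [apply/subsetP => u; rewrite !inE => /andP[]|rewrite cards1].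
rewrite leqn0 cards_eq0; apply/eqP/setP => u; rewrite !inE.
by apply/negP => /andP[/eqP -> /eqP].
Qed.

(** The event that weak vertices absorb an average of [L] links from [t0] vertices that are not
    weak. When it fails, at least half of the [2 L] links of a typical moved vertex end outside the
    weak set. *)
Definition attached (t0 : nat) e : bool :=
  [exists f : {ffun V -> option 'I_k}, [&& #|supp f| == t0,
    [disjoint supp f & weak e],
    [forall v, if f v is Some j then
       [&& j \notin unbal, j \notin heavy e & j != s v] else true] &
    L * t0%:R <= (\sum_v deg e v (lkset s f (weak e) v))%:R]].

(** The weak set depends on [e], and guessing it entirely would cost an exponent of order
    [n k ^ (- g)], far more than [l * t0]. Only the weak vertices actually met by a link are
    guessed, each with the class to which it is weak and a position realising the link. That
    position is unlikely to fall on the right pair, and the total entropy becomes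
    [32 l exp (al - g l) t0]. In a class that is not heavy at most [x N] weak vertices are
    available, so [L * t0] links form a large deviation. *)
Lemma attached_count (t0 : nat) (al : R) : 0 <= al -> t0%:R <= 2 * tau * Nr ->
  #|[set e | proper s e && attached t0 e]|%:R <=
  expR (Nr + 32 * l * expR (- (g * l)) * expR al * t0%:R) *
  (base R n k m * expR (- (al * L * t0%:R) + 4 * l * expR al * x * t0%:R +
                        2 * l * t0%:R)).
Proof.
move=> al0 t0N.
have l0 := lnk_gt0; have N0 := Nr_gt0; have k0 : (0 < k)%N by exact: ltnW.
pose fT := {ffun V -> option 'I_k}; pose gT := {ffun V -> option ('I_k * 'I_m)}.
pose Q (phi : fT * gT) e := [&& proper s e, #|supp phi.1| == t0,
   [disjoint supp phi.1 & supp phi.2],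
   [forall v, if phi.1 v is Some j then (j \notin unbal) && (j != s v) else true],
   [forall w, if phi.2 w is Some p then
       [&& s w \notin unbal, p.1 \notin unbal, p.1 != s w, weak_to e w p.1 &
           e p.2 \in lk s phi.1 [set w]] else true] &
   [forall j, #|supp phi.2 :&: cls s j|%:R <= x * Nr] &&
   (L * t0%:R <= (hits e (lk s phi.1 (supp phi.2)))%:R)].
pose T (f : fT) j := [set v | f v == Some j].
(* Price of a weak vertex met by a link: its weakness times one designated position. It is later
   multiplied by the [k * m] choices of class and position. *)
pose y (f : fT) w : R := if s w \in unbal then 0 else
  expR (- ((1 + g) * l)) * (8 * expR al * (2 * #|T f (s w)|%:R) / n%:R ^+ 2).
have y0 f w : 0 <= y f w.
  by rewrite /y; case: ifP => // _; nonneg.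
(* A weight [k ^ (- 2)] per label of [f] keeps the sum over [f] below [exp N]; the factor
   [expR (2 * l * t0)] in [X] compensates for it. *)
pose wt (phi : fT * gT) : R := if #|supp phi.1| == t0 then
   (\prod_v (if phi.1 v is Some _ then k%:R^-1 ^+ 2 else 1)) *
   \prod_w (if phi.2 w is Some _ then y phi.1 w else 1) else 0.
pose X := base R n k m * expR (- (al * L * t0%:R) + 4 * l * expR al * x * t0%:R +
                        2 * l * t0%:R).
have base0 : 0 <= base R n k m.
  apply: exprn_ge0; rewrite mulr_ge0 ?sqr_ge0 // subr_ge0.
  by rewrite invf_le1 ?ltr0n ?ler1n.
have X0 : 0 <= X by rewrite mulr_ge0 ?expR_ge0.
have wt0 phi : 0 <= wt phi.
  rewrite /wt; case: ifP => // _; apply: mulr_ge0; apply: prodr_ge0 => v _.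
    by case: (phi.1 v) => // _; rewrite sqr_ge0.
  by case: (phi.2 v).
have PQ e : proper s e && attached t0 e -> exists phi, Q phi e.
  case/andP=> pe /existsP[f /and4P[cf df /forallP fe Lf]].
  have fe' v j : f v = Some j -> [&& j \notin unbal, j \notin heavy e & j != s v].
    by move=> fv; have := fe v; rewrite fv.
  (* A weak vertex receives a witness only if some position of [e] links it to a vertex labelled by
     [f]. *)
  pose h : gT := [ffun w => if w \in weak e then
     [pick p : 'I_k * 'I_m | [&& p.1 \notin unbal, p.1 != s w, weak_to e w p.1 &
           e p.2 \in lk s f [set w]]] else None].
  have hW w : w \in supp h -> w \in weak e.
    by rewrite inE ffunE; case: ifP.
  have hin w i : w \in weak e -> e i \in lk s f [set w] -> w \in supp h.
    move=> wW ei; rewrite inE ffunE wW; case: pickP => // none.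
    move: wW; rewrite inE => /existsP[j /and3P[j1 j2 j3]].
    by have := none (j, i); rewrite /= j1 j2 j3 ei.
  have hP w p : h w = Some p -> [&& p.1 \notin unbal, p.1 != s w, weak_to e w p.1 &
           e p.2 \in lk s f [set w]].
    by rewrite ffunE; case: ifP => // _; case: pickP => // p' hp [<-].
  have hv w : w \in supp h -> exists v, f v = Some (s w).
    rewrite inE; case hw : (h w) => [p|] // _.
    have /and4P[_ _ _] := hP _ _ hw; rewrite !inE.
    by case/orP=> /andP[/eqP-> /eqP fv]; [exists (e p.2).1|exists (e p.2).2].
  exists (f, h); rewrite /Q /= pe cf /=.
  apply/and5P; split.
  - rewrite disjoint_subset; apply/subsetP => v vf; rewrite inE.
    by apply/negP => /hW; rewrite (disjointFr df vf).
  - apply/forallP => v; case fv : (f v) => [j|] //.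
    by have /and3P[-> _ ->] := fe' _ _ fv.
  - apply/forallP => w; case hw : (h w) => [p|] //.
    have /and4P[-> -> -> ->] := hP _ _ hw; rewrite !andbT.
    have /hv[v /fe' /and3P[]//] : w \in supp h by rewrite inE hw.
  - apply/forallP => j; have [|jn] := boolP [exists w in supp h, s w == j].
      case/existsP=> w /andP[/hv[v fv] /eqP sw].
      have /and3P[ju jh _] := fe' _ _ fv; rewrite sw in ju jh.
      move: jh; rewrite inE ju /= -leNgt; apply: le_trans.
      rewrite ler_nat subset_leq_card // setSI //.
      by apply/subsetP => u /hW.
    have -> : supp h :&: cls s j = set0.
      apply/setP => w; rewrite [RHS]inE; apply/negP => /setIP[wh].
      by rewrite inE => wj; case/existsP: jn; exists w; rewrite wh.
    by rewrite cards0; nonneg.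
  - apply: (le_trans Lf); rewrite ler_nat.
    apply: leq_trans (hits_lk_ge _ _ df) _; apply: subset_leq_card.
    apply/subsetP => i; rewrite inE => ei; rewrite inE.
    move: (ei); rewrite [_ \in lk _ _ (weak e)]inE.
    case/orP; rewrite inE => /andP[wW fv].
      have wh : (e i).2 \in supp h by apply: (hin _ i wW); rewrite !inE eqxx fv.
      by rewrite inE [_ \in lkset _ _ _ _]inE wh fv.
    have wh : (e i).1 \in supp h by apply: (hin _ i wW); rewrite !inE eqxx fv orbT.
    by rewrite inE [X in _ || X]inE wh fv orbT.
have QX phi : (exists e, Q phi e) -> #|[set e | Q phi e]|%:R <= wt phi * X.
  case: phi => f h [e0 /and5P[_ /= cf dfh /forallP f0 /andP[/forallP h0 /andP[/forallP hx _]]]].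
  have f0' v j : f v = Some j -> (j \notin unbal) && (j != s v).
    by move=> fv; have := f0 v; rewrite fv.
  have h0' w p : h w = Some p -> [&& s w \notin unbal, p.1 \notin unbal & p.1 != s w].
    by move=> hw; have := h0 w; rewrite hw => /and5P[-> -> ->].
  pose h1 : {ffun V -> option 'I_k} := [ffun w => omap fst (h w)].
  pose io : {ffun V -> option 'I_m} := [ffun w => omap snd (h w)].
  have sh1 : supp h1 = supp h.
    by apply/setP => w; rewrite !inE ffunE; case: (h w).
  pose Fp := lk s f (supp h).
  pose Y := supp f :|: supp h.
  pose Fm := lk s h1 (~: Y).
  pose Fw w := if w \in supp h then lk s f [set w] else set0.
  have FwFp w : Fw w \subset Fp.
    rewrite /Fw; case: ifP => [wh|_]; last exact: sub0set.
    apply/subsetP => p; rewrite !inE => /orP[] /andP[/eqP -> ->].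
      by move: wh; rewrite !inE => ->.
    by move: wh; rewrite !inE => ->; rewrite orbT.
  have fh v : f v != None -> h v = None.
    move=> fv; apply/eqP; rewrite -[_ == _]negbK; apply/negP => hv.
    have vf : v \in supp f by rewrite inE.
    by have := disjointFr dfh vf; rewrite inE hv.
  have dFw w w' : w != w' -> [disjoint Fw w & Fw w'].
    move=> ww'; rewrite /Fw; case: ifP => wh; last by rewrite -setI_eq0 set0I.
    case: ifP => w'h; last by rewrite -setI_eq0 setI0.
    rewrite disjoint_subset; apply/subsetP => p; rewrite !inE negb_or !negb_and.
    have nw u : u \in supp h -> f u = None.
      rewrite inE => hu; apply/eqP; rewrite -[_ == _]negbK; apply/negP => /fh.
      by move=> hu'; rewrite hu' in hu.
    case/orP=> /andP[/eqP pw /eqP fp]; rewrite pw ww' /=.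
      case: (p.1 =P w') => //= pw'; rewrite pw' (nw _ w'h) in fp; discriminate.
    case: (p.2 =P w') => //= pw'; rewrite pw' (nw _ w'h) in fp; discriminate.
  have := @planted_count R n k m s Fp Fm al be
     (al * (L * t0%:R) - be * (2 * L * #|supp h|%:R)) io Fw (Q (f, h)) n0 k1 al0 be0.
  move=> H; apply: (le_trans (H _ _ FwFp dFw _)) => {H}.
  - rewrite disjoint_subset; apply/subsetP => p pFp; rewrite inE.
    have pY : (p.1 \in Y) && (p.2 \in Y).
      move: pFp; rewrite !inE.
      by case/orP=> /andP[-> /eqP ->]; rewrite ?orbT.
    case/andP: pY => pY1 pY2.
    by apply/negP; rewrite inE => /orP[]; rewrite inE => /andP[];
       rewrite inE ?pY1 ?pY2.
  - apply: lk_mono => w j; rewrite ffunE; case hw : (h w) => [p|] //= [<-].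
    by have /and3P[] := h0' _ _ hw.
  - move=> e /and5P[pe _ _ _ /andP[/forallP he /andP[_ Lh]]]; split => //.
      rewrite lerB // ler_wpM2l //=.
      rewrite -sh1; apply: hits_lk_weak => w j; rewrite ffunE.
      have := he w; rewrite /=; case: (h w) => [p|] //=.
      by case/and5P=> _ _ _ ? _ [<-].
    move=> w i; rewrite ffunE; have := he w; rewrite /=.
    case hw : (h w) => [p|] //= /and5P[_ _ _ _ hp] [<-].
    by rewrite /Fw [w \in _]inE hw.
  have cFp : #|Fp|%:R <= 2 * (x * Nr * t0%:R).
    apply: (@le_trans _ _ (2 * \sum_v #|lkset s f (supp h) v|)%:R).
      by rewrite ler_nat card_lk_le.
    rewrite natrM ler_wpM2l // natr_sum -(eqP cf) natr_cards mulr_sumr [leRHS]big_mkcond /=.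
    apply: ler_sum => v _; rewrite inE; case fv : (f v) => [j|] /=.
      by rewrite mulr1 (lksetE _ _ fv).
    by rewrite lkset0 // cards0.
  have cFm : 2 * ((1 - 3 * x - 2 * tau) * Nr) * #|supp h|%:R <= #|Fm|%:R.
    rewrite -sh1; apply: card_lk_out_ge; first by rewrite sh1 subsetUr.
    move=> w j; rewrite ffunE; case hw : (h w) => [p|] //= [<-].
    have /and3P[_ ju _] := h0' _ _ hw; move: ju; rewrite inE negbK => /andP[jl _].
    have hD : (#|cls s p.1| <= #|cls s p.1 :\: Y| + (t0 + #|supp h :&: cls s p.1|))%N.
      rewrite -(cardsID Y (cls s p.1)) addnC leq_add2l /Y setIUr.
      apply: leq_trans (leq_card_setU _ _) _; rewrite [supp h :&: _]setIC leq_add2r.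
      by rewrite -(eqP cf) subset_leq_card // subsetIr.
    have : #|cls s p.1|%:R <= #|cls s p.1 :\: Y|%:R + (t0%:R + #|supp h :&: cls s p.1|%:R) :> R.
      by rewrite -!natrD ler_nat.
    have := hx p.1; have : 0 <= x * Nr by rewrite mulr_ge0 ?ltW.
    lra.
  rewrite /wt /= cf /X.
  have -> : \prod_v (if f v is Some _ then k%:R^-1 ^+ 2 else 1) = expR (- (2 * l * t0%:R)) :> R.
    rewrite -(eqP cf) -[- _]mulNr -prod_expR_card [RHS]big_mkcond /=; apply: eq_bigr => v _.
    by rewrite inE; case: (f v) => //= _; rewrite exprVn -expR_lnk expRX -expRN mulrC.
  have pr : expR (- ((1 + g) * l) * #|supp h|%:R) *
      \prod_(w | io w != None) (8 * expR al * #|Fw w|%:R / n%:R ^+ 2) <=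
      \prod_w (if h w is Some _ then y f w else 1).
    rewrite -prod_expR_card [X in _ * X](eq_bigl (mem (supp h))); last first.
      by move=> w; rewrite !inE ffunE; case: (h w).
    rewrite -big_split /= [leLHS]big_mkcond /=; apply: ler_prod => w _.
    rewrite inE; case hw : (h w) => [p|] /=; last by rewrite ler01 lexx.
    have /and3P[/negPf su _ _] := h0' _ _ hw; rewrite /y su.
    have Fw0 : Fw w = lk s f [set w] by rewrite /Fw inE hw.
    apply/andP; split; first by nonneg.
    rewrite ler_wpM2l ?expR_ge0 // ler_wpM2r ?invr_ge0 ?sqr_ge0 //.
    rewrite ler_wpM2l ?mulr_ge0 ?expR_ge0 // Fw0 -natrM ler_nat.
    exact: card_lk1_le.
  set PW := \prod_w _ in pr *; set PI := \prod_(w | _) _ in pr *.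
  have PI0 : 0 <= PI by apply: prodr_ge0 => w _; nonneg.
  have rearr (a p b d : R) : a * p * (b * d) = b * (a * d * p) by ring.
  rewrite -[leLHS]mulrA rearr.
  rewrite ler_wpM2l // -expRD.
  apply: (@le_trans _ _ (expR (- (al * L * t0%:R) + 4 * l * expR al * x * t0%:R) *
    (expR (- ((1 + g) * l) * #|supp h|%:R) * PI))); last first.
    apply: ler_pM => //; rewrite ?expR_ge0 //.
      by rewrite mulr_ge0 ?expR_ge0.
    by rewrite ler_expR; lra.
  rewrite [leRHS]mulrA -expRD; apply: ler_wpM2r => //.
  rewrite ler_expR m_over_n2 LE -/l; set S1 : R := #|supp h|%:R in cFm *.
  have S10 : 0 <= S1 by [].
  have q0 : 0 <= c * l / (2 * Nr).
    by apply: divr_ge0; apply: mulr_ge0 => //; exact: ltW.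
  have e1 : c * l / (2 * Nr) * ((1 - expR (- be)) * (2 * ((1 - 3 * x - 2 * tau) * Nr) * S1))
     <= c * l / (2 * Nr) * ((1 - expR (- be)) * #|Fm|%:R).
    by apply: ler_wpM2l => //; rewrite ler_wpM2l // rho_ge0.
  have e2 : c * l / (2 * Nr) * ((1 - expR (- be)) * (2 * ((1 - 3 * x - 2 * tau) * Nr) * S1))
    = l * S1 * (c * (1 - expR (- be)) * (1 - 3 * x - 2 * tau)).
    by field; rewrite gt_eqF.
  have e3 : l * S1 * (1 + g) <= l * S1 * (c * (1 - expR (- be)) * (1 - 3 * x - 2 * tau) - 2 * ep * be).
    by rewrite ler_wpM2l // mulr_ge0 // ltW.
  have e4 : c * l / (2 * Nr) * (2 * expR al * #|Fp|%:R) <= 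
     c * l / (2 * Nr) * (2 * expR al * (2 * (x * Nr * t0%:R))).
    by apply: ler_wpM2l => //; rewrite ler_wpM2l // mulr_ge0 // expR_ge0.
  have e5 : c * l / (2 * Nr) * (2 * expR al * (2 * (x * Nr * t0%:R))) =
     c * (2 * l * expR al * x * t0%:R) by field; rewrite gt_eqF.
  have e6 : c * (2 * l * expR al * x * t0%:R) <= 2 * (2 * l * expR al * x * t0%:R).
    by apply: ler_wpM2r => //; nonneg.
  rewrite e2 in e1; rewrite e5 in e4; lra.
have := card_union_le X0 PQ wt0 QX; move/le_trans; apply.
rewrite ler_wpM2r //.
rewrite -(pair_big predT predT (fun f h => wt (f, h))) /=.
set E1 := 32 * l * expR (- (g * l)) * expR al * t0%:R.
apply: (@le_trans _ _ (\sum_(f : fT) \prod_v (if f v is Some _ then k%:R^-1 ^+ 2 else 1) * expR E1)).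
  apply: ler_sum => f _; rewrite /wt /=.
  case: (boolP (#|supp f| == t0)) => cf; last first.
    rewrite big1 // mulr_ge0 ?expR_ge0 // prodr_ge0 // => v _.
    by case: (f v) => // _; rewrite sqr_ge0.
  rewrite -mulr_sumr ler_wpM2l //.
    by rewrite prodr_ge0 // => v _; case: (f v) => // _; rewrite sqr_ge0.
  rewrite (sum_prod_option (fun w o => if o is Some _ then y f w else 1)).
  apply: (@le_trans _ _ (\prod_w (1 + k%:R * m%:R * y f w))).
    rewrite le_eqVlt; apply/orP; left; apply/eqP; apply: eq_bigr => w _.
    by rewrite sumr_const card_prod !card_ord -[X in _ + X = _]mulr_natl natrM.
  apply: le_trans (prod_1D_le_exp _ _) _; first by move=> w; rewrite !mulr_ge0.
  rewrite ler_expR.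
  have yE w : k%:R * m%:R * y f w = 
     if s w \in unbal then 0 else (8 * c * l * expR (- (g * l)) * expR al / Nr) * #|T f (s w)|%:R.
    rewrite /y; case: ifP => _; first by rewrite mulr0.
    rewrite mulrDl mul1r opprD expRD [expR (- l)]expRN expR_lnk.
    transitivity (m%:R / n%:R ^+ 2 * (16 * expR (- (g * l)) * expR al * #|T f (s w)|%:R)).
      by field; rewrite !pnatr_eq0 -!lt0n k0 n0.
    by rewrite m_over_n2; field; rewrite gt_eqF.
  under eq_bigr do rewrite yE.
  rewrite (partition_big s predT) //=.
  apply: (@le_trans _ _ (\sum_j (16 * c * l * expR (- (g * l)) * expR al) * #|T f j|%:R)).
    apply: ler_sum => j _.
    have cc0 : 0 <= c * l * expR (- (g * l)) * expR al by nonneg.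
    case: (boolP (j \in unbal)) => ju.
      rewrite big1 => [|w /eqP ->]; last by rewrite ju.
      by apply: mulr_ge0 => //; lra.
    rewrite (eq_bigr (fun=> (8 * c * l * expR (- (g * l)) * expR al / Nr) * #|T f j|%:R)); last first.
      by move=> w /eqP ->; rewrite (negPf ju).
    rewrite sum_const_pred mulrA ler_wpM2r //.
    have jc : #|[set i | s i == j]|%:R <= 2 * Nr.
      move: ju; rewrite inE negbK => /andP[_] /le_trans; apply.
      by rewrite ler_pM2r // (natrD R 1 1) lerD2l.
    have h := ler_wpM2l cc0 jc.
    set q : R := #|_|%:R in h *.
    rewrite (_ : q * _ = 8 * (c * l * expR (- (g * l)) * expR al * q) / Nr);
      last by ring.
    rewrite ler_pdivrMr //; lra.
  rewrite -mulr_sumr -natr_sum.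
  have -> : (\sum_i #|T f i|)%N = t0.
    rewrite -(eqP cf); under eq_bigr do rewrite -sum1_card.
    rewrite (exchange_big_dep predT) //= -sum1_card [RHS]big_mkcond /=.
    apply: eq_bigr => v _; rewrite inE; case fv : (f v) => [j|] /=.
      by rewrite (big_pred1 j) // => i; rewrite inE fv eq_sym.
    by rewrite big_pred0 // => i; rewrite inE fv.
  rewrite /E1 ler_wpM2r //.
  have : 0 <= (2 - c) * (l * expR (- (g * l)) * expR al).
    by rewrite mulr_ge0 ?subr_ge0 //; nonneg.
  lra.
rewrite -mulr_suml expRD ler_wpM2r ?expR_ge0 //.
rewrite (sum_prod_option (fun w o => if o is Some _ then k%:R^-1 ^+ 2 else 1)).
have -> : \sum_(j : 'I_k) k%:R^-1 ^+ 2 = k%:R^-1 :> R.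
  rewrite sumr_const card_ord -[LHS]mulr_natr; field.
  by rewrite pnatr_eq0 -lt0n.
apply: le_trans (prod_1D_le_exp _ _) _ => [v|]; first by rewrite invr_ge0.
by rewrite ler_expR sumr_const card_ord -[leLHS]mulr_natl.
Qed.

End Weak.

(** * Improbability of the patterns found on the boundary of a basin *)

Section Crossing.
Variables (R : realType) (n k m : nat).
Local Notation V := 'I_n.
Local Notation pairs := ('I_n * 'I_n)%type.
Local Notation edges := {ffun 'I_m -> 'I_n * 'I_n}.
Variable s : {ffun V -> 'I_k}.
Variables (E : {set 'I_k}) (rep : {ffun 'I_k -> option 'I_k}).
Implicit Types (e : edges) (f : {ffun V -> option 'I_k}).
Local Notation N := (Nr R n k).

(** [rep j = Some i] means that color [j] is now carried by almost all of class [i]. Free colors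
    represent no class; lost rows are the ordinary classes that no color represents. *)
Definition free : {set 'I_k} := [set j | rep j == None].
Definition reprows : {set 'I_k} := [set i | [exists j, rep j == Some i]].
Definition lostrows : {set 'I_k} := ~: (E :|: reprows).

Definition tlab f : {ffun V -> option 'I_k} := [ffun v => obind rep (f v)].

(** Pairs from different classes of [s] that share a free color. Being properly colored by [s] does
    not keep [e] away from them, yet the new coloring makes them monochromatic, so low energy forces
    few hits. *)
Definition clash f : {set pairs} := [set p | (s p.1 != s p.2) &&
  (if f p.1 is Some j then (j \in free) && (f p.2 == Some j) else false)].

Definition cell f i j : {set V} := [set v | (s v == i) && (f v == Some j)].
Definition column f j : {set V} := [set v | f v == Some j].

Lemma card_clash f : (#|clash f| + \sum_(j in free) \sum_i #|cell f i j| ^ 2 =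
  \sum_(j in free) #|column f j| ^ 2)%N.
Proof.
have cj j : (#|column f j| ^ 2 = #|[set p in clash f | f p.1 == Some j]| * (j \in free) +
   (if j \in free then \sum_i #|cell f i j| ^ 2 else 
     #|column f j| ^ 2))%N.
  case: (boolP (j \in free)) => jf; last by rewrite muln0.
  rewrite muln1 expnS expn1 -cardsX -[LHS](cardsID (mono s)) addnC; congr (_ + _)%N.
    apply: eq_card => p; rewrite !inE; case: (f p.1 =P Some j) => [->|]; last by rewrite !andbF.
    by rewrite jf !andbT.
  rewrite -sum1_card (partition_big (fun p : pairs => s p.1) predT) //=.
  apply: eq_bigr => i _; rewrite expnS expn1 -cardsX -sum1_card; apply: eq_bigl => p.
  rewrite !inE; case: (s p.1 =P i) => [->|]; last by rewrite andbF.
  rewrite andbT /= [i == _]eq_sym.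
  by case: (f p.1 == _); case: (f p.2 == _); case: (s p.2 == i).
under [RHS]eq_bigr => j jf do rewrite cj jf muln1.
rewrite big_split /=; congr (_ + _)%N.
rewrite -sum1_card (partition_big (fun p : pairs => odflt (s p.1) (f p.1)) (mem free)) /=.
  apply: eq_bigr => j jf; rewrite -sum1_card; apply: eq_bigl => p; rewrite !inE.
  case: (f p.1) => [j'|]; last by rewrite !andbF.
  by rewrite /= -[Some _ == _]/(j' == j).
by move=> p; rewrite inE; case: (f p.1) => [j|]; rewrite ?andbF //= => /andP[_ /andP[]].
Qed.

Lemma card_column f j : #|column f j| = (\sum_i #|cell f i j|)%N.
Proof.
rewrite -sum1_card (partition_big s predT) //=; apply: eq_bigr => i _.
by rewrite -sum1_card; apply: eq_bigl => v; rewrite !inE andbC.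
Qed.

(** A free column holds [X] vertices from lost rows and [Z] from the others. The entropy of choosing
    the latter is weighed against the clashes, bounded below by the square of the column minus that
    of its cells. The square of [Nn - (X + Z)] is completed. The extra [b0] in front of [X] comes
    from the fact that no lost row is concentrated on one free color, and it is the whole gain. *)
Lemma column_ineq (c' b b0 x Nn X Z : R) : 0 < Nn -> 0 <= c' -> 0 <= X -> 0 <= Z ->
  0 <= b0 * x -> 1 + c' * b / 2 <= c' ->
  Z - c' / (2 * Nn) * ((X + Z) ^+ 2 - b * Nn * Z - (1 - b0) * (1 + x) * Nn * X) <=
  c' / 2 * (Nn - (1 + b0 - x) * X).
Proof.
move=> N0 c0 X0 Z0 bx hb.
have h1 : Z * (1 + c' * b / 2) <= Z * c' by rewrite ler_wpM2l.
have h2 : 0 <= c' / (2 * Nn) * (Nn - (X + Z)) ^+ 2.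
  by rewrite mulr_ge0 ?sqr_ge0 // divr_ge0 //; lra.
have h3 : 0 <= c' / 2 * (b0 * x * X) by rewrite mulr_ge0 ?(mulr_ge0 bx X0) //; lra.
have e1 : c' / (2 * Nn) * (Nn - (X + Z)) ^+ 2 =
  c' / 2 * Nn - c' * (X + Z) + c' / (2 * Nn) * (X + Z) ^+ 2.
  by field; lra.
have e2 : c' / (2 * Nn) * ((X + Z) ^+ 2 - b * Nn * Z - (1 - b0) * (1 + x) * Nn * X) =
  c' / (2 * Nn) * (X + Z) ^+ 2 - c' * b / 2 * Z - c' / 2 * ((1 - b0) * (1 + x) * X).
  by field; lra.
rewrite e2; rewrite e1 in h2; lra.
Qed.

Variables (x L b b0 th : R) (t0 K B : nat).

(** Everything about the pattern that, once [E] and [rep] are fixed, does not involve [e]; the union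
    bound then runs over such [f]. *)
Definition admissible f : bool :=
  [&& [forall v, (f v != None) ==> (s v \notin E)],
      [forall v, if tlab f v is Some l then l != s v else true],
      [forall l in reprows, #|supp f :&: cls s l|%:R <= b * N],
      [forall i in lostrows, [&& (1 - x) * N <= #|cls s i|%:R <= (1 + x) * N,
         #|cls s i :\: supp f|%:R <= x * N &
         [forall j in free, #|cell f i j|%:R <= (1 - b0) * #|cls s i|%:R]]] &
      [&& #|free| == (K + #|E|)%N, (#|E| <= B)%N & #|lostrows| == K]].

(** Two unlikely features of a low-energy coloring on the boundary: free colors are nearly free of
    conflicts, and vertices that joined a represented class have many links to the few vertices that
    left it. *)
Definition crossing e : bool :=
  [exists f, [&& admissible f, (hits e (clash f))%:R <= th * n%:R &
    (L * (#|supp (tlab f)|%:R - t0%:R) - th * n%:R) / 2 <=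
      (hits e (lk s (tlab f) (supp f)))%:R]].

Variables (c al be ep : R).
Hypotheses (n0 : (0 < n)%N) (k1 : (1 < k)%N).
Hypothesis mE : m%:R = c * k%:R * ln k%:R * n%:R / 2.
Hypotheses (LE : L = ep * ln k%:R) (be0 : 0 <= be) (al0 : 0 <= al).
Hypotheses (x0 : 0 <= x) (x1 : x <= 1) (b00 : 0 <= b0) (b01 : b0 <= 1) (b_ge0 : 0 <= b).
Hypotheses (c0 : 0 <= c) (c2 : c <= 2).
Let c' : R := c * (1 - expR (- be)).
Hypothesis Hb : 1 + c' * b / 2 <= c'.
(** Each vertex that joined a represented class gains [al * ep / 2] through its links. This pays 2
    for its label, 2 for the lost-row vertex that it may hide from the free columns, and the tilted
    mean of its links. *)
Hypothesis HT : 4 + 4 * expR al * b <= al * ep / 2.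

Let l : R := ln k%:R.

Let rho1 : 0 <= 1 - expR (- be).
Proof. by rewrite subr_ge0 expR_le1 oppr_le0. Qed.

Let c'0 : 0 <= c'.
Proof. exact: mulr_ge0. Qed.

Let c'2 : c' <= 2.
Proof.
rewrite /c' -[2]mulr1; apply: ler_pM => //.
by rewrite lerBlDr lerDl expR_ge0.
Qed.

Let slop : R := al * (L * t0%:R + th * n%:R) / 2 + be * (th * n%:R).
Let score : R := c' / 2 * (B%:R - K%:R * (b0 - 5 * x)).

(** Sum of [column_ineq] over the [K + #|E|] free columns. The lost rows put about [K N] vertices
    there, which cancels [K N] and leaves a multiple of [(#|E| - K b0) N]: enough lost rows outweigh
    any bounded number of exceptional classes. *)
Lemma score_le f : admissible f ->
  \sum_(v | (s v \notin lostrows) && (if f v is Some j then j \in free else false)) 1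
  + 2 * #|supp (tlab f)|%:R - al * ep / 2 * #|supp (tlab f)|%:R
  + 4 * expR al * b * #|supp (tlab f)|%:R
  - c' / (2 * N) * #|clash f|%:R <= score * N.
Proof.
case/and5P=> /forallP a1 /forallP a2 /forallP a3 /forallP a4 /and3P[/eqP a5 a6 /eqP a7].
have N0 : 0 < N by apply: Nr_gt0.
set t : R := #|supp (tlab f)|%:R.
have t0' : 0 <= t by [].
pose X j : R := \sum_(i in lostrows) #|cell f i j|%:R.
pose Z j : R := \sum_(i | i \notin lostrows) #|cell f i j|%:R.
have X0 j : 0 <= X j by apply: sumr_ge0.
have Z0 j : 0 <= Z j by apply: sumr_ge0.
have zE : \sum_(v | (s v \notin lostrows) && (if f v is Some j then j \in free else false)) 1
   = \sum_(j in free) Z j.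
  rewrite /Z exchange_big /=.
  rewrite (partition_big s (fun i => i \notin lostrows)) /=; last by move=> v /andP[].
  apply: eq_bigr => i iJ.
  rewrite (partition_big (fun v => odflt (s v) (f v)) (mem free)) /=; last first.
    by move=> v /andP[/andP[_]]; case: (f v).
  apply: eq_bigr => j jf; rewrite natr_cards; apply: eq_bigl => v.
  rewrite [v \in cell _ _ _]inE.
  case: (s v =P i) => [->|]; last by rewrite !andbF.
  rewrite iJ /= andbT; case: (f v) => [j'|] //=.
  rewrite -[Some _ == _]/(j' == j); case: (j' =P j) => [->|]; last by rewrite andbF.
  by rewrite andbT.
have clE : #|clash f|%:R = \sum_(j in free)
    ((X j + Z j) ^+ 2 - \sum_i #|cell f i j|%:R ^+ 2) :> R.
  rewrite big_split /= sumrN; apply/eqP; rewrite eq_sym subr_eq; apply/eqP.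
  have := card_clash f => /(congr1 (fun u => u%:R : R)); rewrite natrD !natr_sum.
  under [X in _ + X = _ -> _]eq_bigr do rewrite natr_sum.
  under [X in _ + X = _ -> _]eq_bigr do under eq_bigr do rewrite natrX.
  move=> ->; apply: eq_bigr => j _; rewrite natrX; congr (_ ^+ 2).
  by rewrite card_column natr_sum (bigID (mem lostrows)).
have colj j : j \in free ->
   Z j - c' / (2 * N) * ((X j + Z j) ^+ 2 - \sum_i #|cell f i j|%:R ^+ 2) <=
   c' / 2 * (N - (1 + b0 - x) * X j).
  move=> jf; apply: le_trans (column_ineq N0 c'0 (X0 j) (Z0 j) (mulr_ge0 b00 x0) Hb).
  rewrite lerD2l lerN2; apply: ler_wpM2l; first by nonneg.
  rewrite -!addrA lerD2l -opprD lerN2 (bigID (mem lostrows)) /= addrC.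
  apply: lerD.
    rewrite /Z mulr_sumr; apply: ler_sum => i iJ.
    rewrite expr2 ler_wpM2r //; case: (boolP (i \in reprows)) => ir.
      apply: le_trans (implyP (a3 i) ir); rewrite ler_nat subset_leq_card //.
      by apply/subsetP => v; rewrite !inE => /andP[/eqP -> /eqP ->]; rewrite eqxx.
    have iE : i \in E by move: iJ; rewrite inE negbK inE (negPf ir) orbF.
    rewrite (_ : cell f i j = set0) ?cards0; first by nonneg.
    apply/setP => v; rewrite !inE; apply/negP => /andP[/eqP sv /eqP fv].
    by have := a1 v; rewrite fv sv iE.
  rewrite /X mulr_sumr; apply: ler_sum => i iJ.
  rewrite expr2 ler_wpM2r //.
  have /and3P[/andP[_ cu] _ /forallP /(_ j) /implyP /(_ jf)] := implyP (a4 i) iJ.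
  move/le_trans; apply; rewrite -mulrA ler_wpM2l // subr_ge0 //.
(* A lost row has at least [(1 - x) N] vertices, at most [x N] of them unlabelled; the others have a
   free color unless they joined a represented class. *)
have sumX : K%:R * ((1 - 2 * x) * N) - t <= \sum_(j in free) X j.
  rewrite /X exchange_big /=.
  have rowi i : i \in lostrows -> (1 - 2 * x) * N <=
     \sum_(j in free) #|cell f i j|%:R + #|supp (tlab f) :&: cls s i|%:R.
    move=> iJ; have /and3P[/andP[cl _] cs _] := implyP (a4 i) iJ.
    have : (#|cls s i| <= \sum_(j in free) #|cell f i j| + #|supp (tlab f) :&: cls s i|
        + #|cls s i :\: supp f|)%N.
      rewrite -(cardsID (supp f) (cls s i)) leq_add2r.
      have -> : (\sum_(j in free) #|cell f i j|)%N =
         #|[set v in cls s i | if f v is Some j then j \in free else false]|.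
        rewrite -[RHS]sum1_card (partition_big (fun v => odflt (s v) (f v)) (mem free)) /=; last first.
          by move=> v; rewrite inE => /andP[_]; case: (f v).
        apply: eq_bigr => j jf; rewrite -sum1_card; apply: eq_bigl => v; rewrite !inE.
        case: (s v == i) => //=; case: (f v) => [j'|] //=.
        rewrite -[Some _ == _]/(j' == j); case: (j' =P j) => [->|]; last by rewrite andbF.
        by move: jf; rewrite inE => ->.
      apply: leq_trans (leq_card_setU _ _); apply: subset_leq_card.
      apply/subsetP => v; rewrite !inE ffunE => /andP[-> fv] /=; rewrite andbT.
      case: (f v) fv => [j|] //= _; rewrite inE.
      by case: (rep j).
    rewrite -(ler_nat R) !natrD natr_sum; lra.
  have h1 : K%:R * ((1 - 2 * x) * N) <= \sum_(i in lostrows)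
     (\sum_(j in free) #|cell f i j|%:R + #|supp (tlab f) :&: cls s i|%:R).
    rewrite -a7 natr_cards mulr_suml; apply: ler_sum => i iJ.
    by rewrite mul1r; exact: rowi.
  rewrite big_split /= in h1.
  have h2 : \sum_(i in lostrows) #|supp (tlab f) :&: cls s i|%:R <= t.
    rewrite -natr_sum ler_nat -[leqRHS]sum1_card (partition_big s predT) //=.
    rewrite [leqRHS](bigID (mem lostrows)) /= -[leqLHS]addn0 leq_add //.
    apply: leq_sum => i _; rewrite -sum1_card leq_eqVlt; apply/orP; left; apply/eqP.
    by apply: eq_bigl => v; rewrite !inE.
  lra.
have sumcol : \sum_(j in free) Z j - c' / (2 * N) * #|clash f|%:R <=
   c' / 2 * ((K + #|E|)%:R * N - (1 + b0 - x) * \sum_(j in free) X j).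
  rewrite clE mulr_sumr -sumrB -a5 natr_cards mulr_suml mulr_sumr -sumrB mulr_sumr.
  by apply: ler_sum => j jf; rewrite mul1r; exact: colj.
rewrite zE.
have EB : #|E|%:R <= B%:R :> R by rewrite ler_nat.
have pos : 0 <= 1 + b0 - x by move: b00 x1; lra.
have h1 : (1 + b0 - x) * (K%:R * ((1 - 2 * x) * N) - t) <=
     (1 + b0 - x) * \sum_(j in free) X j.
  by rewrite ler_wpM2l // pos.
have KN : 0 <= K%:R * N by nonneg.
have h2 : K%:R * N * (1 + b0 - 5 * x) <= K%:R * N * ((1 + b0 - x) * (1 - 2 * x)).
  rewrite ler_wpM2l //.
  have : 0 <= x * (1 - b0) by rewrite mulr_ge0 // subr_ge0.
  have : 0 <= x * x by rewrite mulr_ge0.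
  lra.
have h3 : (1 + b0 - x) * t <= 2 * t by rewrite ler_wpM2r //; move: b01 x0; lra.
have h4 : (#|E|%:R - B%:R) * N <= 0.
  by rewrite pmulr_lle0 // subr_le0.
have h5 : (K + #|E|)%:R * N - (1 + b0 - x) * \sum_(j in free) X j <=
   (B%:R - K%:R * (b0 - 5 * x)) * N + 2 * t.
  rewrite natrD; lra.
have h6 := ler_wpM2l (divr_ge0 c'0 (ler0n R 2)) h5.
have h7 : c' / 2 * (2 * t) <= 2 * t.
  rewrite (_ : _ * _ = c' * t); last by field.
  by rewrite ler_wpM2r.
have h8 : (4 + 4 * expR al * b) * t <= al * ep / 2 * t by rewrite ler_wpM2r.
rewrite /score; lra.
Qed.

(** Free colors are bounded in number, so in a lost row they weigh 1. Elsewhere [1 / k] pays for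
    selecting the moved vertices, and a second [1 / k] for the choice among the represented
    colors. *)
Let y (i : 'I_k) (o : option 'I_k) : R := if o is Some j then
  (if i \in E then 0 else if j \in free then
     (if i \in lostrows then 1 else k%:R^-1) else k%:R^-1 ^+ 2) else 1.

Let y_ge0 i o : 0 <= y i o.
Proof.
rewrite /y; case: o => // j; case: ifP => // _; case: ifP => _; last exact: sqr_ge0.
by case: ifP => // _; rewrite invr_ge0.
Qed.

Let expR_l : expR l = k%:R.
Proof. by rewrite lnK // posrE ltr0n ltnW. Qed.

Lemma prod_weight f : admissible f -> \prod_v y (s v) (f v) = expR (- (l *
  (\sum_(v | (s v \notin lostrows) && (if f v is Some j then j \in free else false)) 1
  + 2 * #|supp (tlab f)|%:R))).
Proof.
case/and5P=> /forallP a1 _ _ _ _.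
rewrite (big_mkcond (fun v => _ && _)) /=.
have -> : #|supp (tlab f)|%:R = \sum_v (if v \in supp (tlab f) then 1 else 0) :> R.
  by rewrite natr_cards big_mkcond.
rewrite [2 * _]mulr_sumr -big_split /= [l * _]mulr_sumr -sumrN expR_sum.
apply: eq_bigr => v _; rewrite [v \in supp _]inE ffunE /y.
have := a1 v; case: (f v) => [j|] /=; last by rewrite andbF mulr0 addr0 mulr0 oppr0 expR0.
move=> /negPf ->; rewrite [j \in free]inE; case rj : (rep j) => [i|] /=.
  by rewrite andbF add0r mulr1 exprVn -expR_l expRX -expRN.
rewrite mulr0 addr0 andbT; case: (boolP (_ \in lostrows)) => _ /=.
  by rewrite mulr0 oppr0 expR0.
by rewrite mulr1 expRN expR_l.
Qed.

(** Only the vertices of the [K] lost rows have weights of order one; every other vertex contributes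
    at most a constant over [k]. The total is a constant times [N], without the factor [ln k]. *)
Lemma sum_weight (f0 : {ffun V -> option 'I_k}) : admissible f0 ->
  \sum_(f : {ffun V -> option 'I_k}) \prod_v y (s v) (f v) <=
  expR ((K + B + 1)%:R * (1 + 2 * K%:R) * N).
Proof.
case/and5P=> _ _ _ /forallP a4 /and3P[/eqP a5 a6 /eqP a7].
have N0 : 0 < N by apply: Nr_gt0.
have k0 : 0 < k%:R :> R by rewrite ltr0n ltnW.
rewrite (sum_prod_option (fun v o => y (s v) o)).
apply: le_trans (prod_1D_le_exp _ _) _ => [v|]; first exact: sumr_ge0.
rewrite ler_expR.
set F : R := (K + B + 1)%:R.
have Ff : #|free|%:R + 1 <= F.
  by rewrite /F addn1 -natr1 lerD2r ler_nat a5 leq_add2l.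
have F0 : 0 <= F by [].
have yi i : \sum_j y i (Some j) <= (if i \in lostrows then F else 0) + F / k%:R.
  apply: (@le_trans _ _ (\sum_j ((if j \in free then (if i \in lostrows then 1 else 0) else 0)
     + (if j \in free then k%:R^-1 else 0) + k%:R^-1 ^+ 2))).
    apply: ler_sum => j _; rewrite /y.
    have i1 : 0 <= k%:R^-1 :> R by rewrite invr_ge0.
    have i2 : 0 <= k%:R^-1 ^+ 2 :> R by exact: sqr_ge0.
    by case: (i \in E); case: (j \in free); case: (i \in lostrows); lra.
  rewrite big_split /= big_split /= -!big_mkcond /=.
  have -> : \sum_(j : 'I_k) k%:R^-1 ^+ 2 = k%:R^-1 :> R.
    by rewrite sumr_const card_ord -[LHS]mulr_natr; field; rewrite gt_eqF.
  rewrite !sum_const_set.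
  have h1 : #|free|%:R * k%:R^-1 + k%:R^-1 <= F / k%:R.
    by rewrite -[X in _ + X]mul1r -mulrDl ler_wpM2r // invr_ge0.
  rewrite -addrA; apply: lerD => //.
  case: ifP => _; rewrite ?mulr0 ?mulr1 //; lra.
apply: (@le_trans _ _ (\sum_v ((if s v \in lostrows then F else 0) + F / k%:R))).
  by apply: ler_sum => v _; exact: yi.
rewrite big_split /= -big_mkcond /=.
have -> : \sum_(v : V) F / k%:R = F * N.
  by rewrite sumr_const card_ord -[LHS]mulr_natr /Nr; field; rewrite gt_eqF.
have hJ : \sum_(v | s v \in lostrows) F <= K%:R * (F * (2 * N)).
  rewrite (partition_big s (mem lostrows)) //= -a7 natr_cards mulr_suml.
  apply: ler_sum => i iJ; rewrite mul1r sum_const_pred mulrC ler_wpM2l //.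
  have /and3P[/andP[_ cu] _ _] := implyP (a4 i) iJ.
  apply: (@le_trans _ _ #|cls s i|%:R).
    rewrite ler_nat subset_leq_card //.
    by apply/subsetP => v; rewrite !inE => /andP[_ ->].
  apply: (le_trans cu); rewrite ler_pM2r // (natrD R 1 1) lerD2l //.
rewrite mulrDr mulr1 mulrDl [leRHS]addrC lerD //.
by apply: (le_trans hJ); rewrite le_eqVlt; apply/orP; left; apply/eqP; ring.
Qed.

Lemma crossing_count :
  #|[set e | proper s e && crossing e]|%:R <=
  expR ((K + B + 1)%:R * (1 + 2 * K%:R) * N) *
  (base R n k m * expR (l * (score * N) + slop)).
Proof.
have N0 : 0 < N by apply: Nr_gt0.
have l0 : 0 < l by rewrite ln_gt0 // ltr1n.
pose Q f e := [&& proper s e, admissible f, (hits e (clash f))%:R <= th * n%:R &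
    (L * (#|supp (tlab f)|%:R - t0%:R) - th * n%:R) / 2 <=
      (hits e (lk s (tlab f) (supp f)))%:R].
pose w f : R := if admissible f then \prod_v y (s v) (f v) else 0.
pose X := base R n k m * expR (l * (score * N) + slop).
have base0 : 0 <= base R n k m.
  apply: exprn_ge0; rewrite mulr_ge0 ?sqr_ge0 // subr_ge0.
  by rewrite invf_le1 ?ltr0n ?ler1n // ltnW.
have X0 : 0 <= X by rewrite mulr_ge0 ?expR_ge0.
have w0 f : 0 <= w f by rewrite /w; case: ifP => // _; apply: prodr_ge0.
have PQ e : proper s e && crossing e -> exists f, Q f e.
  by case/andP=> pe /existsP[f /and3P[a h1 h2]]; exists f; rewrite /Q pe a h1 h2.
have QX f : (exists e, Q f e) -> #|[set e | Q f e]|%:R <= w f * X.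
  case=> e0 /and4P[_ af _ _].
  have /and5P[/forallP a1 /forallP a2 /forallP a3 /forallP a4 _] := af.
  pose Fp := lk s (tlab f) (supp f).
  pose Fm := clash f.
  pose t : R := #|supp (tlab f)|%:R.
  have := @planted_count0 R n k m s Fp Fm al be
    (al * ((L * (t - t0%:R) - th * n%:R) / 2) - be * (th * n%:R)) (Q f) n0 k1 al0 be0.
  move=> H; apply: (le_trans (H _ _ _)) => {H}.
  - rewrite disjoint_subset; apply/subsetP => p; rewrite !inE !ffunE negb_and negbK.
    case/orP=> /andP[_ tp]; apply/orP; right.
      case: (f p.1) tp => [j|] //=; rewrite inE; by case: (rep j).
    case: (f p.1) => [j|] //=; rewrite inE.
    case: (rep j =P None) => //= rj; apply/negP => /eqP fp; move: tp.
    by rewrite fp /= rj.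
  - by rewrite disjoint_subset; apply/subsetP => p; rewrite !inE => /andP[].
  - move=> e /and4P[pe _ h1 h2]; split => //.
    by apply: lerB; apply: ler_wpM2l.
  rewrite /w af (prod_weight af) /X [leRHS]mulrCA ler_wpM2l // -expRD ler_expR.
  rewrite (m_over_n2 n0 k1 mE) LE -/l.
  have cFp : #|Fp|%:R <= 2 * (b * N * t).
    apply: (@le_trans _ _ (2 * \sum_v #|lkset s (tlab f) (supp f) v|)%:R).
      by rewrite ler_nat card_lk_le.
    rewrite natrM ler_wpM2l // natr_sum /t natr_cards mulr_sumr [leRHS]big_mkcond /=.
    apply: ler_sum => v _; rewrite inE; case fv : (tlab f v) => [i|] /=.
      rewrite mulr1 (lksetE _ _ fv); apply: (implyP (a3 i)); rewrite inE.
      move: fv; rewrite ffunE; case: (f v) => [j|] //= rj.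
      by apply/existsP; exists j; rewrite rj.
    by rewrite lkset0 // cards0.
  have sc := score_le af; rewrite -/t in sc.
  set zz := \sum_(v | _) _ in sc *.
  have q0 : 0 <= c * l / (2 * N).
    by apply: divr_ge0; apply: mulr_ge0 => //; exact: ltW.
  have e4 : c * l / (2 * N) * (2 * expR al * #|Fp|%:R) <= 
     c * l / (2 * N) * (2 * expR al * (2 * (b * N * t))).
    by apply: ler_wpM2l => //; rewrite ler_wpM2l // mulr_ge0 // expR_ge0.
  have e5 : c * l / (2 * N) * (2 * expR al * (2 * (b * N * t))) =
     c * (2 * l * expR al * b * t) by field; rewrite gt_eqF.
  have t00 : 0 <= t by [].
  have e6 : c * (2 * l * expR al * b * t) <= 2 * (2 * l * expR al * b * t).
    by apply: ler_wpM2r => //; nonneg.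
  rewrite e5 in e4.
  have e7 : c * l / (2 * N) * ((1 - expR (- be)) * #|Fm|%:R) = l * (c' / (2 * N) * #|Fm|%:R).
    by rewrite /c'; ring.
  have e8 := ler_wpM2l (ltW l0) sc.
  rewrite /slop LE -/l; rewrite -/Fm in e8; lra.
have := card_union_le X0 PQ w0 QX; move/le_trans; apply.
rewrite ler_wpM2r //.
have [f0 af0|none] := pickP admissible; last first.
  by rewrite big1 ?expR_ge0 // => f _; rewrite /w none.
apply: le_trans (sum_weight af0); apply: ler_sum => f _.
by rewrite /w; case: ifP => // _; apply: prodr_ge0.
Qed.

End Crossing.

(** Deleting a smallest element keeps the average above [L]: either that element is at most [L], or
    all elements exceed [L]. *)
Lemma exists_heavy_subset (R : realType) (T : finType) (a : T -> R) (L : R)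
    (A : {set T}) (j : nat) :
  (j <= #|A|)%N -> L * #|A|%:R <= \sum_(v in A) a v ->
  exists2 B : {set T}, B \subset A & #|B| = j /\ L * j%:R <= \sum_(v in B) a v.
Proof.
move: {2}(#|A| - j)%N (erefl (#|A| - j)%N) => d.
elim: d A => [|d IH] A dE jA LA.
  have Aj : #|A| = j by lia.
  by exists A => //; rewrite -Aj.
have [v0 v0A] : exists v, v \in A by apply/set0Pn; rewrite -card_gt0; lia.
pose v := [arg min_(i < v0 in A) a i]%O.
have [vA vmin] : v \in A /\ forall u, u \in A -> a v <= a u.
  by rewrite /v; case: arg_minP.
have cA : #|A| = (#|A :\ v|).+1 by rewrite (cardsD1 v) vA.
have [] := IH (A :\ v); [lia|lia| |].
  have SA : \sum_(u in A) a u = a v + \sum_(u in A :\ v) a u.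
    rewrite (bigD1 v) //=; congr (_ + _); apply: eq_bigl => u.
    by rewrite !inE andbC.
  have [Lv|Lv] := leP (a v) L.
    rewrite SA cA -natr1 in LA; lra.
  apply: (@le_trans _ _ (a v * #|A :\ v|%:R)); first by rewrite ler_wpM2r // ltW.
  rewrite natr_cards mulr_sumr; apply: ler_sum => u; rewrite !inE mulr1 => /andP[_].
  exact: vmin.
by move=> B BA BE; exists B => //; rewrite (subset_trans BA) // subsetDl.
Qed.

(** * The basin of a coloring and the colorings on its boundary *)

Section Barrier.
Variables (R : realType) (n k m : nat).
Local Notation V := 'I_n.
Local Notation pairs := ('I_n * 'I_n)%type.
Local Notation edges := {ffun 'I_m -> 'I_n * 'I_n}.
Variable s : {ffun V -> 'I_k}.
Variable e : edges.
Implicit Types (t : {ffun V -> 'I_k}).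
Local Notation N := (Nr R n k).
Variables (x L b0 th : R) (t0 K B : nat).
Let W := weak s x L e.
Let E := unbal s x :|: heavy s x L e.

Definition aligned t i j : bool :=
  (i \notin E) && ((1 - b0) * #|cls s i|%:R <= #|[set v | (s v == i) && (t v == j)]|%:R).

Definition image_colors t : {set 'I_k} := [set j | [exists i, aligned t i j]].

(** Image colors are counted rather than aligned classes, so that two classes merging into one color
    count as a loss. The count drops by at most one per recoloring, hence the first coloring outside
    has exactly [k - #|E| - K] image colors; this equality is what the boundary analysis uses. *)
Definition basin : {set {ffun V -> 'I_k}} :=
  [set t | (k < #|image_colors t| + #|E| + K)%N].

Hypotheses (n0 : (0 < n)%N) (k1 : (1 < k)%N) (x0 : 0 < x) (x1 : x < 1)
  (b00 : 0 < b0) (b01 : b0 < 1 / 2) (K0 : (0 < K)%N) (L0 : 0 <= L) (th0 : 0 <= th).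
Hypothesis EB : (#|E| <= B)%N.

Lemma cls_balanced i : i \notin E -> (1 - x) * N <= #|cls s i|%:R <= (1 + x) * N.
Proof. by rewrite !inE negb_or negbK => /andP[]. Qed.

Lemma cls_gt0 i : i \notin E -> 0 < #|cls s i|%:R :> R.
Proof.
move=> /cls_balanced /andP[h _]; apply: lt_le_trans h.
by rewrite mulr_gt0 ?Nr_gt0 // subr_gt0.
Qed.

Lemma aligned_uniq t i j j' : aligned t i j -> aligned t i j' -> j = j'.
Proof.
case/andP=> iE h1 /andP[_ h2]; apply/eqP; rewrite -[_ == _]negbK; apply/negP => jj.
have c0 := cls_gt0 iE.
have : (#|[set v | (s v == i) && (t v == j)]| + #|[set v | (s v == i) && (t v == j')]|
    <= #|cls s i|)%N.
  rewrite -cardsUI [X in (_ + X)%N](_ : _ = 0%N).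
    rewrite addn0 subset_leq_card //; apply/subsetP => v.
    by rewrite !inE => /orP[] /andP[].
  apply/eqP; rewrite cards_eq0; apply/eqP/setP => v; rewrite !inE.
  by apply/negP => /andP[/andP[_ /eqP tv] /andP[_ /eqP tv']]; case/eqP: jj; rewrite -tv.
rewrite -(ler_nat R) natrD => h3.
have : (1 - b0) * #|cls s i|%:R > 1 / 2 * #|cls s i|%:R.
  by rewrite ltr_pM2r //; move: b01; lra.
lra.
Qed.

Lemma image_colors_self : image_colors s = ~: E.
Proof.
apply/setP => j; rewrite [LHS]inE [RHS]inE; apply/existsP/idP.
  case=> i /andP[iE h]; have c0 := cls_gt0 iE.
  have [->//|ij] := eqVneq j i.
  move: h; rewrite (_ : [set v | _] = set0).
    rewrite cards0 pmulr_lle0 //; move: b01; lra.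
  apply/setP => v; rewrite !inE; apply/negP => /andP[/eqP -> /eqP iE'].
  by rewrite iE' eqxx in ij.
move=> jE; exists j; rewrite /aligned jE /=.
rewrite (_ : [set v | _] = cls s j).
  rewrite -[leRHS]mul1r ler_wpM2r //; move: b00; lra.
by apply/setP => v; rewrite !inE andbb.
Qed.

Lemma self_basin : s \in basin.
Proof.
rewrite inE image_colors_self; have := cardsC E; rewrite card_ord; lia.
Qed.

(** Recoloring [v] affects only the class of [v], and since [b0 < 1 / 2] a class is aligned with at
    most one color. *)
Lemma image_colors_lip t t' v : (forall u, u != v -> t u = t' u) ->
  (#|image_colors t| <= #|image_colors t'| + 1)%N.
Proof.
move=> tt'.
have same i j : i != s v -> aligned t i j -> aligned t' i j.
  move=> iv /andP[iE h]; rewrite /aligned iE; apply: (le_trans h).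
  rewrite ler_nat subset_leq_card //; apply/subsetP => u; rewrite !inE.
  case/andP=> /eqP su /eqP tu; rewrite -tt' ?su ?tu ?eqxx //.
  by apply: contraNneq iv => <-; rewrite su.
have [j0 aj0|none] := pickP (aligned t (s v)).
  apply: leq_trans (subset_leq_card (_ : _ \subset j0 |: image_colors t')) _.
    apply/subsetP => j; rewrite !inE => /existsP[i aij].
    have [iv|iv] := eqVneq i (s v); last by apply/orP; right; apply/existsP; exists i; exact: same.
    by rewrite iv in aij; rewrite (aligned_uniq aij aj0) eqxx.
  by rewrite cardsU1 addnC leq_add2l; case: (_ \notin _).
apply: leq_trans (leq_addr _ _); apply: subset_leq_card.
apply/subsetP => j; rewrite !inE => /existsP[i aij]; apply/existsP; exists i.
apply: same => //; apply: contraTneq aij => ->; by rewrite none.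
Qed.

Hypothesis pe : proper s e.
Hypothesis natt : ~~ attached s x L t0 e.

Section AtBarrier.
Variable t : {ffun V -> 'I_k}.
Hypothesis tK : (#|image_colors t| + #|E| + K = k)%N.
Hypothesis tH : (hits e (mono t))%:R <= th * n%:R.

Let rep : {ffun 'I_k -> option 'I_k} := [ffun j => [pick i | aligned t i j]].

Let repP j i : rep j = Some i -> aligned t i j.
Proof. by rewrite ffunE; case: pickP => // i' h [<-]. Qed.

Let rep_inj j j' i : rep j = Some i -> rep j' = Some i -> j = j'.
Proof. by move=> /repP h /repP; exact: aligned_uniq. Qed.

Let rep_none j : (rep j == None) = (j \notin image_colors t).
Proof.
rewrite ffunE inE; case: pickP => [i h|h] /=; apply/esym.
  by apply/negbTE; rewrite negbK; apply/existsP; exists i.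
by apply/existsP => -[i]; rewrite h.
Qed.

(** The pattern records the new color of the vertices that are neither weak nor in an exceptional
    class and that do not carry the color representing their own class. *)
Let f : {ffun V -> option 'I_k} := [ffun v =>
  if [|| v \in W, s v \in E | rep (t v) == Some (s v)] then None else Some (t v)].

Let fP v j : f v = Some j -> [/\ v \notin W, s v \notin E, j = t v & rep j != Some (s v)].
Proof.
rewrite ffunE; case: (boolP [|| _, _ | _]) => //; rewrite !negb_or.
by case/and3P=> h1 h2 h3 [<-].
Qed.

Let fN v : f v = None -> [|| v \in W, s v \in E | rep (t v) == Some (s v)].
Proof. by rewrite ffunE; case: (boolP [|| _, _ | _]). Qed.

Let tlabP v l : tlab rep f v = Some l ->
  [/\ v \notin W, s v \notin E, rep (t v) = Some l, l != s v & l \notin E].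
Proof.
rewrite ffunE; case fv : (f v) => [j|] //= rj.
have [h1 h2 jt h3] := fP fv; subst j; split => //.
  by apply: contraNneq h3 => <-; rewrite rj.
by have /andP[] := repP rj.
Qed.

(** Distinct image colors represent distinct classes, so the equality [tK] gives [K + #|E|] free
    colors and [K] lost rows. A represented class has lost at most [b0] of its at most [2 N]
    vertices, whence the parameter [2 * b0]. *)
Lemma barrier_admissible : admissible s E rep x (2 * b0) b0 K B f.
Proof.
have frE : free rep = ~: image_colors t.
  by apply/setP => j; rewrite !inE -[_ == None]/(rep j == None) rep_none inE.
have cfr : #|free rep| = (K + #|E|)%N.
  by rewrite frE; have := cardsC (image_colors t); rewrite card_ord; lia.
have crr : #|reprows rep| = #|image_colors t|.
  have -> : #|image_colors t| = #|[set i | [exists j in image_colors t, rep j == Some i]]|.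
    pose r j := odflt j (rep j).
    have rS j : j \in image_colors t -> rep j = Some (r j).
      by rewrite /r; have := rep_none j; case: (rep j) => //= + ji; rewrite ji.
    rewrite -(card_in_imset (f := r) (D := image_colors t)); last first.
      move=> j j' /rS hj /rS hj' rr; rewrite rr in hj; exact: rep_inj hj hj'.
    apply: eq_card => i; rewrite inE; apply/imsetP/existsP.
      by case=> j ji ->; exists j; rewrite ji (rS j ji) eqxx.
    by case=> j /andP[ji /eqP rj]; exists j => //; have := rS j ji; rewrite rj => -[].
  apply: eq_card => i; rewrite !inE; apply/existsP/existsP => -[j].
    move=> rj; exists j; rewrite rj andbT; apply: negbFE.
    by rewrite -rep_none (eqP rj).
  by case/andP=> _ rj; exists j.
have dER : E :&: reprows rep = set0.
  apply/setP => i; rewrite inE [RHS]inE; apply/negP => /andP[iE].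
  by rewrite inE => /existsP[j /eqP /repP /andP[/negP]].
apply/and5P; split.
- apply/forallP => v; apply/implyP; case fv : (f v) => [j|] // _.
  by have [] := fP fv.
- apply/forallP => v; case tv : (tlab rep f v) => [l|] //.
  by have [] := tlabP tv.
- apply/forallP => l; apply/implyP; rewrite inE => /existsP[j /eqP rj].
  have /andP[lE h] := repP rj; have /andP[_ cu] := cls_balanced lE.
  have : (#|supp f :&: cls s l| + #|[set v | (s v == l) && (t v == j)]| <= #|cls s l|)%N.
    rewrite -cardsUI [X in (_ + X)%N](_ : _ = 0%N).
      rewrite addn0 subset_leq_card //; apply/subsetP => v.
      by rewrite !inE => /orP[] /andP[].
    apply/eqP; rewrite cards_eq0; apply/eqP/setP => v; rewrite !inE.
    apply/negP => /andP[/andP[fv _] /andP[/eqP sv /eqP tv]].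
    case fv' : (f v) fv => [j'|] // _; have [_ _ jt] := fP fv'.
    by rewrite jt tv sv rj eqxx.
  rewrite -(ler_nat R) natrD => h2.
  have h3 : b0 * #|cls s l|%:R <= b0 * (2 * N).
    rewrite ler_pM2l //; apply: (le_trans cu); rewrite ler_pM2r ?Nr_gt0 //.
    by move: x1; lra.
  lra.
- apply/forallP => i; apply/implyP; rewrite inE inE negb_or => /andP[iE ir].
  rewrite (cls_balanced iE) /=; apply/andP; split.
    have ih : i \notin heavy s x L e by move: iE; rewrite inE negb_or => /andP[].
    have iu : i \notin unbal s x by move: iE; rewrite inE negb_or => /andP[].
    move: ih; rewrite inE iu /= -leNgt; apply: le_trans.
    rewrite ler_nat subset_leq_card //; apply/subsetP => v.
    case/setDP; rewrite inE => /eqP sv; rewrite inE negbK => /eqP fv.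
    rewrite inE [v \in cls _ _]inE sv eqxx andbT.
    have /or3P[//|sE|/eqP rv] := fN fv; first by rewrite sv (negPf iE) in sE.
    by case/negP: ir; rewrite inE; apply/existsP; exists (t v); rewrite rv sv.
  apply/forallP => j; apply/implyP; rewrite frE inE => ji.
  have : ~~ aligned t i j by apply: contra ji => h; rewrite inE; apply/existsP; exists i.
  rewrite /aligned iE /= -ltNge => /ltW; apply: le_trans.
  rewrite ler_nat subset_leq_card //; apply/subsetP => v; rewrite !inE.
  by case/andP=> -> /eqP /fP[_ _ <- _]; rewrite eqxx.
- rewrite cfr eqxx EB /=; apply/eqP; rewrite /lostrows.
  have := cardsC (E :|: reprows rep); rewrite card_ord cardsU dER cards0 subn0 crr.
  move=> h; apply: (@addnI (#|E| + #|image_colors t|)%N); rewrite h.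
  by rewrite [(#|E| + _)%N]addnC; exact: esym tK.
Qed.

(** A vertex of [T] joined a class [l] and is not weak, so it has at least [2 L] pairs to [cls s l].
    On average at most [L] lead to weak vertices, since [attached] fails; those leading to vertices
    that kept the color of [l] are monochromatic, at most [th * n] in all. The rest lead to labelled
    vertices, and halving accounts for pairs counted at both ends. *)
Lemma barrier_crossing : crossing s E rep x L (2 * b0) b0 th t0 K B e.
Proof.
apply/existsP; exists f; rewrite barrier_admissible /=; apply/andP; split.
  apply: le_trans tH; rewrite ler_nat hits_subset //; apply/subsetP => p.
  rewrite !inE => /andP[_]; case fp : (f p.1) => [j|] // /andP[_ /eqP fp2].
  by have [_ _ <- _] := fP fp; have [_ _ <- _] := fP fp2.
set g := tlab rep f; set T := supp g.
have gP v l : g v = Some l -> [/\ v \notin W, s v \notin E, rep (t v) = Some l,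
    l != s v & l \notin E] by exact: tlabP.
suff main : L * (#|T|%:R - t0%:R) - th * n%:R <=
    (\sum_v deg e v (lkset s g (supp f) v))%:R.
  have := hits_lk_ge2 s e g (supp f); rewrite -(ler_nat R) natrM.
  by move: main; lra.
have thn : 0 <= th * n%:R by rewrite mulr_ge0.
have [Tt0|Tt0] := ltnP #|T| t0.
  apply: (@le_trans _ _ 0) => //.
  have : L * (#|T|%:R - t0%:R) <= 0.
    by rewrite mulr_ge0_le0 // subr_le0 ler_nat ltnW.
  by move: thn; lra.
pose A := [set w | rep (t w) == Some (s w)].
have dTA : [disjoint supp g & A].
  rewrite disjoint_subset; apply/subsetP => v; rewrite !inE.
  case gv : (g v) => [l|] // _; have [_ _ rv lv _] := gP _ _ gv.
  by rewrite rv.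
have hA : ((\sum_v deg e v (lkset s g A v))%:R <= th * n%:R).
  apply: le_trans tH; rewrite ler_nat; apply: leq_trans (hits_lk_ge _ _ dTA) _.
  apply: hits_subset; apply/subsetP => p; rewrite [_ \in mono _]inE inE.
  case/orP; rewrite !inE => /andP[/eqP r1 /eqP gv];
    have [_ _ r2 _ _] := gP _ _ gv; first by rewrite (rep_inj r2 r1).
  by rewrite (rep_inj r2 r1).
have hW : (\sum_v deg e v (lkset s g W v))%:R <= L * #|T|%:R.
  rewrite leNgt; apply/negP => hlt; case/negP: natt.
  have hsum : L * #|T|%:R <= \sum_(v in T) (deg e v (lkset s g W v))%:R.
    apply: (le_trans (ltW hlt)); rewrite natr_sum [leRHS]big_mkcond /=.
    apply: ler_sum => v _; rewrite inE; case gv : (g v) => [l|] //=.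
    by rewrite lkset0 // deg0.
  (* [attached] speaks of exactly [t0] vertices, so [T] is thinned out without lowering the
     average. *)
  have [T' TT' [cT' hT']] := exists_heavy_subset Tt0 hsum.
  pose g' : {ffun V -> option 'I_k} := [ffun v => if v \in T' then g v else None].
  have sg' : supp g' = T'.
    apply/setP => v; rewrite inE ffunE; case: (boolP (v \in T')) => // /(subsetP TT').
    by rewrite inE.
  apply/existsP; exists g'; rewrite sg' cT' eqxx /=; apply/and3P; split.
  - rewrite disjoint_subset; apply/subsetP => v /(subsetP TT'); rewrite [v \in T]inE [v \in predC _]inE.
    by case gv : (g v) => [l|] // _; have [] := gP _ _ gv.
  - apply/forallP => v; rewrite ffunE; case: (boolP (v \in T')) => // _.
    case gv : (g v) => [l|] //; have [_ _ _ -> lE] := gP _ _ gv.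
    by move: lE; rewrite inE negb_or => /andP[-> ->].
  - apply: (le_trans hT'); rewrite natr_sum [leLHS]big_mkcond /=.
    apply: ler_sum => v _; case: (boolP (v \in T')) => // vT'.
    rewrite (_ : lkset s g' _ v = lkset s g W v) //.
    by apply/setP => w; rewrite !inE ffunE vT'.
have hall : 2 * L * #|T|%:R <= (\sum_v deg e v (lkset s g (supp f) v))%:R +
   (\sum_v deg e v (lkset s g W v))%:R + (\sum_v deg e v (lkset s g A v))%:R.
  rewrite natr_cards mulr_sumr big_mkcond /= !natr_sum -!big_split /=.
  apply: ler_sum => v _; rewrite inE; case gv : (g v) => [l|] /=; last by rewrite -!natrD.
  have [vW sE rv lv lE] := gP _ _ gv.
  have lu : l \notin unbal s x by move: lE; rewrite inE negb_or => /andP[].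
  rewrite mulr1; apply: (@le_trans _ _ (deg e v (cls s l))%:R).
    rewrite leNgt; apply/negP => hd; case/negP: vW; rewrite inE.
    by apply/existsP; exists l; rewrite lu lv.
  rewrite -!natrD ler_nat.
  apply: (@leq_trans (deg e v (lkset s g (supp f) v :|: lkset s g W v :|: lkset s g A v))).
    apply: deg_subset; apply/subsetP => w; rewrite inE => /eqP sw.
    have wl : w \in cls s l by rewrite inE sw.
    rewrite !(lksetE _ _ gv) !in_setU !in_setI wl !andbT [w \in supp f]inE.
    case fw : (f w) => [j|] //=; have := fN fw; rewrite sw (negPf lE) /=.
    by case/orP=> [->//|rw]; rewrite [w \in A]inE sw rw orbT.
  apply: leq_trans (deg_setU _ _ _ _) _; rewrite leq_add2r.
  exact: deg_setU.
have Lt0 : 0 <= L * t0%:R by rewrite mulr_ge0.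
by move: hall hW hA Lt0; lra.
Qed.

End AtBarrier.

Hypothesis nocross : forall rep, ~~ crossing s E rep x L (2 * b0) b0 th t0 K B e.

Lemma basin_closed t t' v : t \in basin -> (forall u, u != v -> t u = t' u) ->
  (hits e (mono t'))%:R <= th * n%:R -> t' \in basin.
Proof.
rewrite !inE => tb tt' tH; rewrite ltnNge; apply/negP => t'b.
have := image_colors_lip tt' => hl.
have tK : (#|image_colors t'| + #|E| + K = k)%N by lia.
have := barrier_crossing tK tH; apply/negP; exact: nocross.
Qed.

End Barrier.

(** * Unequal class sizes and the cardinality of a basin *)

Section Imbalance.
Variables (R : realType) (n k m : nat).
Local Notation V := 'I_n.
Local Notation edges := {ffun 'I_m -> 'I_n * 'I_n}.
Variable s : {ffun V -> 'I_k}.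
Local Notation N := (Nr R n k).
Hypotheses (n0 : (0 < n)%N) (k1 : (1 < k)%N).

Definition imbalance : R := \sum_i (#|cls s i|%:R / N - 1) ^+ 2.

Let N0 : 0 < N. Proof. exact: Nr_gt0. Qed.
Let kN : k%:R * N = n%:R.
Proof. by rewrite /Nr mulrCA mulfV ?mulr1 // pnatr_eq0 -lt0n ltnW. Qed.

Lemma card_mono_imbalance : #|mono s|%:R = N ^+ 2 * (k%:R + imbalance).
Proof.
have -> : imbalance = \sum_i ((#|cls s i|%:R ^+ 2) / N ^+ 2 - 2 / N * #|cls s i|%:R + 1).
  by apply: eq_bigr => i _; field; rewrite gt_eqF.
rewrite big_split /= big_split /= sumrN -mulr_sumr -mulr_suml -natr_sum sum_card_cls.
rewrite sumr_const card_ord card_monoE natr_sum -kN.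
under [LHS]eq_bigr do rewrite natrX.
by field; rewrite gt_eqF.
Qed.

(** The excess of [N ^ 2 * imbalance] monochromatic pairs lowers the count by a factor
    [exp (- c * imbalance * l * N / 2)]; the value 26 yields the exponent 13. *)
Lemma imbalanced_count (c : R) : m%:R = c * k%:R * ln k%:R * n%:R / 2 ->
  1 <= c -> 26 <= imbalance ->
  #|[set e : edges | proper s e]|%:R <= base R n k m * expR (- (13 * ln k%:R * N)).
Proof.
move=> mE c1 q26.
have k0 : 0 < k%:R :> R by rewrite ltr0n ltnW.
have l0 : 0 < ln k%:R :> R by rewrite ln_gt0 // ltr1n.
have n00 : 0 < n%:R :> R by rewrite ltr0n.
have c0 : 0 < c by exact: lt_le_trans c1.
have m0 : 0 < m%:R :> R by rewrite mE divr_gt0 // !mulr_gt0.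
have h : 1 * #|[set e : edges | proper s e]|%:R <=
    \prod_(i < m) \sum_(p : V * V) (if p \notin mono s then 1 else 0 : R).
  apply: card_le_prod => [i p|e /forallP pe]; first by case: ifP.
  by rewrite big1 // => i _; rewrite pe.
rewrite mul1r prodr_const card_ord -big_mkcond /= in h; apply: (le_trans h).
rewrite (_ : expR _ = expR (- (13 * ln k%:R * N) / m%:R) ^+ m); last first.
  by rewrite expRX divfK // gt_eqF.
rewrite /base -exprMn; apply: lerXn2r; rewrite ?nnegrE.
- by apply: sumr_ge0.
- rewrite mulr_ge0 ?expR_ge0 // mulr_ge0 ?sqr_ge0 // subr_ge0 invf_le1 //.
  by rewrite ler1n ltnW.
- have -> : \sum_(p | p \notin mono s) (1 : R) = n%:R ^+ 2 - #|mono s|%:R.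
    rewrite -natr_card_pred.
    have -> : [set p | p \notin mono s] = ~: mono s by apply/setP => p; rewrite !inE.
    have := cardsC (mono s); rewrite card_prod card_ord => /(congr1 (fun x => x%:R : R)).
    by rewrite natrD natrM -expr2; lra.
  rewrite card_mono_imbalance.
  have e1 : n%:R ^+ 2 - N ^+ 2 * (k%:R + imbalance) =
     n%:R ^+ 2 * (1 - k%:R^-1 - imbalance / k%:R ^+ 2).
    by rewrite /Nr; field; rewrite gt_eqF.
  rewrite e1 -[leRHS]mulrA ler_wpM2l ?sqr_ge0 //.
  have kinv : k%:R^-1 <= 1 / 2 :> R.
    have k2 : 2 <= k%:R :> R by rewrite (ler_nat R 2).
    by rewrite -div1r ler_pdivrMr //; lra.
  have kinv0 : 0 < k%:R^-1 :> R by rewrite invr_gt0.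
  set u := imbalance / k%:R ^+ 2.
  have u0 : 0 <= u by rewrite divr_ge0 ?sqr_ge0 //; move: q26; lra.
  apply: (@le_trans _ _ ((1 - k%:R^-1) * (1 - u))).
    have : 0 <= k%:R^-1 * u by rewrite mulr_ge0 // ltW.
    lra.
  rewrite ler_wpM2l //; first by lra.
  apply: (le_trans (expR_ge1Dx _)); rewrite ler_expR mulNr lerN2.
  rewrite ler_pdivrMr // mE /u /Nr.
  have -> : imbalance / k%:R ^+ 2 * (c * k%:R * ln k%:R * n%:R / 2) =
     (imbalance * c / 2) * (ln k%:R * (n%:R / k%:R)) by field; rewrite gt_eqF.
  rewrite -mulrA ler_wpM2r //; first by rewrite mulr_ge0 ?divr_ge0 // ltW.
  have : 26 * 1 <= imbalance * c by apply: ler_pM.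
  lra.
Qed.

Lemma card_unbal_le (x : R) : 0 < x -> x ^+ 2 * #|unbal s x|%:R <= imbalance.
Proof.
move=> x0; rewrite natr_cards mulr_sumr /imbalance [leLHS]big_mkcond /=.
apply: ler_sum => i _; case: ifP => [|_]; last exact: sqr_ge0.
rewrite inE negb_and mulr1 -!ltNge.
case/orP=> h.
  have h1 : #|cls s i|%:R / N < 1 - x by rewrite ltr_pdivrMr.
  have : 0 <= (1 - #|cls s i|%:R / N - x) * (1 - #|cls s i|%:R / N + x).
    by rewrite mulr_ge0 //; lra.
  rewrite !expr2; lra.
have h1 : 1 + x < #|cls s i|%:R / N by rewrite ltr_pdivlMr.
have : 0 <= (#|cls s i|%:R / N - 1 - x) * (#|cls s i|%:R / N - 1 + x).
  by rewrite mulr_ge0 //; lra.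
rewrite !expr2; lra.
Qed.

Variable (e : edges).
Variables (x L b0 : R) (K B : nat).
Let E := unbal s x :|: heavy s x L e.
Hypotheses (x0 : 0 < x) (x1 : x < 1) (b00 : 0 < b0) (b01 : b0 < 1 / 2).
Hypothesis EB : (#|E| <= B)%N.
Hypothesis bal : imbalance <= 26.

(** Vertices not explained by alignment: a share [b0] of the aligned classes, at most [K] unaligned
    classes of size at most [2 N], and the exceptional classes, whose sizes are controlled by the
    imbalance. *)
Let M : R := b0 * n%:R + (2 * K%:R + 2 * B%:R + 26) * N.
Let l : R := ln k%:R.

Let rows (t : {ffun V -> 'I_k}) : {ffun 'I_k -> option 'I_k} :=
  [ffun i => [pick j | aligned s e x L b0 t i j]].
Let moved (t : {ffun V -> 'I_k}) : {ffun V -> option 'I_k} :=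
  [ffun v => if rows t (s v) == Some (t v) then None else Some (t v)].

Lemma card_moved t : t \in basin s e x L b0 K -> #|supp (moved t)|%:R <= M.
Proof.
rewrite inE => tb.
have -> : #|supp (moved t)|%:R = \sum_i #|supp (moved t) :&: cls s i|%:R :> R.
  rewrite -natr_sum -sum1_card (partition_big s predT) //=; congr (_%:R).
  apply: eq_bigr => i _; rewrite -sum1_card; apply: eq_bigl => v.
  by rewrite !inE.
pose Nn := [set i | rows t i == None].
apply: (@le_trans _ _ (\sum_i (b0 * #|cls s i|%:R +
   (if i \in Nn then #|cls s i|%:R else 0)))).
  apply: ler_sum => i _; rewrite inE.
  case ri : (rows t i) => [j|] /=; last first.
    apply: (@le_trans _ _ #|cls s i|%:R); first by rewrite ler_nat subset_leq_card // subsetIr.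
    by rewrite lerDr mulr_ge0 // ltW.
  rewrite addr0; have /andP[iE h] : aligned s e x L b0 t i j.
    by move: ri; rewrite ffunE; case: pickP => // j' hj [<-].
  have : (#|supp (moved t) :&: cls s i| + #|[set v | (s v == i) && (t v == j)]| <= #|cls s i|)%N.
    rewrite -cardsUI [X in (_ + X)%N](_ : _ = 0%N).
      rewrite addn0 subset_leq_card //; apply/subsetP => v.
      by rewrite !inE => /orP[] /andP[].
    apply/eqP; rewrite cards_eq0; apply/eqP/setP => v; rewrite !inE [moved t v]ffunE.
    apply/negP => /andP[/andP[fv _] /andP[/eqP sv /eqP tv]].
    by move: fv; rewrite sv tv ri eqxx.
  rewrite -(ler_nat R) natrD => h2; lra.
rewrite big_split /= -mulr_sumr -natr_sum sum_card_cls /M lerD2l -big_mkcond /=.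
have NnE : Nn = E :|: (Nn :\: E).
  apply/setP => i; rewrite in_setU in_setD; case: (boolP (i \in E)) => //= iE.
  rewrite inE ffunE; case: pickP => // j /andP[/negP]; by case.
have cK : (#|Nn :\: E| <= K)%N.
  pose S := [set i | rows t i != None].
  have hS : (#|image_colors s e x L b0 t| <= #|S|)%N.
    pose r i := odflt i (rows t i).
    apply: leq_trans (leq_imset_card r S); apply: subset_leq_card.
    apply/subsetP => j; rewrite inE => /existsP[i aij]; apply/imsetP; exists i.
      by rewrite inE ffunE; case: pickP => // /(_ j); rewrite aij.
    rewrite /r ffunE; case: pickP => [j' aij'|/(_ j)]; last by rewrite aij.
    exact: (aligned_uniq n0 k1 x1 b01 aij aij').
  have dS : [disjoint S & E].
    rewrite disjoint_subset; apply/subsetP => i; rewrite !inE ffunE.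
    by case: pickP => // j /andP[+ _] _; rewrite !inE.
  have : (#|S| + #|E| + #|Nn :\: E| <= k)%N.
    have cSE : #|S :|: E| = (#|S| + #|E|)%N.
      by rewrite cardsU (_ : S :&: E = set0) ?cards0 ?subn0 //; apply/eqP; rewrite setI_eq0.
    rewrite -cSE -[k in (_ <= k)%N]card_ord.
    rewrite -cardsUI [X in (_ + X)%N](_ : _ = 0%N) ?addn0 ?max_card //.
    apply/eqP; rewrite cards_eq0; apply/eqP/setP => i.
    rewrite in_set0 in_setI in_setU in_setD; case: (i \in E) => //=.
      by rewrite andbF.
    by rewrite orbF !inE; case: (rows t i).
  by move: tb hS; rewrite -/E; lia.
rewrite NnE.
apply: (@le_trans _ _ (\sum_(i in E) #|cls s i|%:R + \sum_(i in Nn :\: E) #|cls s i|%:R)).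
  rewrite big_mkcond [X in _ <= X + _]big_mkcond [X in _ <= _ + X]big_mkcond -big_split /=.
  apply: ler_sum => i _; rewrite in_setU.
  by case: (i \in E); case: (i \in Nn :\: E); rewrite /= ?addr0 ?add0r ?lerDl.
have h1 : \sum_(i in Nn :\: E) #|cls s i|%:R <= 2 * K%:R * N.
  apply: (@le_trans _ _ (\sum_(i in Nn :\: E) 2 * N)).
    apply: ler_sum => i; rewrite in_setD => /andP[iE _].
    have /andP[_ /le_trans] := cls_balanced iE; apply.
    by rewrite ler_pM2r //; move: x1; lra.
  rewrite sum_const_set mulrA ler_pM2r // mulrC ler_wpM2l //.
  by rewrite ler_nat.
have h2 : \sum_(i in E) #|cls s i|%:R <= (2 * B%:R + 26) * N.
  (* Exceptional classes may be large; [r <= 2 + (r - 1) ^ 2] bounds their relative sizes by the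
     imbalance. *)
  apply: (@le_trans _ _ (\sum_(i in E) (2 * N + N * (#|cls s i|%:R / N - 1) ^+ 2))).
    apply: ler_sum => i _.
    have -> : #|cls s i|%:R = N * (#|cls s i|%:R / N) :> R by rewrite mulrCA mulfV ?mulr1 ?gt_eqF.
    rewrite [X in _ <= 2 * N + N * (X / N - 1) ^+ 2]mulrC mulfK ?gt_eqF //.
    rewrite [2 * N]mulrC -mulrDr ler_pM2l //.
    set r := _ / N.
    by have := sqr_ge0 (r - 1 - 1 / 2); rewrite !expr2; lra.
  rewrite big_split /= sum_const_set -mulr_sumr.
  have e1 : #|E|%:R * (2 * N) <= B%:R * (2 * N).
    by rewrite ler_pM2r ?ler_nat // mulr_gt0.
  have e2 : N * \sum_(i in E) (#|cls s i|%:R / N - 1) ^+ 2 <= N * 26.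
    rewrite ler_pM2l //; apply: le_trans bal; rewrite /imbalance [leRHS](bigID (mem E)) /=.
    by rewrite lerDl; apply: sumr_ge0 => i _; exact: sqr_ge0.
  lra.
lra.
Qed.

(** A member of the basin is recovered from the color aligned with each class and the new colors of
    the at most [M] moved vertices. *)
Lemma card_basin : #|basin s e x L b0 K|%:R <= (k.+1)%:R ^+ k * expR (n%:R + l * M).
Proof.
have k0 : 0 < k%:R :> R by rewrite ltr0n ltnW.
have expR_l : expR l = k%:R by rewrite lnK // posrE.
have l0 : 0 <= l by rewrite ltW // ln_gt0 // ltr1n.
pose Q (phi : {ffun 'I_k -> option 'I_k} * {ffun V -> option 'I_k}) t :=
  [&& phi.1 == rows t, phi.2 == moved t & #|supp phi.2|%:R <= M].
pose w (phi : {ffun 'I_k -> option 'I_k} * {ffun V -> option 'I_k}) : R :=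
  \prod_v (if phi.2 v is Some _ then k%:R^-1 else 1).
have -> : basin s e x L b0 K = [set t | t \in basin s e x L b0 K].
  by apply/setP => t; rewrite inE.
have := @card_union_le R _ _ (fun t => t \in basin s e x L b0 K) Q w (expR (l * M)).
move/(_ (expR_ge0 _)); move=> H; apply: (le_trans (H _ _ _)) => {H}.
- by move=> t tb; exists (rows t, moved t); rewrite /Q /= !eqxx card_moved.
- by move=> phi; apply: prodr_ge0 => v _; case: (phi.2 v) => // _; rewrite invr_ge0.
- case=> p f [t1 /and3P[/= /eqP pE /eqP fE cf]].
  have c1 : (#|[set t | Q (p, f) t]| <= 1)%N.
    apply/card_le1_eqP => t t'; rewrite !inE => /and3P[/= /eqP p1 /eqP f1 _] /and3P[/= /eqP p2 /eqP f2 _].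
    apply/ffunP => v.
    have := congr1 (fun g : {ffun V -> option 'I_k} => g v) f1.
    rewrite f2 [moved t v]ffunE [moved t' v]ffunE -p1 -p2.
    case: eqP => [h1|_]; case: eqP => [h2|_] //; last by case.
    by move=> _; rewrite h1 in h2; case: h2.
  apply: (@le_trans _ _ 1); first by rewrite -[1]/(1%:R) ler_nat.
  have -> : w (p, f) = expR (- l * #|supp f|%:R).
    rewrite -prod_expR_card [RHS]big_mkcond /=; apply: eq_bigr => v _.
    by rewrite inE /=; case: (f v) => //= _; rewrite expRN expR_l.
  by rewrite -expRD -[leLHS]expR0 ler_expR mulNr addrC subr_ge0 ler_wpM2l.
have -> : \sum_phi w phi = \sum_(p : {ffun 'I_k -> option 'I_k})
    \sum_(f : {ffun V -> option 'I_k}) \prod_v (if f v is Some _ then k%:R^-1 else 1).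
  by rewrite pair_big.
rewrite sumr_const.
rewrite card_ffun card_option !card_ord -[_ *+ (_ ^ _)]mulr_natl natrX expRD mulrA.
rewrite ler_wpM2r ?expR_ge0 // ler_wpM2l ?exprn_ge0 //.
rewrite (sum_prod_option (fun v o => if o is Some _ then k%:R^-1 else 1)).
have -> : \sum_(j : 'I_k) k%:R^-1 = 1 :> R.
  by rewrite sumr_const card_ord -[LHS]mulr_natr mulVf // gt_eqF.
apply: le_trans (prod_1D_le_exp _ _) _ => [v|]; first by [].
by rewrite ler_expR sumr_const card_ord.
Qed.

End Imbalance.

Lemma exists_nat_ge (R : realType) (C : R) : exists j : nat, C <= j%:R.
Proof.
have [C0|C0] := leP C 0; first by exists 0%N.
exists (Num.truncn C).+1; have /andP[_ /ltW //] := truncn_itv (ltW C0).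
Qed.

Lemma exists_ln_ge (R : realType) (C : R) :
  exists k0 : nat, (1 < k0)%N /\ forall k, (k0 <= k)%N -> C <= ln k%:R :> R.
Proof.
have [j Cj] := exists_nat_ge (expR C).
exists j.+2; split=> // k jk.
have kpos : 0 < k%:R :> R by rewrite ltr0n; lia.
rewrite -[C]expRK ler_ln ?posrE ?expR_gt0 //.
by apply: (le_trans Cj); rewrite ler_nat; lia.
Qed.

(** A small set containing [s] that single recolorings cannot leave while the energy stays at most
    [th * n]; every path of low height from [s] remains inside. *)
Definition trapped (R : realType) n k m (th Dm : R)
    (s : {ffun 'I_n -> 'I_k}) (e : {ffun 'I_m -> 'I_n * 'I_n}) : Prop :=
  exists D : {set {ffun 'I_n -> 'I_k}},
    [/\ s \in D, forall (t t' : {ffun 'I_n -> 'I_k}) v, t \in D ->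
         (forall u, u != v -> t u = t' u) ->
         (hits e (mono t'))%:R <= th * n%:R -> t' \in D & #|D|%:R <= Dm].

Lemma exp2_le (R : realType) (j : nat) : 2 ^+ j <= expR j%:R :> R.
Proof.
have -> : expR j%:R = expR 1 ^+ j :> R by rewrite expRX mul1r.
by apply: lerXn2r; rewrite ?nnegrE ?expR_ge0 //; apply: le_trans (expR_ge1Dx _); lra.
Qed.

Lemma sum5_le (R : realType) (a b c d l : R) : 0 <= a -> 0 <= b -> 0 <= c -> 0 <= d ->
  1 + a + b + c + d <= l -> [/\ 1 <= l, a <= l, b <= l, c <= l & d <= l].
Proof. by move=> *; split; lra. Qed.

Ltac positive := repeat first
  [ exact: expR_gt0 | by [] | apply: mulr_gt0 | rewrite invr_gt0 ].

(** * Choice of the constants and the planted estimate *)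

Section PlantedSummary.
Variables (R : realType) (eps : R).
Hypotheses (e0 : 0 < eps) (e1 : eps <= 1 / 2).

(** Each constant is fixed in terms of the previous ones. [be] gives [exp (- be) = eps / 16] and
    [ep] gives [2 * ep * be = eps / 8], both small against the margin [eps]. [al] gives
    [al * ep / 2 = 12], enough for the cost 4 per joined vertex, and [b0] makes
    [exp al * (2 * b0) = ep / 16]. [al1] makes [al1 * L * t0] worth [20 * l * N] plus [4 * l * t0]
    as soon as [t0 >= tau * N]. [x] comes last, to absorb [exp al1]. *)
Let be : R := ln (16 / eps).
Let ep : R := eps / (16 * be).
Let al : R := 24 / ep.
Let b0 : R := ep * expR (- al) / 32.
Let tau : R := eps / 1000.
Let al1 : R := (20 / tau + 4) / ep.
Let x : R := ep * eps * b0 / 1000 * expR (- al1).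

Let be1 : 1 <= be.
Proof.
rewrite -[1]expRK ler_ln ?posrE ?expR_gt0 ?divr_gt0 //.
have h4 : expR 1 <= 4 :> R.
  have := @expRN1_ge R; rewrite expRN => h.
  have := expR_gt0 (1 : R) => h0.
  rewrite -[leLHS]invrK -[leRHS]invrK lef_pV2 ?posrE ?invr_gt0 //; lra.
apply: (le_trans h4); rewrite ler_pdivlMr //; move: e1; lra.
Qed.

Let rhoE : expR (- be) = eps / 16.
Proof. by rewrite expRN lnK ?posrE ?divr_gt0 // invf_div. Qed.

Let be_gt0 : 0 < be. Proof. by move: be1; lra. Qed.
Let ep0 : 0 < ep. Proof. by rewrite divr_gt0 // mulr_gt0. Qed.
Let ep1 : ep <= 1 / 32.
Proof. by rewrite ler_pdivrMr ?mulr_gt0 //; move: be1 e1; lra. Qed.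
Let epbe : 2 * ep * be = eps / 8.
Proof. by rewrite /ep; field; rewrite gt_eqF. Qed.
Let al0 : 0 < al. Proof. by rewrite divr_gt0. Qed.
Let b00 : 0 < b0. Proof. by rewrite divr_gt0 // mulr_gt0 ?expR_gt0. Qed.
Let b01 : b0 <= ep / 32.
Proof.
rewrite /b0 ler_pM2r ?invr_gt0 // -[leRHS]mulr1 ler_pM2l //.
by rewrite expR_le1 oppr_le0 ltW.
Qed.
Let tau0 : 0 < tau. Proof. by rewrite divr_gt0. Qed.
Let al10 : 0 < al1.
Proof. by rewrite divr_gt0 // addr_gt0 // divr_gt0. Qed.
Let x0 : 0 < x. Proof. by rewrite /x; positive. Qed.
Let eal1 : expR (- al1) <= 1. Proof. by rewrite expR_le1 oppr_le0 ltW. Qed.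
Let b0_small : b0 <= eps / 16.
Proof.
apply: (le_trans b01); rewrite /ep.
have : eps / (16 * be) <= eps.
  by rewrite ler_pdivrMr ?mulr_gt0 // -[leLHS]mulr1 ler_pM2l //; move: be1; lra.
by move: e0; lra.
Qed.

Let x_le1 : x <= b0 / 1000.
Proof.
rewrite /x -[leRHS]mulr1; apply: ler_pM => //; rewrite ?expR_ge0 //.
  by apply: ltW; positive.
rewrite ler_pM2r ?invr_gt0 // -[leRHS]mul1r ler_pM2r //.
by move: ep1 ep0 e1 e0; nra.
Qed.
Let x_le2 : expR al1 * x <= 1 / 1000.
Proof.
have -> : expR al1 * x = ep * eps * b0 / 1000.
  rewrite /x mulrCA -expRD subrr expR0 mulr1 //.
rewrite ler_pM2r ?invr_gt0 // ?ltr0n //.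
have h : ep * eps <= 1 by move: ep1 ep0 e1 e0; nra.
have h' : b0 <= 1 by move: b0_small e1; lra.
have : 0 < ep * eps by rewrite mulr_gt0.
by move: b00; nra.
Qed.

Let eps2 : eps * eps <= eps / 2.
Proof. by rewrite ler_pM2l //; move: e1; lra. Qed.

Section Fixed.
Variables (B1 B2 K : nat).
(** [B1] heavy classes cost at least [20 * l * N]; [B2] bounds the unbalanced classes when the
    imbalance is below 26; [K] is large enough for the score of a crossing to reach [- 40]. *)
Hypothesis HB1 : 40 / (eps * x) <= B1%:R.
Hypothesis HB2 : 26 / x ^+ 2 <= B2%:R.
Let B := (B1 + B2)%N.
Hypothesis HK : (2 * B%:R + 160) / b0 <= K%:R.
Variables (n k m : nat).
Let l : R := ln k%:R.
Let N : R := Nr R n k.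
Hypotheses (n0 : (0 < n)%N) (k1 : (1 < k)%N).
Hypotheses (l1 : 1 <= l) (lB1 : 2 * B1%:R <= l)
  (lK : (K + B + 1)%:R * (1 + 2 * K%:R) <= l) (lal : 2 * (al1 + 32) / eps <= l).
Hypotheses (Ntau : 1 <= tau * N) (Nx : 1 <= x * N)
  (Nk : k%:R + (k%:R + k%:R ^+ 2) <= N).
Variable c : R.
Hypotheses (mE : m%:R = c * k%:R * l * n%:R / 2) (c1 : 1 + eps <= c) (c2 : c <= 2).
Variable s : {ffun 'I_n -> 'I_k}.
Local Notation edges := {ffun 'I_m -> 'I_n * 'I_n}.

Let L : R := ep * l.
Let t0 : nat := (Num.truncn (tau * N)).+1.
(** Chosen so that [(al + be) * th * n = N]: the energy allowed along a path weakens the tilted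
    estimates by at most a factor [exp N]. *)
Let th : R := (k%:R * (al + be))^-1.
Let N0 : 0 < N. Proof. exact: Nr_gt0. Qed.

Let t0l : tau * N <= t0%:R.
Proof. by have /andP[_ /ltW] := truncn_itv (ltW (mulr_gt0 tau0 N0)). Qed.
Let t0u : t0%:R <= 2 * tau * N.
Proof.
have /andP[h _] := truncn_itv (ltW (mulr_gt0 tau0 N0)).
by rewrite /t0 -natr1; move: h Ntau; lra.
Qed.

Let Hg : 1 + eps / 2 <= c * (1 - expR (- be)) * (1 - 3 * x - 2 * tau) - 2 * ep * be.
Proof.
rewrite epbe rhoE.
have hx : x <= eps / 1000 by move: x_le1 b0_small e0; lra.
have h1 : 1 - eps / 200 <= 1 - 3 * x - 2 * tau by rewrite /tau; lra.
have h2 : (1 + eps) * (1 - eps / 16) <= c * (1 - eps / 16).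
  by rewrite ler_wpM2r //; move: e1; lra.
have h3 : (1 + eps) * (1 - eps / 16) * (1 - eps / 200) <=
   c * (1 - eps / 16) * (1 - 3 * x - 2 * tau).
  by apply: ler_pM => //; move: e0 e1; [nra|lra].
have h4 : 1 + eps / 2 + eps / 8 <= (1 + eps) * (1 - eps / 16) * (1 - eps / 200).
  have q2 : 0 <= eps * eps by rewrite mulr_ge0 // ltW.
  have q3 := eps2.
  have : 0 <= eps * eps * eps by rewrite !mulr_ge0 // ltW.
  by move: e0 e1; lra.
lra.
Qed.

Let base0 : 0 <= base R n k m.
Proof.
apply: exprn_ge0; rewrite mulr_ge0 ?sqr_ge0 // subr_ge0.
by rewrite invf_le1 ?ltr0n ?ler1n // ltnW.
Qed.

(** The exceptional classes and their representatives depend on [e], so crossings are excluded for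
    all choices at once; the number of choices depends on [k] only. *)
Definition bad_pair (e : edges) : bool :=
  [|| 26 <= imbalance R s, (B1 <= #|heavy s x L e|)%N, attached s x L t0 e |
    [exists Er : {set 'I_k} * {ffun 'I_k -> option 'I_k},
       crossing s Er.1 Er.2 x L (2 * b0) b0 th t0 K B e]].

Lemma bad_pair_count : #|[set e | proper s e && bad_pair e]|%:R <=
  base R n k m * expR (- (12 * l * N)).
Proof.
have lN1 : 2 <= l * N.
  have h : 2 <= N.
    apply: le_trans Nk; have : 2 <= k%:R :> R by rewrite (ler_nat R 2).
    by have := sqr_ge0 (k%:R : R); lra.
  by apply: (le_trans h); rewrite -[leLHS]mul1r ler_pM2r.
have kn0 : 0 <= k%:R :> R by [].
have k20 : 0 <= k%:R ^+ 2 :> R by exact: sqr_ge0.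
have NlN : N <= l * N by rewrite -[leLHS]mul1r ler_pM2r.
have [q26|q26] := leP 26 (imbalance R s).
  apply: (@le_trans _ _ #|[set e : edges | proper s e]|%:R).
    by rewrite ler_nat subset_leq_card //; apply/subsetP => e; rewrite !inE => /andP[].
  apply: (le_trans (imbalanced_count n0 k1 mE _ q26)); first by move: c1 e0; lra.
  rewrite ler_wpM2l // ler_expR lerN2; move: lN1; rewrite -/l -/N; lra.
pose A1 := [set e : edges | proper s e && (B1 <= #|heavy s x L e|)%N].
pose A2 := [set e : edges | proper s e && attached s x L t0 e].
pose A3 := [set e : edges | proper s e &&
    [exists Er : {set 'I_k} * {ffun 'I_k -> option 'I_k},
       crossing s Er.1 Er.2 x L (2 * b0) b0 th t0 K B e]].
have c0 : 0 <= c by move: c1 e0; lra.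
have x1 : x <= 1 by move: x_le1 b0_small e1; lra.
have be0 : 0 <= be by move: be1; lra.
have h1 : #|A1|%:R <= base R n k m * expR (- (13 * l * N)).
  have := heavy_count s n0 k1 mE (erefl L) be0 x0 (ltW tau0) Hg c0 (divr_ge0 (ltW e0) (ler0n R 2)) B1 Nx.
  move/le_trans; apply; rewrite mulrCA ler_wpM2l // -/l -/N.
  apply: (@le_trans _ _ (expR k%:R * expR (B1%:R * ((1 + x) * N)) *
      expR (- (eps / 2 * l * (B1%:R * (x * N)))))).
    by rewrite ler_wpM2r ?expR_ge0 // ler_wpM2r ?expR_ge0 // exp2_le.
  rewrite -!expRD ler_expR.
  have hB : 20 <= eps / 2 * (B1%:R * x).
    have : 40 <= B1%:R * (eps * x) by rewrite -ler_pdivrMr // mulr_gt0.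
    lra.
  have hB' : 20 * (l * N) <= eps / 2 * (B1%:R * x) * (l * N) by rewrite ler_wpM2r //; move: lN1; lra.
  have hB2 : B1%:R * ((1 + x) * N) <= 2 * B1%:R * N.
    rewrite mulrA ler_pM2r // mulrC ler_wpM2r //; move: x1; lra.
  have hB3 : 2 * B1%:R * N <= l * N by rewrite ler_pM2r.
  by move: Nk NlN; lra.
have h2 : #|A2|%:R <= base R n k m * expR (- (13 * l * N)).
  have := attached_count s n0 k1 mE (erefl L) be0 x0 Hg c0 c2 x1
    (ltW al10) t0u.
  move/le_trans; apply; rewrite mulrCA ler_wpM2l // -/l -/N -expRD ler_expR.
  have t00 : 0 <= t0%:R :> R by [].
  have lt0 : 0 <= l * t0%:R by rewrite mulr_ge0 //; move: l1; lra.
  have f1 : 32 * expR (- (eps / 2 * l)) * expR al1 <= 1.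
    rewrite -mulrA -expRD.
    have hl : al1 + 32 <= eps / 2 * l.
      move: lal; rewrite ler_pdivrMr // => h.
      by lra.
    apply: (@le_trans _ _ (32 * expR (- 32))).
      by rewrite ler_pM2l // ler_expR; lra.
    rewrite expRN ler_pdivrMr ?expR_gt0 // mul1r.
    by apply: le_trans (expR_ge1Dx _); lra.
  have f2 : 32 * l * expR (- (eps / 2 * l)) * expR al1 * t0%:R <= l * t0%:R.
    have := ler_wpM2r lt0 f1; lra.
  have f3 : 4 * l * expR al1 * x * t0%:R <= l * t0%:R.
    have := ler_wpM2r lt0 x_le2; lra.
  have f4 : al1 * L * t0%:R = (20 / tau + 4) * (l * t0%:R).
    by rewrite /L /al1; field; rewrite !gt_eqF.
  have f5 : 20 * (l * N) <= 20 / tau * (l * t0%:R).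
    have -> : 20 * (l * N) = 20 / tau * (l * (tau * N)) by field; rewrite gt_eqF.
    apply: ler_wpM2l; first by rewrite divr_ge0 // ltW.
    by apply: ler_wpM2l => //; move: l1; lra.
  rewrite f4; move: f2 f3 f5 NlN; lra.
have h3 : #|A3|%:R <= base R n k m * expR (- (13 * l * N)).
  pose X := expR ((K + B + 1)%:R * (1 + 2 * K%:R) * N) * (base R n k m *
     expR (l * (c * (1 - expR (- be)) / 2 * (B%:R - K%:R * (b0 - 5 * x)) * N) +
       (al * (L * t0%:R + th * n%:R) / 2 + be * (th * n%:R)))).
  have X0 : 0 <= X by rewrite mulr_ge0 ?expR_ge0 // mulr_ge0 ?expR_ge0.
  have PQ (e : edges) : proper s e && [exists Er : {set 'I_k} * {ffun 'I_k -> option 'I_k},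
       crossing s Er.1 Er.2 x L (2 * b0) b0 th t0 K B e] ->
     exists Er : {set 'I_k} * {ffun 'I_k -> option 'I_k},
       proper s e && crossing s Er.1 Er.2 x L (2 * b0) b0 th t0 K B e.
    by case/andP=> pe /existsP[Er h]; exists Er; rewrite pe.
  have b02 : 2 * b0 = ep * expR (- al) / 16 by rewrite /b0; field.
  have eb : expR al * (2 * b0) = ep / 16.
    by rewrite b02 mulrA mulrCA -expRD subrr expR0 mulr1.
  have cb : 1 <= c * (1 - expR (- be)).
    rewrite rhoE; have h : (1 + eps) * (1 - eps / 16) <= c * (1 - eps / 16).
      by rewrite ler_wpM2r //; move: e1; lra.
    by move: eps2 h e0; lra.
  have cb2 : c * (1 - expR (- be)) <= 2.
    rewrite -[2]mulr1; apply: ler_pM => //; first by rewrite rhoE; move: e1; lra.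
    by rewrite lerBlDr lerDl expR_ge0.
  have Hb : 1 + c * (1 - expR (- be)) * (2 * b0) / 2 <= c * (1 - expR (- be)).
    have h7 : 1 + 7 / 8 * eps <= c * (1 - expR (- be)).
      rewrite rhoE; have h : (1 + eps) * (1 - eps / 16) <= c * (1 - eps / 16).
        by rewrite ler_wpM2r //; move: e1; lra.
      by move: eps2 h e0; lra.
    have h8 : c * (1 - expR (- be)) * b0 <= 2 * b0 by rewrite ler_pM2r.
    rewrite (_ : _ * (2 * b0) / 2 = c * (1 - expR (- be)) * b0); last by field.
    apply: le_trans h7; rewrite lerD2l; apply: (le_trans h8).
    by move: b0_small e0; lra.
  have HT : 4 + 4 * expR al * (2 * b0) <= al * ep / 2.
    rewrite -mulrA eb /al divfK ?gt_eqF //; move: ep1; lra.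
  have QX (Er : {set 'I_k} * {ffun 'I_k -> option 'I_k}) : 
    (exists e : edges, proper s e && crossing s Er.1 Er.2 x L (2 * b0) b0 th t0 K B e) ->
    #|[set e : edges | proper s e && crossing s Er.1 Er.2 x L (2 * b0) b0 th t0 K B e]|%:R <= 1 * X.
    move=> _; rewrite mul1r.
    have b01' : b0 <= 1 by move: b0_small e1; lra.
    have bb : 0 <= 2 * b0 by move: b00; lra.
    exact: (crossing_count s Er.1 Er.2 th t0 K B n0 k1 mE (erefl L) be0 (ltW al0) (ltW x0) x1 (ltW b00) b01' bb c0 c2 Hb HT).
  have := @card_union_le R _ _ _ _ (fun=> 1) X X0 PQ (fun=> ler01) QX.
  move/le_trans; apply=> {PQ QX}.
  have cE : \sum_(Er : {set 'I_k} * {ffun 'I_k -> option 'I_k}) (1 : R) <= expR (k%:R + k%:R ^+ 2).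
    rewrite sumr_const card_prod card_ffun card_option !card_ord.
    rewrite -cardsT -powersetT card_powerset cardsT card_ord natrM !natrX expRD.
    rewrite ler_pM ?exprn_ge0 ?exp2_le //.
    have -> : k%:R ^+ 2 = k%:R * k%:R :> R by rewrite expr2.
    rewrite -expRX; apply: lerXn2r; rewrite ?nnegrE ?expR_ge0 //.
    by rewrite -natr1 addrC expR_ge1Dx.
  apply: (le_trans (ler_wpM2r X0 cE)); rewrite /X.
  have rearr (p q r t : R) : p * (q * (r * t)) = r * (p * q * t) by ring.
  rewrite rearr ler_wpM2l // -!expRD ler_expR.
  have hsc : c * (1 - expR (- be)) / 2 * (B%:R - K%:R * (b0 - 5 * x)) <= - 40.
    have hK : 2 * B%:R + 160 <= K%:R * b0 by rewrite -ler_pdivrMr.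
    have hx5 : K%:R * (b0 / 2) <= K%:R * (b0 - 5 * x).
      by rewrite ler_wpM2l //; move: x_le1 b00; lra.
    have B0 : 0 <= B%:R :> R by [].
    have hneg : B%:R - K%:R * (b0 - 5 * x) <= - 80 by lra.
    have : 1 / 2 * (K%:R * (b0 - 5 * x) - B%:R) <=
        c * (1 - expR (- be)) / 2 * (K%:R * (b0 - 5 * x) - B%:R).
      by rewrite ler_wpM2r //; [move: hneg|move: cb]; lra.
    move: hneg; lra.
  have hsc' : l * (c * (1 - expR (- be)) / 2 * (B%:R - K%:R * (b0 - 5 * x)) * N) <= - 40 * (l * N).
    rewrite mulrCA ler_wpM2r //; move: lN1; lra.
  have kpos : 0 < k%:R :> R by rewrite ltr0n ltnW.
  have ab0 : 0 < al + be by move: al0 be1; lra.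
  have thn : (al + be) * (th * n%:R) = N.
    by rewrite /th /N /Nr; field; rewrite !gt_eqF.
  have thn0 : 0 <= th * n%:R by rewrite mulr_ge0 // invr_ge0 mulr_ge0 // ltW.
  have sl1 : al * L * t0%:R / 2 <= l * N.
    have -> : al * L * t0%:R / 2 = 12 * (l * t0%:R) by rewrite /al /L; field; rewrite gt_eqF.
    have h : l * t0%:R <= l * (2 * tau * N) by rewrite ler_wpM2l //; move: l1; lra.
    have h' : 24 * tau * (l * N) <= 1 * (l * N).
      by rewrite ler_wpM2r //; [move: lN1; lra|rewrite /tau; move: e1; lra].
    lra.
  have sl2 : al * (th * n%:R) / 2 + be * (th * n%:R) <= N.
    have : 0 <= al * (th * n%:R) by rewrite mulr_ge0 // ltW.
    lra.
  have hKB : (K + B + 1)%:R * (1 + 2 * K%:R) * N <= l * N by rewrite ler_pM2r.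
  have hkk : k%:R + k%:R ^+ 2 <= N by move: Nk kn0; lra.
  move: hsc' sl1 sl2 hKB hkk NlN; lra.
have sub : [set e : edges | proper s e && bad_pair e] \subset A1 :|: (A2 :|: A3).
  apply/subsetP => e; rewrite !inE => /andP[-> /=]; rewrite /bad_pair leNgt q26 /=.
  by case/or3P=> ->; rewrite ?orbT.
apply: (@le_trans _ _ (#|A1|%:R + (#|A2|%:R + #|A3|%:R))).
  rewrite -!natrD ler_nat; apply: (leq_trans (subset_leq_card sub)).
  by apply: leq_trans (leq_card_setU _ _) _; rewrite leq_add2l; exact: leq_card_setU.
have h4 : 3 * expR (- (13 * l * N)) <= expR (- (12 * l * N)).
  have -> : - (13 * l * N) = - (12 * l * N) + - (l * N) by ring.
  rewrite expRD mulrCA -[leRHS]mulr1 ler_wpM2l ?expR_ge0 //.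
  rewrite expRN ler_pdivrMr ?expR_gt0 // mul1r.
  by apply: le_trans (expR_ge1Dx _); move: lN1; lra.
have := ler_wpM2l base0 h4; move: h1 h2 h3; lra.
Qed.

Hypothesis kbig : (2 * K%:R + 2 * B%:R + 26) * 16 <= eps * k%:R.

Lemma not_bad_trapped (e : edges) : proper s e -> ~~ bad_pair e ->
  trapped th (k.+1%:R ^+ k * expR (n%:R * (1 + eps / 8 * l))) s e.
Proof.
move=> pe; rewrite /bad_pair !negb_or -!ltNge -ltnNge => /and4P[q26 hv na nc].
have x1 : x < 1 by move: x_le1 b0_small e1; lra.
have b01' : b0 < 1 / 2 by move: b0_small e1; lra.
have L0 : 0 <= L by rewrite mulr_ge0 //; [move: ep0|move: l1]; lra.
have kpos : 0 < k%:R :> R by rewrite ltr0n ltnW.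
have th0 : 0 <= th by rewrite invr_ge0 mulr_ge0 //; move: al0 be1; lra.
have EB : (#|unbal s x :|: heavy s x L e| <= B)%N.
  apply: leq_trans (leq_card_setU _ _) _; rewrite addnC leq_add ?(ltnW hv) //.
  rewrite -(ler_nat R); apply: le_trans HB2; rewrite ler_pdivlMr ?exprn_gt0 // mulrC.
  exact: le_trans (card_unbal_le s n0 k1 x0) (ltW q26).
have K0 : (0 < K)%N.
  rewrite -(ltr_nat R); apply: lt_le_trans HK; rewrite divr_gt0 //.
  by rewrite ltr_wpDl ?mulr_ge0.
exists (basin s e x L b0 K); split.
- exact: self_basin.
- move=> t t' v tb tt' tH; apply: (@basin_closed R n k m s e x L b0 th t0 K B) tb tt' tH => //.
  move=> rep; apply/negP => h; case/negP: nc; apply/existsP.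
  by exists (unbal s x :|: heavy s x L e, rep).
apply: le_trans (card_basin n0 k1 K x0 x1 b00 b01' EB (ltW q26)) _.
rewrite ler_wpM2l ?exprn_ge0 // ler_expR [leRHS]mulrDr mulr1 lerD2l -/l -/N.
have nN : n%:R = k%:R * N by rewrite /N /Nr; field; rewrite gt_eqF.
have h1 : b0 * n%:R <= eps / 16 * n%:R by rewrite ler_wpM2r.
have h2 : (2 * K%:R + 2 * B%:R + 26) * N <= eps / 16 * n%:R.
  rewrite nN mulrA ler_pM2r //; move: kbig; lra.
have l0 : 0 <= l by move: l1; lra.
have h3 : b0 * n%:R + (2 * K%:R + 2 * B%:R + 26) * N <= n%:R * (eps / 8) by lra.
have := ler_wpM2l l0 h3; lra.
Qed.

End Fixed.

Lemma planted_summary : exists k0 : nat, (1 < k0)%N /\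
  forall k, (k0 <= k)%N -> exists (th : R) (n0 : nat), 0 < th /\
  forall n m, (n0 <= n)%N ->
  (1 + eps) * (k%:R * ln k%:R) * n%:R <= 2 * m%:R ->
  2 * m%:R <= 2 * (k%:R * ln k%:R) * n%:R :> R ->
  exists P : {ffun 'I_n -> 'I_k} -> pred {ffun 'I_m -> 'I_n * 'I_n},
  forall s, #|[set e | proper s e && P s e]|%:R <=
     base R n k m * expR (- (12 * ln k%:R * (n%:R / k%:R))) /\
   forall e, proper s e -> ~~ P s e ->
     trapped th (k.+1%:R ^+ k * expR (n%:R * (1 + eps / 8 * ln k%:R))) s e.
Proof.
have [B1 HB1] := exists_nat_ge (40 / (eps * x)).
have [B2 HB2] := exists_nat_ge (26 / x ^+ 2).
have [K HK] := exists_nat_ge ((2 * (B1 + B2)%:R + 160) / b0).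
(* One lower bound on [ln k] covers every condition on [k]; the last summand also bounds [k] itself
   through [ln k < k]. *)
pose C : R := 1 + 2 * B1%:R + (K + (B1 + B2) + 1)%:R * (1 + 2 * K%:R) +
   2 * (al1 + 32) / eps + (2 * K%:R + 2 * (B1 + B2)%:R + 26) * 16 / eps.
have [k0 [k01 Hk0]] := exists_ln_ge C.
exists k0; split => // k kk0; have lC := Hk0 k kk0.
have k1 : (1 < k)%N by exact: leq_trans kk0.
have kpos : 0 < k%:R :> R by rewrite ltr0n ltnW.
have n1 : 0 <= 2 * (al1 + 32) / eps.
  by rewrite divr_ge0 ?(ltW e0) // mulr_ge0 //; move: al10; lra.
have n2 : 0 <= (2 * K%:R + 2 * (B1 + B2)%:R + 26) * 16 / eps :> R.
  by rewrite divr_ge0 ?(ltW e0) // mulr_ge0 // !addr_ge0 // mulr_ge0.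
have n3 : 0 <= (K + (B1 + B2) + 1)%:R * (1 + 2 * K%:R) :> R.
  by rewrite mulr_ge0 // addr_ge0 // mulr_ge0.
have n4 : 0 <= B1%:R :> R by [].
have [n0 Hn0] := exists_nat_ge (k%:R * (1 / tau + 1 / x + (k%:R + (k%:R + k%:R ^+ 2)))).
exists (k%:R * (al + be))^-1, n0.+1; split.
  by rewrite invr_gt0 mulr_gt0 //; move: al0 be1; lra.
move=> n m nn0 ml mu.
have npos : (0 < n)%N by exact: leq_trans nn0.
pose c : R := 2 * m%:R / (k%:R * ln k%:R * n%:R).
have [l1 lB1 lK lal lk] := sum5_le (mulr_ge0 (ler0n R 2) n4) n3 n1 n2 lC.
have den : 0 < k%:R * ln k%:R * n%:R :> R.
  by rewrite mulr_gt0 ?ltr0n // mulr_gt0 //; lra.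
have lpos : 0 < ln k%:R :> R by lra.
have nR : 0 < n%:R :> R by rewrite ltr0n.
have mE : m%:R = c * k%:R * ln k%:R * n%:R / 2.
  by rewrite /c; field; rewrite (gt_eqF nR) (gt_eqF lpos) (gt_eqF kpos).
have c1 : 1 + eps <= c by rewrite /c ler_pdivlMr // mulrA.
have c2 : c <= 2 by rewrite /c ler_pdivrMr // mulrA.
have NN : 1 / tau + 1 / x + (k%:R + (k%:R + k%:R ^+ 2)) <= Nr R n k.
  rewrite /Nr ler_pdivlMr // mulrC; apply: (le_trans Hn0).
  by rewrite ler_nat (leq_trans _ nn0).
have p1 : 0 < 1 / tau by rewrite divr_gt0.
have p2 : 0 < 1 / x by rewrite divr_gt0.
have p3 := sqr_ge0 (k%:R : R).
have Ntau : 1 <= tau * Nr R n k.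
  by rewrite mulrC -ler_pdivrMr //; lra.
have Nx : 1 <= x * Nr R n k.
  by rewrite mulrC -ler_pdivrMr //; lra.
have Nk : k%:R + (k%:R + k%:R ^+ 2) <= Nr R n k by lra.
have kb : (2 * K%:R + 2 * (B1 + B2)%:R + 26) * 16 <= eps * k%:R.
  rewrite [leRHS]mulrC -ler_pdivrMr //; apply: (le_trans lk).
  by rewrite ltW // ln_sublinear.
exists (fun s => bad_pair B1 B2 K s) => s; split.
  exact: (bad_pair_count HB1 HK npos k1 l1 lB1 lK lal Ntau Nx Nk mE c1 c2).
move=> e; exact: (not_bad_trapped HB2 HK npos k1 l1 kb).
Qed.

End PlantedSummary.

(** * Second moment *)

Section Entropy.
Variable R : realType.

(** With [r] the square root of [y], [ln r >= 1 - 1 / r] bounds the entropy below by [(r - 1) ^ 2],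
    and [(r + 1) ^ 2 <= 2 * (y + 1)]. *)
Lemma entropy_ge_sq (y : R) : 0 <= y ->
  (y - 1) ^+ 2 / (2 * (y + 1)) <= y * ln y - y + 1.
Proof.
move=> y0; have [->|y_neq0] := eqVneq y 0.
  rewrite mul0r !sub0r sqrrN expr1n !add0r mulr1 -[leRHS]divr1.
  by rewrite ler_pdivrMr //; lra.
have yp : 0 < y by rewrite lt_neqAle eq_sym y_neq0.
pose r := Num.sqrt y.
have r2 : r ^+ 2 = y by rewrite sqr_sqrtr.
have rp : 0 < r by rewrite sqrtr_gt0.
have lnr : 1 - r^-1 <= ln r.
  have ri : 0 < r^-1 by rewrite invr_gt0.
  have h : ln (1 + (r^-1 - 1)) <= r^-1 - 1 by apply: le_ln1Dx; lra.
  have e0 : 1 + (r^-1 - 1) = r^-1 by lra.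
  by rewrite e0 lnV ?posrE // in h; lra.
have lny : ln y = 2 * ln r by rewrite -r2 lnXn // mulr_natl.
have h1 : (r - 1) ^+ 2 <= y * ln y - y + 1.
  rewrite lny; have h := ler_wpM2l (ltW yp) lnr.
  have e1 : y * (1 - r^-1) = r ^+ 2 - r by rewrite -r2; field; rewrite gt_eqF.
  rewrite e1 in h; rewrite -r2 in h *; rewrite !expr2 in h *; lra.
apply: le_trans h1; rewrite ler_pdivrMr; last by lra.
have -> : (y - 1) ^+ 2 = (r - 1) ^+ 2 * (r + 1) ^+ 2 by rewrite -r2; ring.
rewrite ler_wpM2l ?sqr_ge0 // -r2.
by have := sqr_ge0 (r - 1); rewrite !expr2; lra.
Qed.

(* The quadratic is dominated by the entropy up to the maximal possible value
   [Y] of [y]: near 1 because both have a double zero there, and for large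
   [y] because the entropy grows like [y ln y]. *)
Lemma entropy_ge_quadratic (q Y y : R) : 0 <= q -> 0 < Y ->
  4 * (1 + ln (1 + Y * q)) <= ln Y ->
  q * Y + 2 <= ln Y -> 8 * q <= 1 -> 0 <= y <= Y ->
  q * (y - 1) ^+ 2 <= y * ln y - y + 1.
Proof.
move=> q0 Y0 h1 h2 h3 /andP[y0 yY].
(* Three ranges. Here the quadratic lower bound of the entropy suffices; for [y > Y / 2] the
   logarithm is within 1 of [ln Y]; in between, [q * y >= 1 / 4] bounds [ln y] from below while
   [q * y] is at most half of [q * Y]. *)
have [ys|ys] := leP (4 * q * (y + 1)) 2.
  apply: le_trans (entropy_ge_sq y0); rewrite ler_pdivlMr; last by lra.
  have := ler_wpM2l (sqr_ge0 (y - 1)) ys; lra.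
have qp : 0 < q by rewrite lt_neqAle q0 andbT; apply/eqP => q00; rewrite -q00 in ys; lra.
have y1 : 1 < y by nra.
have yp : 0 < y by lra.
have yq : 1 / 4 <= q * y by nra.
suff key : q * y <= ln y - 1.
  have e1 : q * (y - 1) ^+ 2 <= q * y * y.
    rewrite -mulrA ler_pM2l // expr2; nra.
  have e2 := ler_wpM2l (ltW yp) key; lra.
have [half|half] := leP y (Y / 2); last first.
  have l2 : ln Y - 1 <= ln y.
    have : ln (Y / 2) <= ln y by rewrite ler_ln ?posrE ?divr_gt0 // ltW.
    rewrite ln_div ?posrE //.
    have : ln 2 <= 1 :> R by have := @le_ln1Dx R 1; rewrite -(natrD R 1 1); apply; lra.
    lra.
  have : q * y <= q * Y by rewrite ler_pM2l.
  lra.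
have lY : ln Y - ln (4 * (1 + Y * q)) <= ln y.
  have p1 : 0 < 4 * (1 + Y * q) by nra.
  rewrite -ln_div ?posrE // ler_ln ?posrE ?divr_gt0 // ler_pdivrMr //.
  nra.
have l4 : ln 4 <= 2 :> R.
  have g2 := @le_ln1Dx R 1; rewrite -(natrD R 1 1) in g2.
  have -> : 4 = 2 * 2 :> R by lra.
  by rewrite lnM ?posrE //; have := g2 ltac:(lra); lra.
have p1 : 0 < 1 + Y * q by nra.
rewrite lnM ?posrE // in lY.
have qy : q * y <= q * Y / 2 by nra.
have l0 : 0 <= ln (1 + Y * q) by rewrite ln_ge0 // lerDl; nra.
lra.
Qed.

End Entropy.

Section Types.
Variable (R : realType).

(* Grouping the maps by their fibre sizes: for a fixed distribution, the
   product is the probability of the map under independent sampling. *)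
Lemma sum_types_le (n : nat) (I : finType) : (0 < n)%N ->
  \sum_(f : {ffun 'I_n -> I}) \prod_v (#|[set u | f u == f v]|%:R / n%:R : R) <=
  n.+1%:R ^+ #|I|.
Proof.
move=> n0.
pose ty (f : {ffun 'I_n -> I}) : {ffun I -> 'I_n.+1} :=
  [ffun a => inord #|[set u | f u == a]|].
have tyE f a : ty f a = #|[set u | f u == a]| :> nat.
  by rewrite ffunE inordK // ltnS -[X in (_ <= X)%N]card_ord max_card.
rewrite (partition_big ty predT) //=.
apply: (@le_trans _ _ (\sum_(t : {ffun I -> 'I_n.+1}) 1)); last first.
  by rewrite sumr_const card_ffun card_ord natrX.
apply: ler_sum => t _.
have [f0 /eqP tf0|none] := pickP (fun f => ty f == t); last by rewrite big_pred0.
pose p a : R := (t a)%:R / n%:R.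
have p0 a : 0 <= p a by rewrite divr_ge0.
have sp : \sum_a p a = 1.
  rewrite -mulr_suml -natr_sum -tf0.
  under eq_bigr do rewrite tyE.
  have -> : (\sum_a #|[set u | f0 u == a]|)%N = n.
    rewrite -[RHS]card_ord -sum1_card (partition_big f0 predT) //=.
    by apply: eq_bigr => a _; rewrite -sum1_card; apply: eq_bigl => v; rewrite inE.
  by rewrite mulfV // pnatr_eq0 -lt0n.
apply: (@le_trans _ _ (\sum_(f : {ffun 'I_n -> I}) \prod_v p (f v))).
  rewrite [leRHS](bigID (fun f => ty f == t)) /= -[leLHS]addr0; apply: lerD.
    apply: ler_sum => f /eqP tf; apply: ler_prod => v _.
    by rewrite divr_ge0 //= /p -tf tyE.
  by apply: sumr_ge0 => f _; apply: prodr_ge0.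
by rewrite (sum_prod_ffun (fun (_ : 'I_n) a => p a)) prodr_const sp expr1n.
Qed.

End Types.

Section SecondMoment.
Variables (R : realType) (n k m : nat).
Local Notation V := 'I_n.
Local Notation edges := {ffun 'I_m -> 'I_n * 'I_n}.
Implicit Types (s t : {ffun V -> 'I_k}) (e : edges).
Variable de : R.
Hypotheses (n0 : (0 < n)%N) (k1 : (1 < k)%N) (de0 : 0 < de).

Definition balanced s : bool :=
  [forall i, #|cls s i|%:R <= (1 + de) * (n%:R / k%:R)].

Definition balanced_colorings e : {set {ffun V -> 'I_k}} :=
  [set s | balanced s && proper s e].

Let kpos : 0 < k%:R :> R. Proof. by rewrite ltr0n ltnW. Qed.
Let npos : 0 < n%:R :> R. Proof. by rewrite ltr0n. Qed.

Lemma card_proper_pair s t :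
  #|[set e : edges | proper s e && proper t e]|%:R =
  (n%:R ^+ 2 - #|mono s :|: mono t|%:R) ^+ m :> R.
Proof.
have -> : [set e : edges | proper s e && proper t e] =
    [set e in ffun_on (mem (~: (mono s :|: mono t)))].
  apply/setP => e; rewrite !inE; apply/andP/ffun_onP.
    case=> /forallP h1 /forallP h2 i; rewrite in_setC in_setU negb_or.
    by rewrite (h1 i) (h2 i).
  by move=> h; split; apply/forallP => i; have := h i; rewrite in_setC in_setU negb_or => /andP[].
rewrite cardsE card_ffun_on card_ord natrX; congr (_ ^+ m).
have := cardsC (mono s :|: mono t); rewrite card_prod card_ord.
move/(congr1 (fun x => x%:R : R)); rewrite natrD natrM -expr2; lra.
Qed.

Lemma card_mono_balanced s : balanced s ->
  #|mono s|%:R <= n%:R ^+ 2 * ((1 + de) / k%:R) :> R.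
Proof.
move=> /forallP bs; rewrite card_monoE natr_sum.
apply: (@le_trans _ _ (\sum_i #|cls s i|%:R * ((1 + de) * (n%:R / k%:R)))).
  by apply: ler_sum => i _; rewrite natrX expr2 ler_wpM2l.
rewrite -mulr_suml -natr_sum sum_card_cls le_eqVlt; apply/orP; left; apply/eqP.
by field; rewrite gt_eqF.
Qed.

(** Chernoff bound for the size of one class, with tilt [1 + de], and a union over the [k]
    classes. *)
Lemma card_unbalanced_le : 
  #|[set s | ~~ balanced s]|%:R <= k%:R * k%:R ^+ n *
    expR (- (n%:R * (de ^+ 2 / (2 * (2 + de)) / k%:R))) :> R.
Proof.
pose th := (1 + de) * (n%:R / k%:R).
pose mu := 1 + de.
have mu0 : 0 < mu by rewrite /mu; move: de0; lra.
have lmu : 0 <= ln mu by rewrite ln_ge0 // /mu; move: de0; lra.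
have X0 : 0 <= k%:R ^+ n * expR (- (n%:R * (de ^+ 2 / (2 * (2 + de)) / k%:R))) :> R.
  by rewrite mulr_ge0 ?exprn_ge0 ?expR_ge0.
have PQ s : ~~ balanced s -> exists i, th < #|cls s i|%:R.
  by rewrite negb_forall => /existsP[i]; rewrite -ltNge => h; exists i.
have QX (i : 'I_k) : (exists s : {ffun V -> 'I_k}, th < #|cls s i|%:R) ->
   #|[set s : {ffun V -> 'I_k} | th < #|cls s i|%:R]|%:R <=
   1 * (k%:R ^+ n * expR (- (n%:R * (de ^+ 2 / (2 * (2 + de)) / k%:R)))) :> R.
  move=> _; rewrite mul1r.
  have h : expR (ln mu * th) * #|[set s : {ffun V -> 'I_k} | th < #|cls s i|%:R]|%:R <=
      \prod_(v < n) \sum_(j : 'I_k) (if j == i then mu else 1).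
    apply: card_le_prod => [v j|s ths]; first by case: ifP => // _; exact: ltW.
    rewrite -big_mkcond /= prodr_const.
    have -> : mu = expR (ln mu) by rewrite lnK.
    rewrite expRX expRK ler_expR ler_wpM2l // ltW //; apply: (lt_le_trans ths).
    by rewrite ler_nat subset_leq_card //; apply/subsetP => v; rewrite inE.
  rewrite mulrC -ler_pdivlMr ?expR_gt0 // in h; apply: (le_trans h).
  rewrite prodr_const card_ord.
  have -> : \sum_(j : 'I_k) (if j == i then mu else 1) = k%:R * (1 + de / k%:R).
    rewrite (bigD1 i) //= eqxx (eq_bigr (fun=> 1)) => [|j /negPf ->//].
    rewrite (eq_bigl (fun j => j \in [set~ i])) => [|j]; last by rewrite !inE.
    rewrite sumr_const cardsC1 card_ord /mu mulrDr mulr1 mulrCA mulfV ?gt_eqF // mulr1.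
    by rewrite -subn1 natrB ?(ltnW k1) //; lra.
  rewrite exprMn -[leLHS]mulrA; apply: ler_wpM2l; rewrite ?exprn_ge0 // -expRN.
  apply: (@le_trans _ _ (expR (de / k%:R) ^+ n * expR (- (ln mu * th)))).
    rewrite ler_wpM2r ?expR_ge0 // lerXn2r ?nnegrE ?expR_ge0 ?expR_ge1Dx //.
    by rewrite addr_ge0 // divr_ge0 // ltW.
  rewrite expRX -expRD ler_expR /th.
  have h1 := entropy_ge_sq (ltW mu0).
  have e1 : mu - 1 = de by rewrite /mu; lra.
  have e2 : 2 * (mu + 1) = 2 * (2 + de) by rewrite /mu; lra.
  rewrite e1 e2 in h1.
  have h2 := ler_wpM2l (ltW (divr_gt0 npos kpos)) h1.
  have e3 : n%:R / k%:R * (mu * ln mu - mu + 1) =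
     n%:R / k%:R * (mu * ln mu) - n%:R / k%:R * de by rewrite /mu; ring.
  rewrite e3 in h2; rewrite -/mu; lra.
have := @card_union_le R _ _ _ (fun i s => th < #|cls s i|%:R) (fun=> 1) _ X0 PQ (fun=> ler01) QX.
by rewrite sumr_const card_ord mulrA.
Qed.

(** Let [y i j] be the relative overlap of class [i] of [s] with class [j] of [t]. The correlation
    of the two events is governed by the sum of [(y - 1) ^ 2], and the right-hand product is the
    exponential of the relative entropy of the overlaps. The comparison is made cell by cell through
    the last hypothesis, so that the sum over all pairs reduces to counting overlap types. *)
Lemma pair_proper_le s t (q : R) : balanced s -> balanced t ->
  m%:R / (k%:R - 1) ^+ 2 <= q * n%:R -> 
  (forall y, 0 <= y <= k%:R * (1 + de) -> q * (y - 1) ^+ 2 <= y * ln y - y + 1) ->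
  #|[set e : edges | proper s e && proper t e]|%:R <=
  (n%:R ^+ 2 * (1 - k%:R^-1) ^+ 2) ^+ m * (k%:R ^+ 2) ^+ n *
   \prod_v (#|[set u | (s u == s v) && (t u == t v)]|%:R / n%:R) :> R.
Proof.
move=> bs bt hq ent.
have k2 : 2 <= k%:R :> R by rewrite (ler_nat R 2).
have ki : k%:R^-1 <= 1 / 2 :> R by rewrite -div1r ler_pdivrMr //; lra.
have ki0 : 0 < k%:R^-1 :> R by rewrite invr_gt0.
pose c i j : R := #|[set u | (s u == i) && (t u == j)]|%:R.
have c0 i j : 0 <= c i j by [].
pose y i j : R := k%:R ^+ 2 * c i j / n%:R.
rewrite card_proper_pair.
have cI : #|mono s :&: mono t|%:R = \sum_i \sum_j c i j ^+ 2.
  rewrite -sum1_card (partition_big (fun p : V * V => s p.1) predT) //= natr_sum.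
  apply: eq_bigr => i _.
  rewrite (partition_big (fun p : V * V => t p.1) predT) //= natr_sum.
  apply: eq_bigr => j _; rewrite sum1_card /c -natrX expnS expn1 -cardsX.
  congr (_%:R); apply: eq_card => p; rewrite !inE -!topredE /= !inE.
  case: (s p.1 =P i) => [->|]; last by rewrite andbF.
  case: (t p.1 =P j) => [->|]; last by rewrite !andbF.
  by rewrite !andbT [i == _]eq_sym [j == _]eq_sym.
have sc : \sum_i \sum_j c i j = n%:R.
  rewrite -(sum_card_cls s) natr_sum; apply: eq_bigr => i _.
  rewrite /c -natr_sum; congr (_%:R).
  rewrite -sum1_card (partition_big t predT) //=; apply: eq_bigr => j _.
  by rewrite -sum1_card; apply: eq_bigl => v; rewrite !inE.
have k11 : 0 < 1 - k%:R^-1 :> R by lra.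
set S2 := \sum_i \sum_j c i j ^+ 2 in cI.
have h1 : n%:R ^+ 2 - #|mono s :|: mono t|%:R <=
   n%:R ^+ 2 * (1 - k%:R^-1) ^+ 2 *
     expR ((S2 / n%:R ^+ 2 - (k%:R ^+ 2)^-1) / (1 - k%:R^-1) ^+ 2).
  have := cardsUI (mono s) (mono t) => /(congr1 (fun x => x%:R : R)); rewrite !natrD cI => h.
  have ms := @card_mono_ge R _ _ s (ltnW k1); have mt := @card_mono_ge R _ _ t (ltnW k1).
  apply: (@le_trans _ _ (n%:R ^+ 2 * (1 - k%:R^-1) ^+ 2 *
     (1 + (S2 / n%:R ^+ 2 - (k%:R ^+ 2)^-1) / (1 - k%:R^-1) ^+ 2))); last first.
    by rewrite ler_wpM2l ?expR_ge1Dx // mulr_ge0 ?sqr_ge0.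
  have -> : n%:R ^+ 2 * (1 - k%:R^-1) ^+ 2 *
     (1 + (S2 / n%:R ^+ 2 - (k%:R ^+ 2)^-1) / (1 - k%:R^-1) ^+ 2) =
     n%:R ^+ 2 - 2 * (n%:R ^+ 2 / k%:R) + S2.
    by field; rewrite !gt_eqF //; lra.
  lra.
apply: (@le_trans _ _ ((n%:R ^+ 2 * (1 - k%:R^-1) ^+ 2 *
     expR ((S2 / n%:R ^+ 2 - (k%:R ^+ 2)^-1) / (1 - k%:R^-1) ^+ 2)) ^+ m)).
  apply: lerXn2r => //; rewrite nnegrE.
    rewrite subr_ge0 -natrX ler_nat (leq_trans (max_card _)) // card_prod card_ord.
    by rewrite expnS expn1.
  by rewrite mulr_ge0 ?expR_ge0 // mulr_ge0 ?sqr_ge0.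
rewrite exprMn -mulrA; apply: ler_wpM2l.
  by rewrite exprn_ge0 // mulr_ge0 ?sqr_ge0.
rewrite expRX.
have rE : (k%:R ^+ 2) ^+ n * \prod_v (#|[set u | (s u == s v) && (t u == t v)]|%:R / n%:R)
   = expR (\sum_i \sum_j c i j * ln (y i j)).
  have -> : (k%:R ^+ 2) ^+ n = \prod_(v < n) (k%:R ^+ 2 : R) by rewrite prodr_const card_ord.
  rewrite -big_split /=.
  have -> : \sum_i \sum_j c i j * ln (y i j) = \sum_v ln (y (s v) (t v)).
    rewrite (partition_big s predT) //=; apply: eq_bigr => i _.
    rewrite (partition_big t predT) //=; apply: eq_bigr => j _.
    rewrite (eq_bigr (fun=> ln (y i j))); last by move=> v /andP[/eqP -> /eqP ->].
    by rewrite sum_const_pred.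
  rewrite expR_sum; apply: eq_bigr => v _.
  have cp : 0 < c (s v) (t v).
    by rewrite ltr0n card_gt0; apply/set0Pn; exists v; rewrite inE !eqxx.
  rewrite lnK; first by rewrite /y mulrA.
  by rewrite posrE divr_gt0 // mulr_gt0 // exprn_gt0.
rewrite rE ler_expR.
have -> : \sum_i \sum_j c i j * ln (y i j) =
   n%:R / k%:R ^+ 2 * \sum_i \sum_j (y i j * ln (y i j) - y i j + 1).
  rewrite mulr_sumr.
  have e1 i : n%:R / k%:R ^+ 2 * \sum_j (y i j * ln (y i j) - y i j + 1) =
     \sum_j c i j * ln (y i j) - \sum_j c i j + \sum_(j : 'I_k) n%:R / k%:R ^+ 2.
    rewrite mulr_sumr -sumrB -big_split /=; apply: eq_bigr => j _.
    by rewrite /y; field; rewrite !gt_eqF.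
  under [RHS]eq_bigr do rewrite e1.
  rewrite big_split /= sumrB sc.
  have -> : \sum_(i : 'I_k) \sum_(j : 'I_k) n%:R / k%:R ^+ 2 = n%:R :> R.
    rewrite !sumr_const card_ord -[LHS]mulr_natr -[X in X * _]mulr_natr.
    by field; rewrite gt_eqF.
  by rewrite addrNK.
apply: (@le_trans _ _ (n%:R / k%:R ^+ 2 * \sum_i \sum_j q * (y i j - 1) ^+ 2)).
  have -> : \sum_i \sum_j q * (y i j - 1) ^+ 2 =
      q * (k%:R ^+ 4 * (S2 / n%:R ^+ 2 - (k%:R ^+ 2)^-1)).
    rewrite (eq_bigr (fun i => q * \sum_j (y i j - 1) ^+ 2)); last first.
      by move=> i _; rewrite mulr_sumr.
    rewrite -mulr_sumr; congr (_ * _).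
    have e1 i : \sum_j (y i j - 1) ^+ 2 = k%:R ^+ 4 / n%:R ^+ 2 * \sum_j c i j ^+ 2
        - 2 * k%:R ^+ 2 / n%:R * \sum_j c i j + \sum_(j : 'I_k) 1.
      rewrite !mulr_sumr -sumrB -big_split /=; apply: eq_bigr => j _.
      by rewrite /y; field; rewrite !gt_eqF.
    under eq_bigr do rewrite e1.
    rewrite big_split /= sumrB -!mulr_sumr sc -/S2.
    have -> : \sum_(i : 'I_k) \sum_(j : 'I_k) 1 = k%:R ^+ 2 :> R.
      by rewrite !sumr_const card_ord -[LHS]mulr_natr expr2.
    by field; rewrite !gt_eqF.
  set D := S2 / n%:R ^+ 2 - (k%:R ^+ 2)^-1.
  have D0 : 0 <= D.
    have := sum_sqr_ge (fun p : 'I_k * 'I_k => c p.1 p.2).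
    rewrite -(pair_big predT predT (fun i j => c i j)) /=.
    rewrite -(pair_big predT predT (fun i j => c i j ^+ 2)) /= sc -/S2.
    rewrite card_prod card_ord natrM => h.
    rewrite /D subr_ge0 -[leLHS]mul1r ler_pdivrMr ?exprn_gt0 // mulrAC ler_pdivlMr ?exprn_gt0 //.
    by rewrite mul1r; move: h; rewrite !expr2; lra.
  have kk : 0 < (1 - k%:R^-1) ^+ 2 :> R by rewrite exprn_gt0.
  have -> : D / (1 - k%:R^-1) ^+ 2 * m%:R = D * k%:R ^+ 2 * (m%:R / (k%:R - 1) ^+ 2).
    by field; rewrite !gt_eqF //; lra.
  have -> : n%:R / k%:R ^+ 2 * (q * (k%:R ^+ 4 * D)) = D * k%:R ^+ 2 * (q * n%:R).
    by field; rewrite gt_eqF.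
  by rewrite ler_wpM2l // mulr_ge0 ?sqr_ge0.
rewrite ler_wpM2l; [|by rewrite divr_ge0 ?sqr_ge0|] => //.
apply: ler_sum => i _; apply: ler_sum => j _; apply: ent.
rewrite divr_ge0 ?mulr_ge0 ?sqr_ge0 //= ler_pdivrMr //.
have : c i j <= (1 + de) * (n%:R / k%:R).
  apply: le_trans (forallP bs i); rewrite ler_nat subset_leq_card //.
  by apply/subsetP => v; rewrite !inE => /andP[].
have := ler_wpM2l (sqr_ge0 (k%:R : R)) => h /h; move/le_trans; apply.
rewrite le_eqVlt; apply/orP; left; apply/eqP; field; by rewrite gt_eqF.
Qed.

End SecondMoment.

(** * Sparse subsets and repairing colorings *)

Section Chernoff.
Variables (R : realType) (n m : nat).
Local Notation V := 'I_n.
Local Notation edges := {ffun 'I_m -> 'I_n * 'I_n}.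

Lemma hits_ge_count (F : {set V * V}) (a h : R) : (0 < n)%N -> 0 <= a ->
  #|[set e : edges | h <= (hits e F)%:R]|%:R <=
  (n%:R ^+ 2) ^+ m * expR (expR a * #|F|%:R / n%:R ^+ 2 * m%:R - a * h).
Proof.
move=> n0 a0.
have npos : 0 < n%:R :> R by rewrite ltr0n.
have ea : 1 <= expR a by rewrite -[leLHS]expR0 ler_expR.
have h1 : expR (a * h) * #|[set e : edges | h <= (hits e F)%:R]|%:R <=
    \prod_(i < m) \sum_(p : V * V) (if p \in F then expR a else 1).
  apply: card_le_prod => [i p|e he]; first by case: ifP => // _; exact: expR_ge0.
  rewrite -big_mkcond /= prodr_const expRX ler_expR ler_wpM2l //.
  apply: (le_trans he); rewrite ler_nat; apply/eq_leq/eq_card => i.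
  by rewrite inE.
have h2 : \sum_(p : V * V) (if p \in F then expR a else 1) <=
    n%:R ^+ 2 * expR (expR a * #|F|%:R / n%:R ^+ 2).
  apply: (@le_trans _ _ (\sum_(p : V * V) (1 + (if p \in F then expR a else 0)))).
    by apply: ler_sum => p _; case: ifP => _; lra.
  rewrite big_split /= sumr_const card_prod card_ord -big_mkcond /= sum_const_set.
  apply: (@le_trans _ _ (n%:R ^+ 2 * (1 + expR a * #|F|%:R / n%:R ^+ 2))).
    rewrite natrM le_eqVlt; apply/orP; left; apply/eqP.
    by field; rewrite gt_eqF.
  by rewrite ler_wpM2l ?expR_ge1Dx // sqr_ge0.
rewrite expRD expRN mulrA ler_pdivlMr ?expR_gt0 // mulrC.
apply: (le_trans h1); rewrite prodr_const card_ord -expRX -exprMn.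
apply: lerXn2r => //; rewrite nnegrE.
  by apply: sumr_ge0 => p _; case: ifP => // _; exact: expR_ge0.
by rewrite mulr_ge0 ?sqr_ge0 ?expR_ge0.
Qed.

Definition touching (e : edges) (X : {set V}) : nat :=
  hits e [set p | (p.1 \in X) || (p.2 \in X)].

Lemma card_touching_pairs (X : {set V}) :
  (#|[set p : V * V | (p.1 \in X) || (p.2 \in X)]| <= 2 * #|X| * n)%N.
Proof.
have -> : [set p : V * V | (p.1 \in X) || (p.2 \in X)] =
   setX X setT :|: setX setT X.
  by apply/setP => p; rewrite !inE andbT.
apply: (leq_trans (leq_card_setU _ _)).
by rewrite !cardsX cardsT card_ord [(n * _)%N]mulnC addnn -mul2n mulnA.
Qed.

Definition loopless (e : edges) : bool := [forall i, (e i).1 != (e i).2].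

End Chernoff.

(** The tilt [4 / th] makes [th * n] hits worth [exp (- 4 n)], and [zeta] keeps the tilted mean
    below [n]. What remains beats the [2 ^ n] choices of the set. *)
Lemma touching_rare (R : realType) (d th : R) : 0 < d -> 0 < th ->
  exists2 zeta : R, 0 < zeta & forall e0 : R, 0 < e0 -> exists n0 : nat,
    forall n m : nat, (n0 <= n)%N -> m%:R <= d * n%:R ->
    #|[set e : {ffun 'I_m -> 'I_n * 'I_n} | [exists X : {set 'I_n},
        (#|X|%:R <= zeta * n%:R) && (th * n%:R <= (touching e X)%:R)]]|%:R <=
    e0 * (n%:R ^+ 2) ^+ m.
Proof.
move=> d0 th0; pose a : R := 4 / th; pose lam := expR a.
have a0 : 0 <= a by rewrite divr_ge0 // ltW.
have lam0 : 0 < lam by exact: expR_gt0.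
exists (2 * lam * d)^-1; first by rewrite invr_gt0 !mulr_gt0.
set zeta := (2 * lam * d)^-1 => e0 e00.
have [n0 Hn0] := exists_nat_ge (e0^-1).
exists n0.+1 => n m nn0 md.
have npos : (0 < n)%N by exact: leq_trans nn0.
have nR : 0 < n%:R :> R by rewrite ltr0n.
have X0 : 0 <= (n%:R ^+ 2) ^+ m * expR (- (2 * n%:R)) :> R.
  by rewrite mulr_ge0 ?expR_ge0 // exprn_ge0 // sqr_ge0.
apply: (@le_trans _ _ ((\sum_(X : {set 'I_n}) 1) * ((n%:R ^+ 2) ^+ m * expR (- (2 * n%:R))))).
  apply: (@card_union_le R _ _ _ (fun (X : {set 'I_n}) (e : {ffun 'I_m -> 'I_n * 'I_n}) =>
     (#|X|%:R <= zeta * n%:R) && (th * n%:R <= (touching e X)%:R)) (fun=> 1)) => //.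
    by move=> e /existsP.
  move=> X [e1 /andP[Xs _]]; rewrite mul1r.
  set F := [set p : 'I_n * 'I_n | (p.1 \in X) || (p.2 \in X)].
  apply: (@le_trans _ _ #|[set e : {ffun 'I_m -> 'I_n * 'I_n} |
     th * n%:R <= (hits e F)%:R]|%:R).
    rewrite ler_nat; apply: subset_leq_card; apply/subsetP => e.
    by rewrite [e \in _]inE => /andP[_ ?]; rewrite [e \in _]inE.
  apply: (le_trans (hits_ge_count m F (th * n%:R) npos a0)).
  rewrite ler_wpM2l ?exprn_ge0 ?sqr_ge0 // ler_expR.
  have aE : a * (th * n%:R) = 4 * n%:R by rewrite /a; field; rewrite gt_eqF.
  rewrite aE -/lam.
  suff : lam * #|F|%:R / n%:R ^+ 2 * m%:R <= n%:R by lra.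
  have Fc : #|F|%:R <= 2 * (zeta * n%:R) * n%:R.
    apply: (@le_trans _ _ (2 * #|X| * n)%:R); first by rewrite ler_nat card_touching_pairs.
    by rewrite !natrM ler_wpM2r // ler_wpM2l.
  apply: (@le_trans _ _ (lam * (2 * (zeta * n%:R) * n%:R) / n%:R ^+ 2 * (d * n%:R))).
    apply: ler_pM => //.
      by rewrite divr_ge0 ?sqr_ge0 // mulr_ge0 // ltW.
    by rewrite ler_wpM2r ?invr_ge0 ?sqr_ge0 // ler_wpM2l // ltW.
  rewrite /zeta le_eqVlt; apply/orP; left; apply/eqP.
  by field; rewrite (gt_eqF nR) (gt_eqF d0) (gt_eqF lam0).
rewrite mulrCA [leRHS]mulrC ler_wpM2l ?exprn_ge0 ?sqr_ge0 //.
rewrite sumr_const -cardsT -powersetT card_powerset cardsT card_ord.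
have h2 : 2 <= expR 1 :> R by have := @expR_ge1Dx R 1; lra.
have -> : (1 *+ 2 ^ n : R) = 2 ^+ n by rewrite -natrX.
apply: (@le_trans _ _ (expR 1 ^+ n * expR (- (2 * n%:R)))).
  apply: ler_wpM2r; first exact: expR_ge0.
  by apply: lerXn2r => //; rewrite nnegrE ?expR_ge0.
rewrite expRX -expRD.
have -> : 1 * n%:R + - (2 * n%:R) = - n%:R :> R by lra.
rewrite expRN -[leRHS]invrK lef_pV2 ?posrE ?expR_gt0 ?invr_gt0 //.
apply: (le_trans Hn0); apply: (@le_trans _ _ n%:R); first by rewrite ler_nat ltnW.
by apply: le_trans (expR_ge1Dx _); lra.
Qed.

Section SparseSets.
Variable R : realType.

Lemma pow_self_le_fact (s : nat) : s%:R ^+ s <= expR s%:R * (s`!)%:R :> R.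
Proof.
elim: s => [|s IH]; first by rewrite expr0 fact0 mulr1 expR0.
have [->|s0] := posnP s.
  by rewrite expr1 mulr1; apply: le_trans (expR_ge1Dx _); lra.
have sp : 0 < s%:R :> R by rewrite ltr0n.
have h : s.+1%:R ^+ s <= expR 1 * s%:R ^+ s :> R.
  have -> : s.+1%:R = (1 + s%:R^-1) * s%:R :> R.
    by rewrite mulrDl mul1r mulVf ?gt_eqF // natr1.
  rewrite exprMn ler_wpM2r ?exprn_ge0 //.
  have -> : expR 1 = expR (s%:R^-1) ^+ s :> R by rewrite expRX mulVf ?gt_eqF.
  rewrite lerXn2r ?nnegrE ?expR_ge0 ?expR_ge1Dx //.
  by rewrite addr_ge0 // invr_ge0.
rewrite exprS; apply: (@le_trans _ _ (s.+1%:R * (expR 1 * (expR s%:R * (s`!)%:R)))).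
  by rewrite ler_wpM2l // (le_trans h) // ler_wpM2l // expR_ge0.
rewrite factS natrM mulrA mulrCA mulrA mulrC !mulrA le_eqVlt; apply/orP; left; apply/eqP.
have -> : expR s.+1%:R = expR 1 * expR s%:R :> R by rewrite -expRD -nat1r.
by ring.
Qed.

Lemma bin_pow_le (n s : nat) :
  'C(n, s)%:R * s%:R ^+ s <= expR s%:R * n%:R ^+ s :> R.
Proof.
have h : ('C(n, s) * s`! <= n ^ s)%N.
  rewrite bin_ffact; elim: s n => [|s IH] n //.
  case: n => // n; rewrite ffactSS expnS leq_mul // (leq_trans (IH n)) //.
  by case: s {IH} => // s; rewrite leq_exp2r.
apply: (@le_trans _ _ ('C(n, s)%:R * (expR s%:R * (s`!)%:R))).
  by rewrite ler_wpM2l // pow_self_le_fact.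
by rewrite mulrCA ler_wpM2l ?expR_ge0 // -natrM -natrX ler_nat.
Qed.

Lemma geometric_half_le (N : nat) : \sum_(s < N) (2^-1 ^+ s : R) <= 2.
Proof.
suff -> : \sum_(s < N) (2^-1 ^+ s : R) = 2 - 2 * 2^-1 ^+ N.
  by rewrite gerBl mulr_ge0 // exprn_ge0 // invr_ge0.
elim: N => [|N IH]; first by rewrite big_ord0 expr0; lra.
by rewrite big_ord_recr /= IH exprS; lra.
Qed.

(** Sets of size [s] violate sparsity in at most a share [(C s / n) ^ s] of the sequences. Below
    [eta * n] the base is at most 1/4; one factor [C s / n] is kept to make the whole sum of order
    [1 / n], the rest being geometric. *)
Lemma sparse_rare (d : R) : 1 <= d ->
  exists2 eta : R, 0 < eta & forall e0 : R, 0 < e0 -> exists n0 : nat,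
    forall n m : nat, (n0 <= n)%N -> m%:R <= d * n%:R ->
    #|[set e : {ffun 'I_m -> 'I_n * 'I_n} | [exists U : {set 'I_n},
        [&& (0 < #|U|)%N, #|U|%:R <= eta * n%:R &
            (2 * #|U| <= hits e (setX U U))%N]]]|%:R <=
    e0 * (n%:R ^+ 2) ^+ m.
Proof.
move=> d1; pose C : R := expR 2 * d ^+ 2.
have d0 : 0 < d by lra.
have e2 : 1 <= expR 2 :> R by rewrite -[leLHS]expR0 ler_expR.
have dC : d <= C.
  rewrite /C expr2 mulrA ler_peMl //; first exact: ltW.
  by rewrite -[leLHS]mulr1 ler_pM.
have C0 : 0 < C by lra.
exists (4 * C)^-1; first by rewrite invr_gt0 mulr_gt0.
set eta := (4 * C)^-1 => e0 e00.
have [n0 Hn0] := exists_nat_ge (4 * C / e0).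
exists n0.+1 => n m nn0 md.
have npos : (0 < n)%N by exact: leq_trans nn0.
have nR : 0 < n%:R :> R by rewrite ltr0n.
have X0 : 0 <= (n%:R ^+ 2) ^+ m :> R by rewrite exprn_ge0 // sqr_ge0.
pose w (s : nat) : R := if (0 < s)%N && (s%:R <= eta * n%:R)
   then expR s%:R * (s%:R * d / n%:R) ^+ (2 * s) else 0.
have wge0 s : 0 <= w s.
  rewrite /w; case: ifP => // _; rewrite mulr_ge0 ?expR_ge0 // exprn_ge0 //.
  by rewrite divr_ge0 // mulr_ge0 // ltW.
apply: (@le_trans _ _ ((\sum_(U : {set 'I_n}) w #|U|) * (n%:R ^+ 2) ^+ m)).
  apply: (@card_union_le R _ _ _ (fun (U : {set 'I_n}) (e : {ffun 'I_m -> 'I_n * 'I_n}) =>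
     [&& (0 < #|U|)%N, #|U|%:R <= eta * n%:R &
            (2 * #|U| <= hits e (setX U U))%N]) (fun U => w #|U|)) => //.
    by move=> e /existsP.
  move=> U [e1 /and3P[U0 Us _]].
  rewrite /w U0 Us /=; set s := #|U| in U0 Us *.
  have sR : 0 < s%:R :> R by rewrite ltr0n.
  have sd : 0 < s%:R * d / n%:R by rewrite divr_gt0 // mulr_gt0.
  (* With this tilt the exponential correction is at most [exp s], while [2 s] hits are worth
     [(s d / n) ^ (2 s)]. *)
  pose a : R := ln (n%:R / (s%:R * d)).
  have ea : expR a = n%:R / (s%:R * d) by rewrite lnK // posrE divr_gt0 // mulr_gt0.
  have a0 : 0 <= a.
    rewrite ln_ge0 // ler_pdivlMr ?mulr_gt0 // mul1r.
    apply: (@le_trans _ _ (eta * n%:R * C)).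
      by apply: ler_pM => //; rewrite ltW.
    have -> : eta * n%:R * C = n%:R / 4 by rewrite /eta; field; rewrite gt_eqF.
    lra.
  apply: (@le_trans _ _ #|[set e : {ffun 'I_m -> 'I_n * 'I_n} |
     (2 * s)%:R <= (hits e (setX U U))%:R :> R]|%:R).
    rewrite ler_nat; apply: subset_leq_card; apply/subsetP => e.
    by rewrite [e \in _]inE => he; rewrite [e \in _]inE ler_nat.
  apply: (le_trans (hits_ge_count m _ (2 * s)%:R npos a0)).
  rewrite mulrC ler_wpM2r //.
  have -> : (s%:R * d / n%:R) ^+ (2 * s) = expR (- (a * (2 * s)%:R)).
    rewrite -mulNr -expRX; congr (_ ^+ _); rewrite expRN ea.
    by rewrite invf_div.
  rewrite -expRD ler_expR lerD2r ea cardsX -/s natrM.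
  have -> : n%:R / (s%:R * d) * (s%:R * s%:R) / n%:R ^+ 2 * m%:R =
     s%:R * (m%:R / (d * n%:R)) :> R.
    by field; rewrite (gt_eqF nR) (gt_eqF d0) (gt_eqF sR).
  by rewrite -[leRHS]mulr1 ler_wpM2l // ler_pdivrMr ?mulr_gt0 // mul1r.
rewrite ler_wpM2r //.
have cU (U : {set 'I_n}) : (#|U| < n.+1)%N.
  by rewrite ltnS -[X in (_ <= X)%N]card_ord max_card.
rewrite (partition_big (fun U => Ordinal (cU U)) predT) //=.
apply: (@le_trans _ _ (\sum_(s < n.+1) (2 * C / n%:R) * 2^-1 ^+ s)); last first.
  rewrite -mulr_sumr.
  have := ler_wpM2l _ (geometric_half_le n.+1) => /(_ (2 * C / n%:R)).
  move=> h; apply: (le_trans (h _)); first by rewrite divr_ge0 // mulr_ge0 // ltW.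
  have -> : 2 * C / n%:R * 2 = 4 * C / n%:R by ring.
  rewrite ler_pdivrMr // [leRHS]mulrC -ler_pdivrMr //; apply: (le_trans Hn0).
  by rewrite ler_nat ltnW.
apply: ler_sum => s _.
have -> : \sum_(U : {set 'I_n} | Ordinal (cU U) == s) w #|U| = 'C(n, s)%:R * w s.
  rewrite (eq_bigl (fun U : {set 'I_n} => #|U| == s)) => [|U]; last first.
    by rewrite -(inj_eq val_inj).
  rewrite (eq_bigr (fun=> w s)) => [|U /eqP -> //].
  by rewrite sum_const_pred card_draws card_ord.
rewrite /w; case: ifP => [/andP[s0 ss]|_]; last first.
  rewrite mulr0 mulr_ge0 ?exprn_ge0 ?invr_ge0 // divr_ge0 // mulr_ge0 //; exact: ltW.
have sR : 0 < s%:R :> R by rewrite ltr0n.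
apply: (@le_trans _ _ ((C * s%:R / n%:R) ^+ s)).
  have h := bin_pow_le n s.
  have h2 : 'C(n, s)%:R * s%:R ^+ s * (expR s%:R * (s%:R ^+ s * d ^+ (2 * s) / n%:R ^+ (2 * s))) <=
     expR s%:R * n%:R ^+ s * (expR s%:R * (s%:R ^+ s * d ^+ (2 * s) / n%:R ^+ (2 * s))).
    rewrite ler_wpM2r // mulr_ge0 ?expR_ge0 // divr_ge0 ?exprn_ge0 //.
    by rewrite mulr_ge0 ?exprn_ge0 // ltW.
  apply: (@le_trans _ _ _ _ _ (le_trans _ h2)).
    rewrite le_eqVlt; apply/orP; left; apply/eqP.
    rewrite !exprMn exprVn mul2n -addnn !exprD; ring.
  rewrite le_eqVlt; apply/orP; left; apply/eqP.
  have es : expR (s%:R : R) * expR s%:R = expR 2 ^+ s.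
    by rewrite expRX -expRD; congr expR; lra.
  have ns : n%:R ^+ s != 0 :> R by rewrite expf_neq0 // gt_eqF.
  rewrite /C !exprMn exprVn -es mul2n -addnn !exprD.
  by field.
case: (val s) s0 ss sR => [//|t] _ ss sR; rewrite exprS.
have q0 : 0 <= C * t.+1%:R / n%:R by rewrite divr_ge0 // mulr_ge0 //; exact: ltW.
have q4 : C * t.+1%:R / n%:R <= 1 / 4.
  rewrite ler_pdivrMr // mulrC -ler_pdivlMr //; apply: (le_trans ss).
  by rewrite /eta le_eqVlt; apply/orP; left; apply/eqP; field; rewrite gt_eqF.
apply: (@le_trans _ _ (C * t.+1%:R / n%:R * (1 / 4) ^+ t)).
  apply: ler_wpM2l => //; apply: lerXn2r => //; rewrite nnegrE; lra.
have t2 : t.+1%:R <= 2 ^+ t :> R by rewrite -natrX ler_nat ltn_expl.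
have -> : 2 * C / n%:R * 2^-1 ^+ t.+1 = C / n%:R * (2 ^+ t * (1 / 4) ^+ t).
  rewrite -exprMn exprS; have -> : 2 * (1 / 4) = 2^-1 :> R by lra.
  rewrite [in LHS]mulrA; congr (_ * _); field; by rewrite gt_eqF.
have -> : C * t.+1%:R / n%:R * (1 / 4) ^+ t = C / n%:R * (t.+1%:R * (1 / 4) ^+ t).
  by ring.
rewrite ler_wpM2l ?divr_ge0 ?(ltW C0) // ler_wpM2r // exprn_ge0 //; lra.
Qed.

End SparseSets.

Section Repair.
Variables (R : realType) (n m k : nat).
Local Notation V := 'I_n.
Local Notation edges := {ffun 'I_m -> 'I_n * 'I_n}.
Implicit Types (e : edges) (W U : {set V}).

(** Fewer than [2 #|W|] pairs inside [W] leave a vertex with at most three incident positions. It is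
    removed, the rest is colored by induction, and one of the four colors remains for it. *)
Lemma four_coloring e W : loopless e ->
  (forall U, U \subset W -> (0 < #|U|)%N -> (hits e (setX U U) < 2 * #|U|)%N) ->
  exists c : {ffun V -> 'I_4}, forall i, (e i).1 \in W -> (e i).2 \in W ->
     c (e i).1 != c (e i).2.
Proof.
move=> /forallP lf.
elim: {W}_.+1 {-2}W (ltnSn #|W|) => // sz IH W Wsz sp.
have [W0|[w0 w0W]] := set_0Vmem W.
  by exists [ffun=> ord0] => i; rewrite W0 inE.
pose inc v := [set i | (e i \in setX W W) && ((v == (e i).1) || (v == (e i).2))].
have [v vW dv] : exists2 v, v \in W & (#|inc v| <= 3)%N.
  have [/exists_inP[v vW dv]|/exists_inPn H] :=
    boolP [exists v in W, (#|inc v| <= 3)%N]; first by exists v.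
  have Wp : (0 < #|W|)%N by apply/card_gt0P; exists w0.
  have h1 : (4 * #|W| <= \sum_(v in W) #|inc v|)%N.
    rewrite mulnC -sum_nat_const; apply: leq_sum => v vW.
    by have := H v vW; rewrite -ltnNge.
  have h2 : (\sum_(v in W) #|inc v| <= 2 * hits e (setX W W))%N.
    have -> : (\sum_(v in W) #|inc v| = \sum_(v in W) \sum_(i | e i \in setX W W)
         ((v == (e i).1) || (v == (e i).2)))%N.
      apply: eq_bigr => v _; rewrite -sum1_card big_mkcond [RHS]big_mkcond /=.
      apply: eq_bigr => i _; rewrite [i \in inc v]inE.
      by case: (e i \in _) => //=; case: (_ || _).
    rewrite exchange_big /= /hits.
    rewrite -sum1_card big_distrr /= (eq_bigl (fun i => e i \in setX W W)); last first.
      by move=> i; rewrite inE.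
    rewrite [leqRHS](eq_bigl (fun i => e i \in setX W W)); last by move=> i; rewrite inE.
    apply: leq_sum => i _; rewrite muln1.
    apply: (@leq_trans (\sum_(v in V) ((v == (e i).1) + (v == (e i).2))))%N.
      apply: (@leq_trans (\sum_(v in V) ((v == (e i).1) || (v == (e i).2))))%N.
        by rewrite [leqRHS](bigID (mem W)) /= leq_addr.
      by apply: leq_sum => v _; case: (v == _) => //=; case: (v == _).
    rewrite big_split /= (bigD1 (e i).1) //= eqxx big1 => [|v /negPf -> //].
    by rewrite (bigD1 (e i).2) //= eqxx big1 => [|v /negPf -> //].
  have := sp W (subxx W) Wp; lia.
have [c Hc] : exists c : {ffun V -> 'I_4}, forall i,
    (e i).1 \in W :\ v -> (e i).2 \in W :\ v -> c (e i).1 != c (e i).2.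
  apply: IH => [|U UW]; first by have := cardsD1 v W; rewrite vW; lia.
  by apply: sp; apply: (subset_trans UW); exact: subsetDl.
pose Fb := [set c (if v == (e i).1 then (e i).2 else (e i).1) | i in inc v].
have [col colF] : exists col, col \notin Fb.
  have lt : (#|Fb| < #|[set: 'I_4]|)%N.
    by rewrite cardsT card_ord ltnS (leq_trans (leq_imset_card _ _)).
  have : (0 < #|~: Fb|)%N by have := cardsC Fb; rewrite cardsT card_ord in lt *; lia.
  by case/card_gt0P => col; rewrite inE => ?; exists col.
exists [ffun u => if u == v then col else c u] => i i1 i2; rewrite !ffunE.
have iW : e i \in setX W W by rewrite (surjective_pairing (e i)) in_setX i1 i2.
have [e1|n1] := eqVneq (e i).1 v.
  have e2 : (e i).2 != v by rewrite -e1 eq_sym.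
  rewrite (negPf e2); apply: contra colF => /eqP ->.
  by apply/imsetP; exists i; rewrite ?[i \in _]inE ?iW -?e1 ?eqxx.
have [e2|n2] := eqVneq (e i).2 v.
  rewrite eq_sym; apply: contra colF => /eqP ->.
  apply/imsetP; exists i; first by rewrite [i \in _]inE iW e2 eqxx orbT.
  by rewrite eq_sym (negPf n1).
by apply: Hc; rewrite !inE ?n1 ?n2.
Qed.

(* The vertices incident to the violated edges are recolored with four spare
   colors; the old coloring is recovered from the new one up to the choice of
   the old colors of those few vertices. *)
Lemma repair_count (r : nat) e e' (A : {set {ffun V -> 'I_k}}) :
  (0 < k)%N -> loopless e ->
  (forall U, (0 < #|U|)%N -> (#|U| <= r)%N -> (hits e (setX U U) < 2 * #|U|)%N) ->
  (edist e e' <= r)%N -> (forall s, s \in A -> proper s e') ->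
  #|A|%:R <= #|[set t : {ffun V -> 'I_(k + 4)} | proper t e]|%:R * k%:R ^+ r :> R.
Proof.
move=> k0 lf sp er Ap; have lf' := forallP lf.
(* One end of each violated pair is enough. Violations occur only at positions where [e] and [e']
   differ, so [W s] has at most [r] vertices. *)
pose W (s : {ffun V -> 'I_k}) := [set (e i).1 | i in [set i | e i \in mono s]].
have Wr s : s \in A -> (#|W s| <= r)%N.
  move=> /Ap /forallP ps; apply: leq_trans er; apply: (leq_trans (leq_imset_card _ _)).
  apply: subset_leq_card; apply/subsetP => i; rewrite !(inE, in_set) => em.
  by apply/eqP => ee; have := ps i; rewrite -ee inE em.
pose rep (s : {ffun V -> 'I_k}) (t : {ffun V -> 'I_(k + 4)}) :=
  [forall v, if v \in W s then (k <= t v)%N else t v == lshift 4 (s v)].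
have ex s : s \in A -> exists t, proper t e && rep s t.
  move=> sA.
  have [c Hc] : exists c : {ffun V -> 'I_4}, forall i, (e i).1 \in W s -> (e i).2 \in W s ->
     c (e i).1 != c (e i).2.
    apply: four_coloring => // U US U0; apply: sp => //.
    by apply: leq_trans (subset_leq_card US) _; exact: Wr.
  exists [ffun v => if v \in W s then rshift k (c v) else lshift 4 (s v)].
  apply/andP; split; last first.
    apply/forallP => v; rewrite !ffunE; have [vW|vW] := boolP (v \in W s) => //=.
    exact: leq_addr.
  apply/forallP => i; rewrite inE !ffunE.
  case: ifP => w1; case: ifP => w2.
  - by rewrite (inj_eq (@rshift_inj _ _)) Hc.
  - by rewrite eq_rlshift.
  - by rewrite eq_lrshift.
  - rewrite (inj_eq (@lshift_inj _ _)); apply/negP => se.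
    by move/negP: w1; apply; apply/imsetP; exists i => //; rewrite !inE.
have -> : A = [set s | s \in A] by apply/setP => s; rewrite inE.
rewrite [X in _ <= X * _]natr_card_pred [X in _ <= X * _]big_mkcond /=.
apply: (@card_union_le R _ _ (fun s => s \in A)
  (fun t s => [&& proper t e, s \in A & rep s t])
  (fun t => if proper t e then 1 else 0)); first by rewrite exprn_ge0.
- by move=> s sA; have [t /andP[pt rt]] := ex s sA; exists t; apply/and3P.
- by move=> t; case: ifP.
move=> t [s0 /and3P[pt sA /forallP r0]]; rewrite ifT // mul1r.
(* The new coloring reveals which vertices were recolored, as exactly these carry a spare color. *)
have Wt s : rep s t -> W s = [set v | (k <= t v)%N].
  move/forallP => rs; apply/setP => v; rewrite [RHS]inE.
  have := rs v; case: ifP => [_ -> //|_ /eqP ->] /=.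
  by rewrite leqNgt ltn_ord.
have W0 : W s0 = [set v | (k <= t v)%N] by apply: Wt; apply/forallP.
have := @card_le_prod R _ _ (fun s => [&& proper t e, s \in A & rep s t])
  (fun v c => if (v \in W s0) || (c == s0 v) then 1 else 0) 1.
rewrite mul1r => h; apply: (le_trans (h _ _)).
- by move=> v c; case: ifP.
- move=> s /and3P[_ _ rs]; rewrite big1 // => v _.
  have := forallP rs v; have := r0 v; rewrite (Wt s rs) W0.
  by case: ifP => //= _ /eqP -> /eqP /lshift_inj ->; rewrite eqxx.
apply: (@le_trans _ _ (\prod_(v < n) (if v \in W s0 then k%:R else 1))).
  apply: ler_prod => v _; rewrite sumr_ge0 => [|c _]; last by case: ifP.
  case: ifP => vW /=; first by rewrite sumr_const card_ord.
  by rewrite (bigD1 (s0 v)) //= eqxx big1 ?addr0 // => c /negPf ->.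
rewrite -big_mkcond /= prodr_const; apply: ler_weXn2l; last exact: Wr.
by rewrite (ler_nat _ 1).
Qed.

End Repair.

(** * Lower bound on the number of colorings *)

(** Outside [A] the variable is below half of the guaranteed mean. On [A] it is linearised by
    [2 s Z <= s ^ 2 Z ^ 2 + 1] with [s = M1 / (2 M2)], which leaves a quarter of [M1] to be carried
    by [#|A|]. *)
Lemma paley_zygmund (R : realType) (T : finType) (Z : T -> R) (M1 M2 : R) :
  0 < M1 -> 0 < M2 -> (forall x, 0 <= Z x) ->
  M1 <= \sum_x Z x -> \sum_x Z x ^+ 2 <= M2 ->
  M1 ^+ 2 / (4 * M2) <= #|[set x | M1 / (2 * #|T|%:R) <= Z x]|%:R.
Proof.
move=> M10 M20 Z0 h1 h2.
set A := [set x | _].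
have [T0|Tp] := posnP #|T|.
  have : \sum_x Z x = 0.
    by apply: big1 => x; have := fintype0 (x : T) T0.
  by move=> e; rewrite e in h1; lra.
have TR : 0 < #|T|%:R :> R by rewrite ltr0n.
pose s : R := M1 / (2 * M2).
have s0 : 0 < s by rewrite divr_gt0 // mulr_gt0.
have hZ x : Z x <= M1 / (2 * #|T|%:R) + (s / 2 * Z x ^+ 2 + (x \in A)%:R / (2 * s)).
  have [xA|] := boolP (x \in A); last first.
    rewrite inE -ltNge => /ltW zx; rewrite mul0r addr0.
    have : 0 <= s / 2 * Z x ^+ 2 by rewrite mulr_ge0 ?sqr_ge0 //; lra.
    lra.
  have p1 : 0 <= M1 / (2 * #|T|%:R) by rewrite divr_ge0 ?mulr_ge0 // ltW.
  have : 0 <= (s * Z x - 1) ^+ 2 / (2 * s) by rewrite divr_ge0 ?sqr_ge0 //; lra.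
  have -> : (s * Z x - 1) ^+ 2 / (2 * s) = s / 2 * Z x ^+ 2 - Z x + 1 / (2 * s).
    by field; rewrite gt_eqF.
  by rewrite /=; lra.
have : \sum_x Z x <= M1 / 2 + (s / 2 * M2 + #|A|%:R / (2 * s)).
  apply: (le_trans (ler_sum _ (fun x _ => hZ x))).
  rewrite big_split big_split /= sumr_const -mulr_sumr -mulr_suml.
  have -> : \sum_i ((i \in A)%:R : R) = #|A|%:R.
    rewrite natr_cards [RHS]big_mkcond /=; apply: eq_bigr => i _.
    by case: (i \in A).
  rewrite lerD // ?lerD2r ?ler_wpM2l //; last by rewrite ltW // divr_gt0.
  rewrite -[leLHS]mulr_natr le_eqVlt; apply/orP; left; apply/eqP.
  by field; rewrite gt_eqF.
move=> h; have {}h := le_trans h1 h.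
have e1 : s / 2 * M2 = M1 / 4 by rewrite /s; field; rewrite gt_eqF.
have e2 : #|A|%:R / (2 * s) = #|A|%:R * M2 / M1.
  by rewrite /s; field; rewrite (gt_eqF M10) (gt_eqF M20).
rewrite e1 e2 in h.
have h3 : M1 / 4 <= #|A|%:R * M2 / M1 by lra.
rewrite ler_pdivrMr ?mulr_gt0 //; rewrite ler_pdivlMr // in h3.
by rewrite expr2; lra.
Qed.

(** [blowup] with [q = 1 + x] and [D] equal to [r] on the far set and 0 elsewhere, combined with
    [1 + x >= exp (x / 2)] and [(q + 1) ^ 2 / (4 q) <= exp (x ^ 2 / 4)]. *)
Lemma far_count (R : realType) (m r : nat) (T : finType)
    (A : {set {ffun 'I_m -> T}}) (x : R) : 0 < x -> x <= 1 ->
  #|[set e | [forall (e' | e' \in A), (r <= edist e e')%N]]|%:R * #|A|%:R <=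
  expR (x ^+ 2 / 4 * m%:R - x / 2 * r%:R) * (#|T|%:R ^+ 2) ^+ m.
Proof.
move=> x0 x1; set Fa := [set e | _].
pose D e := if e \in Fa then r else 0%N.
have q1 : 1 <= 1 + x by lra.
have := @blowup R T (1 + x) m A D q1.
have hD e e' : e' \in A -> (D e <= edist e e')%N.
  by rewrite /D; case: ifP => // + e'A; rewrite inE => /forall_inP /(_ e' e'A).
move=> /(_ hD) hb.
have hq : expR (x / 2 * r%:R) * #|Fa|%:R <= \sum_e (1 + x) ^+ D e.
  rewrite natr_cards mulr_sumr [leLHS]big_mkcond /=; apply: ler_sum => e _.
  rewrite /D; case: ifP => _ //; rewrite mulr1 -expRX.
  apply: lerXn2r; rewrite ?nnegrE ?expR_ge0 //; first by lra.
  have h : 1 - x / 2 <= expR (- (x / 2)) by apply: expR_ge1Dx.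
  rewrite expRN in h.
  have p : 0 < 1 - x / 2 by lra.
  rewrite -[leLHS]invrK; apply: (@le_trans _ _ (1 - x / 2)^-1).
    by rewrite lef_pV2 // posrE ?invr_gt0 ?expR_gt0.
  rewrite -div1r ler_pdivrMr //.
  have : 0 <= x * (1 - x) by rewrite mulr_ge0 //; lra.
  by lra.
have hq2 : (1 + x + 1) ^+ 2 / (4 * (1 + x)) * #|T|%:R ^+ 2 <=
   expR (x ^+ 2 / 4) * #|T|%:R ^+ 2.
  apply: ler_wpM2r; first exact: sqr_ge0.
  apply: le_trans (expR_ge1Dx _).
  rewrite ler_pdivrMr; last by lra.
  have := mulr_ge0 (sqr_ge0 x) (ltW x0); rewrite !expr2; lra.
have {}hb : (\sum_e (1 + x) ^+ D e) * #|A|%:R <= expR (x ^+ 2 / 4 * m%:R) * (#|T|%:R ^+ 2) ^+ m.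
  apply: (le_trans hb); rewrite -expRX -exprMn; apply: lerXn2r => //; rewrite nnegrE.
    by rewrite mulr_ge0 ?sqr_ge0 // divr_ge0 ?sqr_ge0 //; lra.
  by rewrite mulr_ge0 ?expR_ge0 ?sqr_ge0.
have hh := le_trans (ler_wpM2r (ler0n R #|A|) hq) hb.
by rewrite expRD expRN mulrAC ler_pdivlMr ?expR_gt0 // [leLHS]mulrC mulrA.
Qed.

Section ManyColorings.
Variables (R : realType) (n k m : nat) (de q : R).
Local Notation V := 'I_n.
Local Notation edges := {ffun 'I_m -> 'I_n * 'I_n}.
Hypotheses (n0 : (0 < n)%N) (k1 : (1 < k)%N) (de0 : 0 < de) (dek : 2 * de <= k%:R - 1).
Hypothesis hq : m%:R / (k%:R - 1) ^+ 2 <= q * n%:R.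
Hypothesis hent : forall y, 0 <= y <= k%:R * (1 + de) -> q * (y - 1) ^+ 2 <= y * ln y - y + 1.
Hypothesis hbal : k%:R * expR (- (n%:R * (de ^+ 2 / (2 * (2 + de)) / k%:R))) <= 1 / 2.

Let p1 : R := n%:R ^+ 2 * (1 - (1 + de) / k%:R).
Let Z (e : edges) : R := #|balanced_colorings k de e|%:R.

(** The second moment exceeds the square of the first by a polynomial in [n], the number of overlap
    types, and by the discrepancy between classes of size at most [(1 + de) n / k] and equal ones.
    The latter is an exponential whose rate is proportional to [de]. *)
Lemma many_colorings_count :
  (n%:R ^+ 2) ^+ m * expR (- (4 * de / (k%:R - 1) * m%:R)) / (16 * n.+1%:R ^+ (k * k)) <=
  #|[set e : edges | k%:R ^+ n * (1 - (1 + de) / k%:R) ^+ m / 4 <= Z e]|%:R.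
Proof.
have kp : 1 < k%:R :> R by rewrite (ltr_nat _ 1).
have kpos : 0 < k%:R :> R by lra.
have npos : 0 < n%:R :> R by rewrite ltr0n.
have ki : 0 < k%:R^-1 :> R by rewrite invr_gt0.
have k11 : 0 < 1 - k%:R^-1 :> R by rewrite subr_gt0 invf_lt1.
have pk : 0 < 1 - (1 + de) / k%:R.
  by rewrite subr_gt0 ltr_pdivrMr // mul1r; move: dek de0; lra.
have p1p : 0 < p1 by rewrite mulr_gt0 ?exprn_gt0.
pose M1 := k%:R ^+ n / 2 * p1 ^+ m.
pose M2 := (n%:R ^+ 2 * (1 - k%:R^-1) ^+ 2) ^+ m * (k%:R ^+ 2) ^+ n * n.+1%:R ^+ (k * k) : R.
have M10 : 0 < M1 by rewrite mulr_gt0 ?exprn_gt0 // divr_gt0 ?exprn_gt0.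
have M20 : 0 < M2 by rewrite !mulr_gt0 ?exprn_gt0 // ?mulr_gt0 ?exprn_gt0 ?ltr0n.
have Z0 e : 0 <= Z e by [].
have ZE e : Z e = \sum_(s : {ffun V -> 'I_k} | balanced de s) (proper s e)%:R.
  rewrite /Z natr_cards big_mkcond [RHS]big_mkcond /=; apply: eq_bigr => s _.
  by rewrite [s \in _]inE; case: (balanced de s) => //=; case: (proper s e).
have cE (P : pred edges) : \sum_e (P e)%:R = #|[set e | P e]|%:R :> R.
  by rewrite natr_card_pred [RHS]big_mkcond /=; apply: eq_bigr => e _; case: (P e).
have h1 : M1 <= \sum_e Z e.
  rewrite (eq_bigr _ (fun e _ => ZE e)) exchange_big /=.
  apply: (@le_trans _ _ (\sum_(s : {ffun V -> 'I_k} | balanced de s) p1 ^+ m)); last first.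
    apply: ler_sum => s bs; rewrite cE.
    have -> : [set e : edges | proper s e] = [set e | proper s e && proper s e].
      by apply/setP => e; rewrite !inE andbb.
    rewrite card_proper_pair setUid; apply: lerXn2r; rewrite ?nnegrE; first exact: ltW.
      rewrite subr_ge0 -natrX ler_nat (leq_trans (max_card _)) // card_prod card_ord.
      by rewrite expnS expn1.
    have := card_mono_balanced k1 bs; rewrite /p1 mulrBr mulr1; lra.
  rewrite sum_const_pred /M1; apply: ler_wpM2r; first by rewrite exprn_ge0 // ltW.
  have hu := @card_unbalanced_le R n k de n0 k1 de0.
  have hc : #|[set s : {ffun V -> 'I_k} | balanced de s]|%:R +
       #|[set s : {ffun V -> 'I_k} | ~~ balanced de s]|%:R = k%:R ^+ n :> R.
    rewrite -natrX -[X in (_ ^ X)%N](card_ord n) -[X in (X ^ _)%N](card_ord k) -card_ffun.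
    rewrite -(cardsC [set s : {ffun V -> 'I_k} | balanced de s]) natrD.
    by congr (_ + _%:R); apply: eq_card => s; rewrite !inE.
  have kn : 0 <= k%:R ^+ n :> R by rewrite exprn_ge0.
  have h := ler_wpM2l kn hbal.
  move: hu hc h; rewrite mulrAC; lra.
have h2 : \sum_e Z e ^+ 2 <= M2.
  have e1 e : Z e ^+ 2 = \sum_(s : {ffun V -> 'I_k} | balanced de s)
     \sum_(t : {ffun V -> 'I_k} | balanced de t)
     (proper s e && proper t e)%:R.
    rewrite expr2 {1}ZE mulr_suml; apply: eq_bigr => s _; rewrite ZE mulr_sumr.
    by apply: eq_bigr => t _; rewrite -natrM mulnb.
  rewrite (eq_bigr _ (fun e _ => e1 e)) exchange_big /=.
  pose f (s t : {ffun V -> 'I_k}) : {ffun V -> 'I_k * 'I_k} := [ffun v => (s v, t v)].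
  pose w (h : {ffun V -> 'I_k * 'I_k}) : R := \prod_v (#|[set u | h u == h v]|%:R / n%:R).
  have w0 h : 0 <= w h by apply: prodr_ge0 => v _; rewrite divr_ge0.
  pose c : R := (n%:R ^+ 2 * (1 - k%:R^-1) ^+ 2) ^+ m * (k%:R ^+ 2) ^+ n.
  have c0 : 0 <= c.
    by apply: mulr_ge0; apply: exprn_ge0; rewrite ?sqr_ge0 //; apply: mulr_ge0; exact: sqr_ge0.
  apply: (@le_trans _ _ (\sum_(s : {ffun V -> 'I_k}) \sum_(t : {ffun V -> 'I_k}) c * w (f s t))).
    rewrite big_mkcond /=; apply: ler_sum => s _.
    have [bs|_] := boolP (balanced de s); last first.
      by apply: sumr_ge0 => t _; rewrite mulr_ge0.
    rewrite exchange_big /= big_mkcond /=; apply: ler_sum => t _.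
    case: ifP => bt; last by rewrite mulr_ge0.
    rewrite cE; apply: (le_trans (pair_proper_le n0 k1 bs bt hq hent)).
    rewrite -/c le_eqVlt; apply/orP; left; apply/eqP; congr (_ * _).
    apply: eq_bigr => v _; congr (_%:R / _); apply: eq_card => u.
    by rewrite !inE !ffunE xpair_eqE.
  rewrite pair_big /=.
  under eq_bigr do [].
  rewrite -mulr_sumr /M2 -/c; apply: ler_wpM2l => //.
  have := @sum_types_le R n ('I_k * 'I_k)%type n0.
  rewrite card_prod card_ord; apply: le_trans.
  rewrite (reindex (fun p : {ffun V -> 'I_k} * {ffun V -> 'I_k} => f p.1 p.2)) //.
  exists (fun h : {ffun V -> 'I_k * 'I_k} => ([ffun v => (h v).1], [ffun v => (h v).2])).
    by case=> s t _; congr (_, _); apply/ffunP => v; rewrite !ffunE.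
  by move=> h _; apply/ffunP => v; rewrite !ffunE; case: (h v).
have := paley_zygmund M10 M20 Z0 h1 h2.
have cT : #|{: edges}|%:R = (n%:R ^+ 2) ^+ m :> R.
  by rewrite card_ffun card_prod !card_ord natrX natrM.
have nm : (n%:R ^+ 2) ^+ m != 0 :> R by rewrite !expf_neq0 // gt_eqF.
have -> : M1 / (2 * #|{: edges}|%:R) = k%:R ^+ n * (1 - (1 + de) / k%:R) ^+ m / 4.
  by rewrite cT /M1 /p1 exprMn; field.
apply: le_trans.
have kn : k%:R ^+ n != 0 :> R by rewrite expf_neq0 // gt_eqF.
have nk : n.+1%:R ^+ (k * k) != 0 :> R by rewrite expf_neq0 // pnatr_eq0.
have km : (1 - k%:R^-1) ^+ m != 0 :> R by rewrite expf_neq0 // gt_eqF.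
have -> : M1 ^+ 2 / (4 * M2) = (n%:R ^+ 2) ^+ m *
   (((1 - (1 + de) / k%:R) / (1 - k%:R^-1)) ^+ m) ^+ 2 / (16 * n.+1%:R ^+ (k * k)).
  rewrite /M1 /M2 /p1 expr_div_n [(n%:R ^+ 2 * _ ^+ 2) ^+ m]exprMn.
  rewrite [(n%:R ^+ 2 * (1 - _)) ^+ m]exprMn.
  rewrite [((1 - k%:R^-1) ^+ 2) ^+ m]exprAC [(k%:R ^+ 2) ^+ n]exprAC.
  set a := (n%:R ^+ 2) ^+ m in nm *; set b := k%:R ^+ n in kn *.
  set c := n.+1%:R ^+ _ in nk *; set z := (1 - k%:R^-1) ^+ m in km *.
  by field; rewrite ?nm ?kn ?nk ?km.
apply: ler_wpM2r; first by rewrite invr_ge0 mulr_ge0 // exprn_ge0.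
apply: ler_wpM2l; first by rewrite exprn_ge0 // sqr_ge0.
have -> : (1 - (1 + de) / k%:R) / (1 - k%:R^-1) = 1 - de / (k%:R - 1).
  by field; rewrite (gt_eqF kpos) /= gt_eqF //; lra.
have -> : expR (- (4 * de / (k%:R - 1) * m%:R)) = (expR (- (2 * (de / (k%:R - 1)))) ^+ m) ^+ 2.
  by rewrite !expRX; congr expR; field; rewrite gt_eqF //; lra.
set y := de / (k%:R - 1).
have y0 : 0 <= y by rewrite divr_ge0 //; move: de0; lra.
have y2 : y <= 1 / 2 by rewrite ler_pdivrMr; [move: dek|]; lra.
apply: lerXn2r; rewrite ?nnegrE ?exprn_ge0 ?expR_ge0 //; first by lra.
apply: lerXn2r; rewrite ?nnegrE ?expR_ge0 //; first by lra.
have h : 1 + 2 * y <= expR (2 * y) by exact: expR_ge1Dx.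
rewrite expRN; apply: (@le_trans _ _ (1 + 2 * y)^-1).
  by rewrite lef_pV2 // posrE ?expR_gt0 //; lra.
rewrite -div1r ler_pdivrMr; last by lra.
have : 0 <= y * (1 - 2 * y) by rewrite mulr_ge0 //; lra.
by lra.
Qed.

End ManyColorings.

Section LowerBound.
Variable R : realType.

Lemma poly_exp_small (j : nat) (c e0 : R) : 0 < c -> 0 < e0 ->
  exists n0 : nat, forall n : nat, (n0 <= n)%N ->
    n.+1%:R ^+ j * expR (- (c * n%:R)) <= e0.
Proof.
move=> c0 e00; pose b : R := c / (2 * j.+1%:R).
have j0 : 0 < j.+1%:R :> R by rewrite ltr0n.
have b0 : 0 < b by rewrite divr_gt0 // mulr_gt0.
pose K : R := (b^-1) ^+ j * expR (c / 2).
have K0 : 0 < K by rewrite mulr_gt0 ?expR_gt0 // exprn_gt0 // invr_gt0.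
have [n0 Hn0] := exists_nat_ge (2 * K / (c * e0)).
exists n0 => n nn0.
have h1 : n.+1%:R <= b^-1 * expR (b * n.+1%:R).
  rewrite ler_pdivlMl //; apply: le_trans (expR_ge1Dx _); lra.
have h2 : n.+1%:R ^+ j <= K * expR (c / 2 * n%:R).
  apply: (@le_trans _ _ ((b^-1 * expR (b * n.+1%:R)) ^+ j)).
    apply: lerXn2r; rewrite ?nnegrE // mulr_ge0 ?expR_ge0 // invr_ge0; exact: ltW.
  rewrite exprMn /K -[leRHS]mulrA; apply: ler_wpM2l.
    by rewrite exprn_ge0 // invr_ge0 ltW.
  rewrite expRX -expRD ler_expR.
  have h3 : b * j%:R <= c / 2.
    rewrite /b mulrAC ler_pdivrMr ?mulr_gt0 //.
    have h4 : c * j%:R <= c * j.+1%:R by rewrite ler_pM2l // ler_nat.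
    have -> : c / 2 * (2 * j.+1%:R) = c * j.+1%:R by field.
    exact: h4.
  have := ler_wpM2r (ler0n R n.+1) h3.
  by rewrite -[n.+1%:R]nat1r; lra.
apply: (@le_trans _ _ (K * expR (c / 2 * n%:R) * expR (- (c * n%:R)))).
  by apply: ler_wpM2r; rewrite ?expR_ge0.
rewrite -mulrA -expRD.
have -> : c / 2 * n%:R + - (c * n%:R) = - (c / 2 * n%:R) by lra.
rewrite expRN ler_pdivrMr ?expR_gt0 //.
have h5 : c / 2 * n%:R <= expR (c / 2 * n%:R).
  by apply: le_trans (expR_ge1Dx _); lra.
apply: le_trans (ler_wpM2l (ltW e00) h5).
have := le_trans Hn0 (_ : n0%:R <= n%:R); rewrite ler_nat nn0 => /(_ isT).
rewrite ler_pdivrMr ?mulr_gt0 //; lra.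
Qed.

(** The second moment is applied with [k - 4] colors, whence [k - 5] in [q]; the interval up to [k]
    leaves room for slightly unequal classes. The factor [1 - eps / 2] is what brings [q * k + 2]
    below [ln k]. *)
Lemma large_ln_bounds (eps : R) (k : nat) : 0 < eps -> eps <= 1 / 2 -> (1 < k)%N ->
  100 / eps + 400 <= ln k%:R ->
  let l := ln k%:R in let q := (1 - eps / 2) * (k%:R * l) / (k%:R - 5) ^+ 2 in
  [/\ 400 <= l, 8 * l <= k%:R & forall y, 0 <= y <= k%:R ->
    q * (y - 1) ^+ 2 <= y * ln y - y + 1].
Proof.
move=> e0 e1 k1 lC l q.
have k0 : 0 < k%:R :> R by rewrite ltr0n ltnW.
have l400 : 400 <= l.
  have : 0 < 100 / eps by rewrite divr_gt0.
  by move: lC; rewrite -/l; lra.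
have sq_le (c z : R) : 0 < c -> 2 * c <= z -> z ^+ 2 <= (2 * c) ^+ 2 * expR (z / c).
  move=> c0 cz; have -> : z / c = z / (2 * c) * 2%:R by field; rewrite gt_eqF.
  rewrite -expRX -exprMn; apply: lerXn2r; rewrite ?nnegrE.
  - lra.
  - by rewrite mulr_ge0 ?expR_ge0 //; lra.
  rewrite mulrC -ler_pdivrMr; last by lra.
  by apply: le_trans (expR_ge1Dx _); lra.
have kE : expR l = k%:R by rewrite lnK.
have k8 : 8 * l <= k%:R.
  have := sq_le 1 l ltr01; rewrite divr1 kE expr2 => /(_ ltac:(lra)) h.
  have : 400 * l <= l * l by rewrite ler_wpM2r //; lra.
  by rewrite !mulr1 in h; lra.
have keps : 100 <= eps * k%:R.
  rewrite [leRHS]mulrC -ler_pdivrMr //; move: lC; rewrite -/l; lra.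
have k5 : 0 < k%:R - 5 :> R by lra.
have qk : q * k%:R + 2 <= l.
  have h1 : k%:R / (k%:R - 5) <= 1 + eps / 16 by rewrite ler_pdivrMr //; lra.
  have h2 : (k%:R / (k%:R - 5)) ^+ 2 <= 1 + eps / 4.
    have p : 0 <= k%:R / (k%:R - 5) :> R by rewrite divr_ge0 // ltW.
    apply: (@le_trans _ _ ((1 + eps / 16) ^+ 2)).
      by apply: lerXn2r; rewrite ?nnegrE //; lra.
    have : 0 <= eps * (1 - eps) by rewrite mulr_ge0 //; lra.
    by rewrite !expr2; lra.
  have -> : q * k%:R = (1 - eps / 2) * (k%:R / (k%:R - 5)) ^+ 2 * l.
    by rewrite /q; field; rewrite gt_eqF.
  have h3 : (1 - eps / 2) * (k%:R / (k%:R - 5)) ^+ 2 <= 1 - eps / 4.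
    apply: (@le_trans _ _ ((1 - eps / 2) * (1 + eps / 4))).
      by apply: ler_wpM2l => //; lra.
    have : 0 <= eps * eps by rewrite mulr_ge0 // ltW.
    by lra.
  have h4 := ler_wpM2r (_ : 0 <= l) h3.
  have h5 : 8 <= eps * l.
    have : 100 / eps <= l by move: lC; rewrite -/l; lra.
    by rewrite ler_pdivrMr // mulrC; lra.
  by have := h4 ltac:(lra); lra.
have q0 : 0 <= q.
  rewrite divr_ge0 ?sqr_ge0 // mulr_ge0 //; first by lra.
  by rewrite mulr_ge0 //; lra.
split=> // y yk; apply: entropy_ge_quadratic yk => //.
  have h1 : ln (1 + k%:R * q) <= l / 8.
    have p : 0 < 1 + k%:R * q by rewrite -[ltLHS]addr0 ltr_leD // mulr_ge0.
    rewrite -[leRHS](@expRK R) ler_ln ?posrE ?expR_gt0 //.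
    apply: (@le_trans _ _ l); first by lra.
    have := sq_le 8 l ltac:(lra) ltac:(lra); rewrite !expr2 => h.
    have : 400 * l <= l * l by rewrite ler_wpM2r //; lra.
    lra.
  by rewrite -/l; lra.
have : q * k%:R * 8 <= l * 8 by rewrite ler_wpM2r //; lra.
move=> h; have : 8 * q * k%:R <= 1 * k%:R by lra.
by rewrite ler_pM2r.
Qed.

(** With [L = n / k1], passing from [k] to [k1 = k + 4] colors costs [exp (5 L)] for the number of
    maps and [exp (7 l L)] for the edge constraints; recovering the old colors of [r] vertices and
    the constant 4 cost [exp (l L)] each. The sum stays below [11 l L]. *)
Lemma repaired_bound (n m k r : nat) (de : R) : (0 < n)%N ->
  let k1 := (k + 4)%N in let l := ln k1%:R in
  400 <= l -> 8 * l <= k1%:R -> 0 < de -> de * k1%:R <= 1 ->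
  m%:R <= k1%:R * l * n%:R -> r%:R <= n%:R / k1%:R :> R -> k1%:R <= n%:R :> R ->
  k1%:R ^+ n * (1 - k1%:R^-1) ^+ m * expR (- (11 * l * (n%:R / k1%:R))) * k%:R ^+ r <=
  k%:R ^+ n * (1 - (1 + de) / k%:R) ^+ m / 4.
Proof.
move=> n0 k1 l l400 k8 de0 dek hm hr hn.
have kE : k1%:R = k%:R + 4 :> R by rewrite natrD.
set K : R := k1%:R in kE k8 dek hm hr hn *.
have K3200 : 3200 <= K by lra.
have K0 : 0 < K by lra.
have k0 : 0 < k%:R :> R by lra.
have nR : 0 < n%:R :> R by rewrite ltr0n.
pose L : R := n%:R / K.
have L0 : 0 < L by rewrite divr_gt0.
have L1 : 1 <= L by rewrite ler_pdivlMr // mul1r.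
have a1 : K ^+ n <= k%:R ^+ n * expR (5 * L).
  have -> : expR (5 * L) = expR (5 / K) ^+ n.
    by rewrite expRX; congr expR; rewrite /L; field; rewrite gt_eqF.
  rewrite -exprMn; apply: lerXn2r; rewrite ?nnegrE ?mulr_ge0 ?expR_ge0 ?(ltW K0) //.
  have h : 1 + 5 / K <= expR (5 / K) by exact: expR_ge1Dx.
  apply: le_trans (ler_wpM2l (ltW k0) h).
  have : k%:R * (5 / K) = 5 - 20 / K by rewrite -[k%:R](addrK 4) -kE; field; rewrite gt_eqF.
  have : 20 / K <= 1 by rewrite ler_pdivrMr //; lra.
  lra.
have de1 : de <= 1 by have := ler_wpM2l (ltW de0) K3200; lra.
pose P := 1 - (1 + de) / k%:R.
have P9 : 9 / 10 <= P.
  have : (1 + de) / k%:R <= 1 / 10 by rewrite ler_pdivrMr //; lra.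
  rewrite /P; lra.
have a2 : (1 - K^-1) ^+ m <= P ^+ m * expR (7 * l * L).
  have h7 : 7 / K ^+ 2 * m%:R <= 7 * l * L.
    rewrite mulrAC ler_pdivrMr ?exprn_gt0 //.
    have -> : 7 * l * L * K ^+ 2 = 7 * (K * l * n%:R) by rewrite /L; field; rewrite gt_eqF.
    lra.
  apply: (@le_trans _ _ (P ^+ m * expR (7 / K ^+ 2 * m%:R))); last first.
    by apply: ler_wpM2l; rewrite ?ler_expR // exprn_ge0; lra.
  rewrite -expRX -exprMn; apply: lerXn2r; rewrite ?nnegrE.
  - by rewrite subr_ge0 invf_le1 //; lra.
  - by rewrite mulr_ge0 ?expR_ge0 //; lra.
  have h : 1 + 7 / K ^+ 2 <= expR (7 / K ^+ 2) by exact: expR_ge1Dx.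
  apply: (@le_trans _ _ (P * (1 + 7 / K ^+ 2))); last by apply: ler_wpM2l => //; lra.
  have h1 : (1 + de) / k%:R - K^-1 <= 63 / 10 / K ^+ 2.
    have -> : (1 + de) / k%:R - K^-1 = (4 + de * K) / (K * k%:R).
      by rewrite kE; field; rewrite (gt_eqF k0) /= gt_eqF //; lra.
    rewrite ler_pdivrMr ?mulr_gt0 // mulrAC ler_pdivlMr ?exprn_gt0 //.
    apply: (@le_trans _ _ (5 * K ^+ 2)).
      by apply: ler_wpM2r; rewrite ?sqr_ge0 //; lra.
    rewrite expr2 mulrA [leRHS]mulrA.
    have h5 : 5 * K <= 63 / 10 * k%:R by lra.
    by have := ler_wpM2r (ltW K0) h5; lra.
  have p7 : 0 <= 7 / K ^+ 2 by rewrite divr_ge0 ?sqr_ge0.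
  have h2 := ler_wpM2r p7 P9.
  have e3 : 9 / 10 * (7 / K ^+ 2) = 63 / 10 / K ^+ 2 by field; rewrite gt_eqF.
  rewrite e3 in h2; rewrite /P in h2 *; lra.
have a3 : k%:R ^+ r <= expR (l * L).
  apply: (@le_trans _ _ (K ^+ r)).
    by apply: lerXn2r; rewrite ?nnegrE //; lra.
  have -> : K = expR l by rewrite lnK.
  by rewrite expRX ler_expR ler_wpM2l //; lra.
have a4 : 4 <= expR (l * L).
  apply: le_trans (expR_ge1Dx _).
  have : l * 1 <= l * L by rewrite ler_wpM2l //; lra.
  lra.
have q1 : 0 <= K ^+ n by rewrite exprn_ge0 // ltW.
have q2 : 0 <= (1 - K^-1) ^+ m by rewrite exprn_ge0 // subr_ge0 invf_le1 //; lra.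
have q3 : 0 <= k%:R ^+ r :> R by rewrite exprn_ge0.
have b1 := ler_pM q1 q2 a1 a2.
have b2 := ler_pM (mulr_ge0 q1 q2) q3 b1 a3.
have b3 := ler_pM (mulr_ge0 (mulr_ge0 q1 q2) q3) (ler0n R 4) b2 a4.
rewrite ler_pdivlMr //.
have -> : k1%:R ^+ n * (1 - k1%:R^-1) ^+ m * expR (- (11 * l * (n%:R / k1%:R))) *
   k%:R ^+ r * 4 = expR (- (11 * l * L)) * (K ^+ n * (1 - K^-1) ^+ m * k%:R ^+ r * 4).
  by rewrite /L /K; ring.
apply: (le_trans (ler_wpM2l (expR_ge0 _) b3)).
set kn := k%:R ^+ n; set Pm := P ^+ m.
have -> : expR (- (11 * l * L)) * (kn * expR (5 * L) * (Pm * expR (7 * l * L)) *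
   expR (l * L) * expR (l * L)) =
   kn * Pm * expR (- (11 * l * L) + (5 * L + (7 * l * L + (l * L + l * L)))).
  by rewrite !expRD; ring.
rewrite -[leRHS]mulr1; apply: ler_wpM2l.
  by rewrite mulr_ge0 // exprn_ge0 //; lra.
rewrite -[leRHS]expR0 ler_expR.
have : 400 * L <= l * L by rewrite ler_wpM2r // ltW.
lra.
Qed.

(** [eta] is the share of vertices that can be repaired, [x = eta / (2 K l)] the concentration
    parameter suited to distance [eta n], and [de] is then small enough for the second moment loss
    to be negligible beside the concentration gain. *)
Lemma repair_constants (K l eta1 : R) : 400 <= l -> 8 * l <= K -> 0 < eta1 ->
  exists eta x de : R,
  [/\ 0 < eta, eta <= eta1 & eta <= K^-1] /\ [/\ 0 < x, x <= 1 & 0 < de] /\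
  [/\ de * (K * l) = x * eta / 32, x * eta / 8 = x ^+ 2 / 4 * (K * l),
      de * K <= 1 & de <= 1].
Proof.
move=> l400 k8 eta10.
have K0 : 0 < K by lra.
have d1 : 1 <= K * l.
  have : K * 400 <= K * l by rewrite ler_pM2l.
  lra.
have [eta [eta0 etal etaK]] : exists eta, [/\ 0 < eta, eta <= eta1 & eta <= K^-1].
  exists (Num.min eta1 K^-1).
  by rewrite lt_min eta10 invr_gt0 K0 ge_min lexx ge_min lexx orbT.
have KlK : K <= K * l by rewrite ler_peMr //; lra.
have [d dE] : exists d, d = K * l by exists (K * l).
rewrite -dE in d1 KlK *.
have Ki : K^-1 <= 1 by rewrite invf_le1 //; lra.
have d0 : 0 < d by lra.
have x0 : 0 < eta / (2 * d) by rewrite divr_gt0 // mulr_gt0.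
have x1 : eta / (2 * d) <= 1 by rewrite ler_pdivrMr ?mulr_gt0 //; lra.
have [x xE] : exists x, x = eta / (2 * d) by exists (eta / (2 * d)).
rewrite -xE in x0 x1.
have xe : 0 < x * eta by rewrite mulr_gt0.
have de0 : 0 < x * eta / (32 * d) by rewrite divr_gt0 // mulr_gt0.
have [de deE] : exists de, de = x * eta / (32 * d) by exists (x * eta / (32 * d)).
rewrite -deE in de0.
have ded : de * d = x * eta / 32 by rewrite deE; field; rewrite gt_eqF.
have deK : de * K <= 1.
  have h2 := ler_wpM2l (ltW de0) KlK.
  have h3 : x * eta <= 1 * 1 by apply: ler_pM; rewrite ?(ltW x0) ?(ltW eta0) //; lra.
  lra.
exists eta, x, de; split => //; split => //; split => //.
  by rewrite xE; field; rewrite gt_eqF.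
have h : de * 1 <= de * K by rewrite ler_pM2l //; lra.
lra.
Qed.

(** A loopless sequence with few colorings is either far from all sequences with many balanced
    [(k - 4)]-colorings, or contains a small dense set that obstructs the repair. Both kinds are
    rare. *)
Lemma colorings_lower_bound (eps : R) : 0 < eps -> eps <= 1 / 2 ->
  exists k0 : nat, (1 < k0)%N /\ forall k : nat, (k0 <= k)%N ->
  forall e0 : R, 0 < e0 -> exists n0 : nat, forall n m : nat, (n0 <= n)%N ->
    m%:R <= (1 - eps / 2) * (k%:R * ln k%:R) * n%:R ->
    #|[set e : {ffun 'I_m -> 'I_n * 'I_n} | loopless e &&
       (#|[set t : {ffun 'I_n -> 'I_k} | proper t e]|%:R <
        k%:R ^+ n * (1 - k%:R^-1) ^+ m * expR (- (11 * ln k%:R * (n%:R / k%:R))) :> R)]|%:R <=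
    e0 * (n%:R ^+ 2) ^+ m.
Proof.
move=> ep0 ep1; have [k0 [k01 Hk0]] := exists_ln_ge (100 / eps + 400).
exists k0; split => // k kk0 e0 e00.
have lC := Hk0 k kk0; have k1 : (1 < k)%N by exact: leq_trans kk0.
have [l400 k8 ent] := large_ln_bounds ep0 ep1 k1 lC.
have [K KE0] : exists K : R, K = k%:R by exists k%:R.
have [l lE] : exists l : R, l = ln K by exists (ln K).
rewrite /= -KE0 -lE in l400 k8 ent lC *.
have K3200 : 3200 <= K by lra.
have k4 : (4 <= k)%N by rewrite -(ler_nat R) -KE0; lra.
pose k' := (k - 4)%N; have kE : (k' + 4 = k)%N by rewrite subnK.
have KE : K = k'%:R + 4 by rewrite KE0 -kE natrD.
move: (k') kE KE => {}k' kE KE.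
have [d dE] : exists d : R, d = K * l by exists (K * l).
have K0 : 0 < K by lra.
have d1 : 1 <= d.
  have : K * 400 <= K * l by rewrite ler_pM2l.
  lra.
have d0 : 0 < d by lra.
have [eta1 eta10 Hsp] := sparse_rare d1.
have [eta [x [de [[eta0 etal etaK] [[x0 x1 de0] [dex x8 deK de1]]]]]] :=
  repair_constants l400 k8 eta10.
rewrite -dE in dex x8.
have e02 : 0 < e0 / 2 by rewrite divr_gt0.
have [n1 Hn1] := Hsp _ e02.
have xe0 : 0 < x * eta / 4 by rewrite divr_gt0 // mulr_gt0.
have e32 : 0 < e0 / 32 by rewrite divr_gt0.
have [n2 Hn2] := poly_exp_small (k' * k') xe0 e32.
have k'h : 1 <= k'%:R - 1 :> R by clear - K3200 KE; lra.
have k'0 : 0 < k'%:R :> R by clear - k'h; lra.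
pose cb := de ^+ 2 / (2 * (2 + de)) / k'%:R.
have cb0 : 0 < cb.
  by rewrite divr_gt0 // divr_gt0 ?exprn_gt0 // mulr_gt0 // addr_gt0.
have ek : 0 < 1 / 2 / k'%:R :> R by rewrite !divr_gt0.
have [n3 Hn3] := poly_exp_small 0 cb0 ek.
exists (n1 + n2 + n3 + k)%N => n m nn hm.
have [nn1 nn2 nn3 nnk] : [/\ (n1 <= n)%N, (n2 <= n)%N, (n3 <= n)%N & (k <= n)%N] by clear - nn; split; lia.
have npos : (0 < n)%N by apply: leq_trans nnk; exact: ltnW.
have nR : 0 < n%:R :> R by rewrite ltr0n.
have md : m%:R <= d * n%:R.
  apply: (le_trans hm); apply: ler_wpM2r => //; rewrite -dE -[leRHS]mul1r.
  by apply: ler_wpM2r; [exact: ltW|clear - ep0; lra].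
have etan : 0 <= eta * n%:R by rewrite mulr_ge0 // ltW.
have [r [r1 r2]] : exists r : nat, r%:R <= eta * n%:R /\ eta * n%:R < r.+1%:R.
  by exists (Num.truncn (eta * n%:R)); have /andP[] := truncn_itv etan.
have [q qE] : exists q : R, q = (1 - eps / 2) * (K * l) / (K - 5) ^+ 2.
  by exists ((1 - eps / 2) * (K * l) / (K - 5) ^+ 2).
rewrite -qE in ent.
have k'1 : (1 < k')%N by rewrite -(ltr_nat R); clear - k'h; lra.
have dek' : 2 * de <= k'%:R - 1 by clear - K3200 KE de1; lra.
have k5 : k'%:R - 1 = K - 5 by clear - KE; lra.
have hq : m%:R / (k'%:R - 1) ^+ 2 <= q * n%:R.
  rewrite k5 qE [leRHS]mulrAC; apply: ler_wpM2r => //.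
  by rewrite invr_ge0 sqr_ge0.
have hent y : 0 <= y <= k'%:R * (1 + de) -> q * (y - 1) ^+ 2 <= y * ln y - y + 1.
  move=> /andP[y0 yk]; apply: ent; rewrite y0 /=; apply: (le_trans yk).
  have h : k'%:R * de <= K * de by apply: ler_wpM2r; [exact: ltW|clear - KE; lra].
  by clear - h KE deK; lra.
have hbal : k'%:R * expR (- (n%:R * (de ^+ 2 / (2 * (2 + de)) / k'%:R))) <= 1 / 2.
  have := Hn3 n nn3; rewrite expr0 mul1r ler_pdivlMr // mulrC [cb * _]mulrC; exact.
have hA := many_colorings_count npos k'1 de0 dek' hq hent hbal.
set Z0 := k'%:R ^+ n * _ / 4 in hA; set A := [set e | _] in hA.
set N : R := (n%:R ^+ 2) ^+ m in hA *.
have N0 : 0 < N by rewrite !exprn_gt0.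
have hfar := @far_count R m r.+1 _ A x x0 x1.
set Fa := [set e | _] in hfar.
have cT : #|{: 'I_n * 'I_n}|%:R = n%:R ^+ 2 :> R.
  by rewrite card_prod !card_ord natrM.
have farN : #|Fa|%:R <= e0 / 2 * N.
  pose B := expR (- (4 * de / (k'%:R - 1) * m%:R)) / (16 * n.+1%:R ^+ (k' * k')).
  have nk0 : 0 < n.+1%:R ^+ (k' * k') :> R by rewrite exprn_gt0 // ltr0n.
  have B0 : 0 < B by rewrite divr_gt0 ?expR_gt0 // mulr_gt0.
  have hA' : N * B <= #|A|%:R by rewrite mulrA.
  have h1 := le_trans (ler_wpM2l (ler0n R #|Fa|) hA') hfar.
  rewrite cT exprAC -/N expr2 in h1.
  have h2 : #|Fa|%:R * B * N <= expR (x ^+ 2 / 4 * m%:R - x / 2 * r.+1%:R) * N * N.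
    by clear - h1; lra.
  rewrite ler_pM2r // -ler_pdivlMr // in h2; apply: (le_trans h2).
  rewrite mulrAC; apply: ler_wpM2r; first exact: ltW.
  rewrite /B invf_div mulrCA -expRN opprK mulrA.
  rewrite -[leLHS]mulrA -expRD.
  apply: (@le_trans _ _ (16 * (n.+1%:R ^+ (k' * k') * expR (- (x * eta / 4 * n%:R))))); last first.
    by have := Hn2 n nn2; clear; lra.
  rewrite [leRHS]mulrA; apply: ler_wpM2l; first by rewrite mulr_ge0 // ltW.
  rewrite ler_expR.
  (* In units of [x * eta * n], the concentration error and the second moment loss are at most 1/8
     each, against a gain of 1/2 from the distance; a decay of 1/4 is left to absorb the
     polynomial. *)
  have s1 : x ^+ 2 / 4 * m%:R <= x * eta / 8 * n%:R.
    rewrite x8 -[leRHS]mulrA.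
    by apply: ler_wpM2l => //; rewrite divr_ge0 ?sqr_ge0.
  have s2 : x / 2 * (eta * n%:R) <= x / 2 * r.+1%:R.
    by apply: ler_wpM2l; [rewrite divr_ge0 // ltW|exact: ltW].
  have s3 : 4 * de / (k'%:R - 1) * m%:R <= x * eta / 8 * n%:R.
    have e3 : 4 * de * (d * n%:R) = 4 * (de * d) * n%:R by ring.
    have -> : x * eta / 8 * n%:R = 4 * de * (d * n%:R) by rewrite e3 dex; field.
    apply: ler_pM => //.
      rewrite divr_ge0 ?mulr_ge0 ?(ltW de0) //; clear - k'h; lra.
    rewrite ler_pdivrMr; last by clear - k'h; lra.
    by have := ler_wpM2l (mulr_ge0 (ler0n R 4) (ltW de0)) k'h; rewrite mulr1.
  by clear - s1 s2 s3; lra.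
have spN := Hn1 n m nn1 md; rewrite -/N in spN; set Sp := [set e | _] in spN.
apply: (@le_trans _ _ (#|Fa| + #|Sp|)%:R); last by rewrite natrD; clear - farN spN; lra.
rewrite ler_nat; apply: leq_trans (leq_card_setU _ _); apply: subset_leq_card.
apply/subsetP => e; rewrite [e \in _]inE => /andP[le few].
rewrite in_setU; apply/negPn/negP; rewrite negb_or => /andP[eF eS].
move: eF; rewrite [e \in _]inE negb_forall_in => /exists_inP[e' e'A]; rewrite -ltnNge ltnS => er.
have sp (U : {set 'I_n}) : (0 < #|U|)%N -> (#|U| <= r)%N -> (hits e (setX U U) < 2 * #|U|)%N.
  move=> U0 Ur; rewrite ltnNge; apply: contra eS => hU.
  rewrite [e \in _]inE; apply/existsP; exists U; rewrite U0 hU andbT /=.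
  apply: (@le_trans _ _ r%:R); first by rewrite ler_nat.
  by apply: (le_trans r1); apply: ler_wpM2r.
have pr s : s \in balanced_colorings k' de e' -> proper s e' by rewrite inE => /andP[].
have := @repair_count R n m k' r e e' _ (ltnW k'1) le sp er pr.
rewrite kE => hrep.
move: e'A; rewrite [e' \in _]inE => e'A.
have := le_trans e'A hrep.
have hb := @repaired_bound n m k' r de npos; rewrite /= kE -KE0 -lE -dE in hb.
have rK : r%:R <= n%:R / K by apply: (le_trans r1); rewrite mulrC; exact: ler_wpM2l.
have Kn : K <= n%:R by rewrite KE0 ler_nat.
have hb' := hb l400 k8 de0 deK md rK Kn.
move=> hz; have := le_trans hb' hz.
rewrite ler_pM2r ?exprn_gt0 //.
by rewrite leNgt few.
Qed.

End LowerBound.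

(** * From edge sequences to graphs *)

Section Landscape.
Variables (R : realType) (n k m : nat).
Local Notation V := 'I_n.
Local Notation edges := {ffun 'I_m -> 'I_n * 'I_n}.
Implicit Types (e : edges) (s t : {ffun V -> 'I_k}).

Definition edge_ends e i : {set V} := [set (e i).1; (e i).2].
Definition graph_of e : {set {set V}} := [set edge_ends e i | i in 'I_m].
Definition simple e : bool := loopless e && injectiveb (edge_ends e).

Lemma energy_graph e s : simple e -> energy (graph_of e) s = hits e (mono s).
Proof.
move=> /andP[_ /injectiveP inj]; rewrite /energy /hits -(card_imset _ inj).
apply: eq_card => E; rewrite [E \in _]inE; apply/andP/imsetP.
  case=> /imsetP[i _ ->] /forall_inP H; exists i => //.
  rewrite [i \in _]inE [e i \in _]inE.
  have /forall_inP H1 := H (e i).1 (set21 _ _).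
  exact: (H1 (e i).2 (set22 _ _)).
case=> i; rewrite [i \in _]inE [e i \in _]inE => /eqP mi ->; split.
  by apply/imsetP; exists i.
by apply/forall_inP => u /set2P[] ->; apply/forall_inP => v /set2P[] ->; rewrite ?mi.
Qed.

Lemma proper_hits e s : proper s e = (hits e (mono s) == 0%N).
Proof.
rewrite cards_eq0; apply/forallP/eqP => [H|H i].
  by apply/setP => i; rewrite [i \in _]inE in_set0; apply/negbTE/H.
by apply/negP => ei; have := in_set0 i; rewrite -H [i \in _]inE ei.
Qed.

Lemma hamming_adjacentP s t : hamming_adjacent s t ->
  exists v, forall u, u != v -> s u = t u.
Proof.
move=> /cards1P[v hv]; exists v => u uv; apply/eqP/negPn/negP => st.
have : u \in [set v] by rewrite -hv inE.
by rewrite inE (negPf uv).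
Qed.

Section Shattered.
Variables (e : edges) (P : pred {ffun V -> 'I_k}).
Variables (th theta zeta gamma Dm : R).
Local Notation G := (graph_of e).
Local Notation sols := [set s : {ffun V -> 'I_k} | proper s e].
Hypotheses (n0 : (0 < n)%N) (theta0 : 0 < theta) (thth : theta <= th).
Hypothesis se : simple e.
Hypothesis touch : forall X : {set V}, #|X|%:R <= zeta * n%:R ->
  (touching e X)%:R < theta * n%:R.
Hypothesis few_bad : #|[set s | proper s e && P s]|%:R <=
  expR (- (gamma * n%:R)) * #|sols|%:R.
Hypothesis good : forall s, proper s e -> ~~ P s -> trapped th Dm s e.
Hypothesis Dm_le : Dm <= expR (- (gamma * n%:R)) * #|sols|%:R.
Hypothesis sols0 : (0 < #|sols|)%N.

(** Regions are the components below level [theta * n], whereas clusters are those at level 0; each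
    region is therefore a union of clusters, and the height condition between regions is built
    in. *)
Let adj : rel {ffun V -> 'I_k} := [rel s t | [&& hamming_adjacent s t,
  (energy G s)%:R < theta * n%:R & (energy G t)%:R < theta * n%:R]].
Let regions := equivalence_partition (connect adj) (solutions k G).

Let solE : solutions k G = sols.
Proof. by apply/setP => s; rewrite !inE energy_graph // proper_hits. Qed.

Let tn0 : 0 < theta * n%:R.
Proof. by rewrite mulr_gt0 // ltr0n. Qed.

Let ham_sym s t : hamming s t = hamming t s.
Proof. by apply: eq_card => v; rewrite !inE eq_sym. Qed.

Let csym : connect_sym adj.
Proof.
have sy s t : adj s t -> adj t s.
  case/and3P => h a b; apply/and3P; split => //.
  by move: h; rewrite /hamming_adjacent /= ham_sym.
by apply: sym_connect_sym => s t; apply/idP/idP; exact: sy.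
Qed.

Let eqv : {in solutions k G & &, equivalence_rel (connect adj)}.
Proof.
move=> s t u _ _ _; split; first exact: connect0.
by move=> st; exact: (same_connect csym st).
Qed.

Let regionP A : A \in regions -> exists2 x, x \in solutions k G &
  A = [set y in solutions k G | connect adj x y].
Proof. by case/imsetP => x xS ->; exists x. Qed.

Let region_eq A B s t : A \in regions -> B \in regions -> s \in A -> t \in B ->
  connect adj s t -> A = B.
Proof.
move=> /regionP[x _ ->] /regionP[y _ ->]; rewrite !inE => /andP[_ xs] /andP[_ yt] st.
have xy : connect adj x y.
  by apply: connect_trans xs (connect_trans st _); rewrite csym.
by apply/setP => z; rewrite !inE (same_connect csym xy).
Qed.

Let sol_adj s t : solution_adjacent G s t -> adj s t.
Proof.
case/and3P => + + h; rewrite !inE => /eqP e1 /eqP e2.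
by apply/and3P; split; rewrite ?e1 ?e2.
Qed.

Lemma region_is_region A : A \in regions -> is_region G A.
Proof.
move=> AR; have [x xS AE] := regionP AR; split.
  by apply/set0Pn; exists x; rewrite AE inE xS connect0.
exists [set c in clusters k G | c \subset A].
  by apply/subsetP => c; rewrite inE => /andP[].
apply/setP => s; apply/idP/bigcupP; last first.
  by case=> c; rewrite inE => /andP[_ /subsetP]; apply.
move=> sA; have sS : s \in solutions k G by move: sA; rewrite AE inE => /andP[].
exists [set y in solutions k G | connect (solution_adjacent G) s y]; last first.
  by rewrite [s \in _]inE sS connect0.
rewrite [_ \in [set c in _ | _]]inE; apply/andP; split.
  by apply/imsetP; exists s.
apply/subsetP => y; rewrite [y \in _]inE => /andP[yS sy].
rewrite AE in_set yS /=; move: sA; rewrite AE in_set => /andP[_ xs].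
apply: connect_trans xs _; apply: connect_sub sy => u v uv.
by apply: connect1; exact: sol_adj.
Qed.

(** Either the region consists of bad colorings, which are few altogether, or it contains a good
    one, whose trap contains the whole region. *)
Lemma region_small A : A \in regions ->
  #|A|%:R <= expR (- (gamma * n%:R)) * #|solutions k G|%:R.
Proof.
move=> AR; have [x xS AE] := regionP AR; rewrite solE.
have [allP|] := boolP [forall s in A, P s].
  apply: le_trans few_bad; rewrite ler_nat; apply: subset_leq_card.
  apply/subsetP => s sA; rewrite [s \in _]inE (forall_inP allP) // andbT.
  by move: sA; rewrite AE solE !inE => /andP[].
rewrite negb_forall_in => /exists_inP[s sA nP].
have ps : proper s e by move: sA; rewrite AE solE !inE => /andP[].
have [D [sD Dc Ds]] := good ps nP.
apply: le_trans Dm_le; apply: le_trans Ds; rewrite ler_nat; apply: subset_leq_card.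
apply/subsetP => y yA.
have : connect adj s y.
  move: sA yA; rewrite AE !inE => /andP[_ xs] /andP[_ xy].
  by apply: connect_trans xy; rewrite csym.
case/connectP => p; elim: p s sD {ps nP sA} => [|t p IH] s sD /=; first by move=> _ ->.
case/andP => /and3P[st _ te] pp yl; apply: (IH t) => //.
have [v hv] := hamming_adjacentP st.
apply: (Dc s t v sD hv); rewrite -energy_graph //; apply: (le_trans (ltW te)).
by rewrite ler_wpM2r.
Qed.

(** If [s] and [t] differ on a small set [X], recoloring the vertices of [X] one at a time leads
    from [s] to [t]. Every violated pair on the way touches [X], so the path stays below [theta * n]
    and the regions coincide. *)
Lemma regions_distant A B s t : A \in regions -> B \in regions -> A != B ->
  s \in A -> t \in B -> zeta * n%:R <= (hamming s t)%:R.
Proof.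
move=> AR BR AB sA tB; rewrite leNgt; apply: contra AB => hst.
apply/eqP; apply: (region_eq AR BR sA tB).
pose X := [set v | s v != t v].
have hX : (touching e X)%:R < theta * n%:R by apply: touch; exact: ltW.
have ps : proper s e.
  by have [x _ AE] := regionP AR; move: sA; rewrite AE solE !inE => /andP[].
have low (u : {ffun V -> 'I_k}) : (forall v, v \notin X -> u v = s v) -> (energy G u)%:R < theta * n%:R.
  move=> us; apply: le_lt_trans hX; rewrite ler_nat energy_graph //.
  apply: subset_leq_card; apply/subsetP => i; rewrite [i \in _]inE => eu.
  rewrite [i \in _]inE [e i \in _]inE; apply/negPn/negP; rewrite negb_or => /andP[x1 x2].
  have := forallP ps i; rewrite inE -(us _ x1) -(us _ x2).
  by move: eu; rewrite inE => ->.
suff : forall c (u : {ffun V -> 'I_k}), (#|[set v | u v != t v]| <= c)%N ->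
    (forall v, v \notin X -> u v = s v) -> connect adj u t.
  by move=> /(_ _ s (leqnn _)); apply.
elim=> [|c IH] u uc us.
  suff -> : u = t by exact: connect0.
  move: uc; rewrite leqn0 cards_eq0 => /eqP u0; apply/ffunP => v; apply/eqP/negPn/negP => uv.
  by have := in_set0 v; rewrite -u0 inE uv.
have [u0|[v]] := set_0Vmem [set v | u v != t v].
  by apply: IH => //; rewrite u0 cards0.
rewrite inE => uv.
have vX : v \in X.
  apply/negPn/negP => vX; move/negP: uv; apply; rewrite us //.
  by move: vX; rewrite inE negbK.
pose u' : {ffun V -> 'I_k} := [ffun w => if w == v then t v else u w].
have us' w : w \notin X -> u' w = s w.
  by move=> wX; rewrite ffunE; case: eqP => [wv|_]; [rewrite wv vX in wX|exact: us].
apply: (connect_trans (y := u')); last first.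
  apply: IH => //; rewrite -ltnS; apply: leq_trans uc; apply: proper_card.
  apply/properP; split; last by exists v; rewrite !inE ?ffunE ?eqxx.
  apply/subsetP => w; rewrite !inE ffunE; case: (w =P v) => // wv.
  by rewrite wv eqxx.
apply: connect1; apply/and3P; split; [|exact: low|exact: low].
apply/cards1P; exists v; apply/setP => w; rewrite !inE ffunE.
by case: (w =P v) => [->|_]; rewrite ?uv ?eqxx.
Qed.

Lemma regions_separated A B s p : A \in regions -> B \in regions -> A != B ->
  s \in A -> last s p \in B -> path (@hamming_adjacent n k) s p ->
  theta * n%:R <= (height G s p)%:R.
Proof.
move=> AR BR AB sA tB hp; rewrite leNgt; apply: contra AB => hh.
apply/eqP; apply: (region_eq AR BR sA tB); apply/connectP; exists p => //.
have low t : t \in s :: p -> (energy G t)%:R < theta * n%:R.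
  move=> tp; apply: le_lt_trans hh; rewrite ler_nat.
  by rewrite /height; apply: (@leq_bigmax_seq _ _ predT (energy G)).
elim: p s hp low {sA tB hh} => //= t p IH s /andP[st hp] low.
apply/andP; split.
  by apply/and3P; split => //; apply: low; rewrite !inE eqxx ?orbT.
by apply: IH => // u up; apply: low; rewrite inE up orbT.
Qed.

(** The bound on the size of a region forces at least [exp (gamma n)] regions, so [gamma] also
    serves as the rate of their number. *)
Lemma sequence_shattered : @shattered n k R gamma gamma zeta theta G.
Proof.
exists regions; have pR := equivalence_partitionP eqv; split => //.
  exact: region_is_region.
split; [|exact: region_small|exact: regions_distant|exact: regions_separated].
have Z0 : 0 < #|solutions k G|%:R :> R by rewrite ltr0n solE.
have := card_partition pR => /(congr1 (fun x => x%:R : R)); rewrite natr_sum => cE.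
have : #|solutions k G|%:R <= #|regions|%:R * (expR (- (gamma * n%:R)) * #|solutions k G|%:R).
  rewrite {1}cE -sum_const_set; apply: ler_sum => A; exact: region_small.
rewrite mulrA -{1}[#|solutions k G|%:R]mul1r ler_pM2r // expRN.
by rewrite ler_pdivlMr ?expR_gt0 // mul1r.
Qed.

End Shattered.

(** Ordering the edges and orienting each of them gives distinct simple sequences with the same
    graph. *)
Lemma fiber_ge (H : {set {set V}}) : H \in graphs n m ->
  (m`! * 2 ^ m <= #|[set e : edges | simple e && (graph_of e == H)]|)%N.
Proof.
rewrite inE => /andP[/forall_inP H2 /eqP Hm].
pose g (i : 'I_m) : {set V} := enum_val (cast_ord (esym Hm) i).
have gH i : g i \in H by exact: enum_valP.
have ginj : injective g by move=> i j /enum_val_inj /cast_ord_inj.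
have [f Hf] : exists f : 'I_m -> V * V, forall i,
    (f i).1 != (f i).2 /\ g i = [set (f i).1; (f i).2].
  apply: (@fin_all_exists _ (fun=> (V * V)%type)
     (fun i (p : V * V) => p.1 != p.2 /\ g i = [set p.1; p.2])) => i.
  by have /cards2P[a [b [ab ->]]] := H2 _ (gH i); exists (a, b).
pose phi (pb : ({perm 'I_m} * {ffun 'I_m -> bool})%type) : edges :=
  [ffun i => if pb.2 i then f (pb.1 i) else ((f (pb.1 i)).2, (f (pb.1 i)).1)].
have phiE pb i : edge_ends (phi pb) i = g (pb.1 i).
  rewrite /edge_ends ffunE; case: (pb.2 i); rewrite /= (Hf _).2 //.
  by rewrite setUC.
have phi_inj : injective phi.
  move=> [p b] [p' b'] E.
  have pp : p = p'.
    by apply/permP => i; apply: ginj; rewrite -(phiE (p, b)) E phiE.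
  rewrite -pp in E *; congr (_, _); apply/ffunP => i.
  have := congr1 (fun h : edges => h i) E; rewrite !ffunE /=.
  have := (Hf (p i)).1; case: (f (p i)) => a c /= ac.
  by case: (b i); case: (b' i) => // -[] E1 E2; move: ac; rewrite ?E1 ?E2 eqxx.
have -> : (m`! * 2 ^ m = #|phi @: [set: ({perm 'I_m} * {ffun 'I_m -> bool})%type]|)%N.
  by rewrite card_imset // cardsT card_prod card_Sn card_ffun card_bool card_ord.
apply: subset_leq_card; apply/subsetP => _ /imsetP[pb _ ->]; rewrite inE.
have inj : injective (edge_ends (phi pb)).
  by move=> i j; rewrite !phiE => /ginj /perm_inj.
apply/andP; split.
  apply/andP; split; last exact/injectiveP.
  apply/forallP => i; rewrite ffunE; have := (Hf (pb.1 i)).1.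
  by case: (pb.2 i) => //=; rewrite eq_sym.
rewrite eqEcard; apply/andP; split.
  by apply/subsetP => _ /imsetP[i _ ->]; rewrite phiE; exact: gH.
by rewrite Hm card_imset // card_ord.
Qed.

Lemma bad_graphs_le (Q : pred {set {set V}}) :
  (#|[set H in graphs n m | Q H]| * (m`! * 2 ^ m) <=
   #|[set e : edges | simple e && Q (graph_of e)]|)%N.
Proof.
rewrite -sum_nat_const.
rewrite -[leqRHS]sum1_card (partition_big graph_of predT) //=.
rewrite [leqRHS](bigID (fun H => H \in [set H in graphs n m | Q H])) /=.
apply: leq_trans (leq_addr _ _); apply: leq_sum => H; rewrite inE => /andP[Hg QH].
apply: (leq_trans (fiber_ge Hg)); rewrite sum1_card; apply: subset_leq_card.
apply/subsetP => e; rewrite [e \in _]inE => /andP[se /eqP eH].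
by rewrite unfold_in [e \in _]inE se eH QH eqxx.
Qed.

Lemma ffact_ge (N i j : nat) : (i <= j)%N -> ((N - j) ^ i <= N ^_ i)%N.
Proof.
elim: i => // i IH ij; rewrite expnSr ffactnSr leq_mul ?IH ?(ltnW ij) //.
by rewrite leq_sub2l // ltnW.
Qed.

Lemma graphs_count_ge :
  ((n * n.-1 - 2 * m) ^ m <= #|graphs n m| * (m`! * 2 ^ m))%N.
Proof.
have -> : #|graphs n m| = 'C('C(n, 2), m).
  have c2 : #|[set E : {set V} | #|E| == 2]| = 'C(n, 2) by rewrite card_draws card_ord.
  rewrite -c2 -cards_draws; apply: eq_card => H; rewrite !inE; congr (_ && _).
  apply/forall_inP/subsetP => h E EH; first by rewrite inE h.
  by have := h E EH; rewrite inE.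
rewrite mulnA bin_ffact.
have -> : (n * n.-1 = 2 * 'C(n, 2))%N by rewrite bin2 mul2n halfK oddM; case: (n) => [|j] //=; rewrite andNb subn0.
by rewrite -mulnBr expnMn mulnC leq_mul // ffact_ge.
Qed.

End Landscape.

(** The graphs, each counted with its [m! 2 ^ m] sequences, make up at least a constant share of all
    sequences when [m] is linear in [n]. An event rare among sequences is therefore rare among
    graphs. *)
Lemma simple_fraction_ge (R : realType) (n m : nat) (d : R) : 1 <= d ->
  2 * (1 + 2 * d) <= n%:R -> m%:R <= d * n%:R ->
  (n%:R ^+ 2) ^+ m * expR (- (2 * (1 + 2 * d) * d)) <=
  (#|graphs n m| * (m`! * 2 ^ m))%:R.
Proof.
move=> d1 nd md.
have nR : 0 < n%:R :> R by lra.
have n0 : (0 < n)%N by rewrite -(ltr0n R).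
apply: (@le_trans _ _ ((n * n.-1 - 2 * m) ^ m)%:R); last by rewrite ler_nat graphs_count_ge.
rewrite natrX.
have hx : 0 <= (1 + 2 * d) / n%:R <= 1 / 2.
  by rewrite divr_ge0 /= ?ler_pdivrMr //; lra.
set x := (1 + 2 * d) / n%:R in hx; case/andP: hx => x0 x1.
apply: (@le_trans _ _ ((n%:R ^+ 2 * expR (- (2 * x))) ^+ m)).
  rewrite [leRHS]exprMn; apply: ler_wpM2l; first by rewrite exprn_ge0 // sqr_ge0.
  rewrite expRX ler_expR.
  have -> : 2 * (1 + 2 * d) * d = 2 * x * (d * n%:R) by rewrite /x; field; rewrite gt_eqF.
  have := ler_wpM2l (_ : 0 <= 2 * x) md => /(_ ltac:(lra)).
  lra.
apply: lerXn2r; rewrite ?nnegrE // ?mulr_ge0 ?expR_ge0 ?sqr_ge0 //.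
have h : expR (- (2 * x)) <= 1 - x.
  have h : 1 + 2 * x <= expR (2 * x) by exact: expR_ge1Dx.
  rewrite expRN; apply: (@le_trans _ _ (1 + 2 * x)^-1).
    by rewrite lef_pV2 // posrE ?expR_gt0 //; lra.
  rewrite -div1r ler_pdivrMr; last by lra.
  have : 0 <= x * (1 - 2 * x) by rewrite mulr_ge0 //; lra.
  by lra.
apply: (le_trans (ler_wpM2l (sqr_ge0 _) h)).
have -> : n%:R ^+ 2 * (1 - x) = n%:R * (n%:R - 1) - 2 * (d * n%:R).
  by rewrite /x; field; rewrite gt_eqF.
have n1 : n.-1%:R = n%:R - 1 :> R by rewrite -subn1 natrB.
have dn : 0 <= d * n%:R by rewrite mulr_ge0 //; lra.
rewrite -n1 -natrM natrB; last first.
  rewrite -(ler_nat R) !natrM n1.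
  have : 2 * (1 + 2 * d) * n%:R <= n%:R * n%:R by rewrite ler_wpM2r.
  lra.
by rewrite natrM lerD2l lerN2 natrM ler_wpM2l.
Qed.

(** * Shattering *)

Section Assembly.
Variable R : realType.

(** Double counting of bad pairs of a coloring and a sequence, followed by Markov's inequality. *)
Lemma bad_colorings_markov (n k m : nat) (P : {ffun 'I_n -> 'I_k} -> pred {ffun 'I_m -> 'I_n * 'I_n})
    (X Y : R) : 0 < X ->
  (forall s, #|[set e | proper s e && P s e]|%:R <= Y) ->
  #|[set e : {ffun 'I_m -> 'I_n * 'I_n} |
      X < #|[set s : {ffun 'I_n -> 'I_k} | proper s e && P s e]|%:R]|%:R * X <=
  k%:R ^+ n * Y.
Proof.
move=> X0 HY.
apply: (@le_trans _ _ (\sum_(e : {ffun 'I_m -> 'I_n * 'I_n})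
   #|[set s : {ffun 'I_n -> 'I_k} | proper s e && P s e]|%:R)).
  rewrite -sum_const_set big_mkcond /=; apply: ler_sum => e _.
  by rewrite [e \in _]inE; case: ifP => // /ltW.
have -> : \sum_(e : {ffun 'I_m -> 'I_n * 'I_n})
   #|[set s : {ffun 'I_n -> 'I_k} | proper s e && P s e]|%:R =
   \sum_(s : {ffun 'I_n -> 'I_k}) #|[set e | proper s e && P s e]|%:R :> R.
  under eq_bigr do rewrite natr_card_pred big_mkcond.
  rewrite exchange_big /=; apply: eq_bigr => s _.
  by rewrite natr_card_pred [RHS]big_mkcond.
apply: (le_trans (ler_sum _ (fun s _ => HY s))).
by rewrite sumr_const card_ffun !card_ord -natrX mulr_natl.
Qed.

(** With [m <= (1 - eps / 2) K l n] the main term [K ^ n (1 - 1 / K) ^ m] is at least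
    [exp ((eps / 2 - eps / 50) l n)], while the trap has exponent about [eps l n / 16]. All
    remaining terms are at most small multiples of [eps l n / 100]. *)
Lemma basin_small (eps K l : R) (n m k : nat) : 0 < eps -> eps <= 1 / 2 ->
  K = k%:R -> l = ln K -> 400 <= l -> 8 * l <= K -> 100 <= eps * l ->
  K * K <= n%:R -> m%:R <= (1 - eps / 2) * (K * l) * n%:R ->
  k.+1%:R ^+ k * expR (n%:R * (1 + eps / 2 / 8 * l)) <=
  expR (- (l / (2 * K) * n%:R)) *
  (K ^+ n * (1 - K^-1) ^+ m * expR (- (11 * l * (n%:R / K)))).
Proof.
move=> e0 e1 KE lE l400 k8 el nK hm.
have K0 : 0 < K by lra.
have K1 : 0 < K - 1 by lra.
have KKn : K ^+ n = expR (l * n%:R) by rewrite lE -expRX lnK.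
have n0 : 0 <= n%:R :> R by [].
have ln0 : 0 <= l * n%:R by rewrite mulr_ge0 //; lra.
have eK : 100 <= eps * K.
  have : eps * l <= eps * K by rewrite ler_pM2l //; lra.
  lra.
have h1 : expR (- (K - 1)^-1) <= 1 - K^-1.
  have h : 1 + (K - 1)^-1 <= expR (K - 1)^-1 by exact: expR_ge1Dx.
  have -> : 1 - K^-1 = (1 + (K - 1)^-1)^-1.
    by field; rewrite !gt_eqF //; lra.
  rewrite expRN lef_pV2 // posrE ?expR_gt0 //.
  by rewrite addr_gt0 // invr_gt0.
have h2 : expR (- ((1 - eps / 2 + eps / 50) * (l * n%:R))) <= (1 - K^-1) ^+ m.
  apply: (@le_trans _ _ (expR (- (K - 1)^-1) ^+ m)); last first.
    apply: lerXn2r; rewrite ?nnegrE ?expR_ge0 //.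
    by rewrite subr_ge0 invf_le1 //; lra.
  rewrite expRX ler_expR mulNr lerN2 mulrC ler_pdivrMr //.
  apply: (le_trans hm).
  have -> : (1 - eps / 2) * (K * l) * n%:R = (1 - eps / 2) * K * (l * n%:R) by ring.
  have -> : (1 - eps / 2 + eps / 50) * (l * n%:R) * (K - 1) =
     (1 - eps / 2 + eps / 50) * (K - 1) * (l * n%:R) by ring.
  apply: ler_wpM2r => //; lra.
have h3 : k.+1%:R ^+ k <= expR n%:R :> R.
  apply: (@le_trans _ _ (expR K ^+ k)).
    apply: lerXn2r; rewrite ?nnegrE ?expR_ge0 //.
    by apply: le_trans (expR_ge1Dx _); rewrite KE nat1r.
  by rewrite expRX ler_expR -KE.
have Ki : n%:R / K <= eps / 100 * n%:R.
  by rewrite mulrC; apply: ler_wpM2r => //; rewrite -div1r ler_pdivrMr //; lra.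
have h4 : l * (n%:R / K) <= eps / 100 * (l * n%:R).
  have := ler_wpM2l (_ : 0 <= l) Ki => /(_ ltac:(lra)); lra.
have h5 : 100 * n%:R <= eps * (l * n%:R).
  have := ler_wpM2r n0 el; lra.
apply: (@le_trans _ _ (expR n%:R * expR (n%:R * (1 + eps / 2 / 8 * l)))).
  by apply: ler_wpM2r; rewrite ?expR_ge0.
apply: (@le_trans _ _ (expR (- (l / (2 * K) * n%:R)) *
  (expR (l * n%:R) * expR (- ((1 - eps / 2 + eps / 50) * (l * n%:R))) *
    expR (- (11 * l * (n%:R / K)))))); last first.
  apply: ler_wpM2l; first exact: expR_ge0.
  apply: ler_wpM2r; first exact: expR_ge0.
  by rewrite KKn; apply: ler_wpM2l => //; exact: expR_ge0.
rewrite -!expRD ler_expR.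
have -> : l / (2 * K) * n%:R = l * (n%:R / K) / 2 by field; rewrite gt_eqF.
have -> : n%:R * (1 + eps / 2 / 8 * l) = n%:R + eps * (l * n%:R) / 16 by field.
set A := l * n%:R in ln0 h4 h5 *; set B := l * (n%:R / K) in h4 *.
have -> : 11 * l * (n%:R / K) = 11 * B by rewrite /B; ring.
have [eA eAE] : exists eA, eA = eps * A by exists (eps * A).
rewrite -eAE in h5 *.
have e4 : eps / 100 * A = eA / 100 by rewrite eAE; ring.
have e5 : (1 - eps / 2 + eps / 50) * A = A - eA / 2 + eA / 50 by rewrite eAE; ring.
by rewrite e4 in h4; rewrite e5; clear - h4 h5 n0; lra.
Qed.

Lemma unshattered_rare (eps : R) : 0 < eps -> eps <= 1 / 2 ->
  exists k0 : nat, forall k : nat, (k0 <= k)%N -> forall d : R,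
  (1 + eps) * (k%:R * ln k%:R) <= d -> d <= (2 - eps) * (k%:R * ln k%:R) ->
  exists gamma zeta theta : R, [/\ 0 < gamma, 0 < zeta & 0 < theta] /\
  forall e0 : R, 0 < e0 -> exists n0 : nat, forall n m : nat, (n0 <= n)%N ->
    m%:R <= d * n%:R / 2 -> d * n%:R / 2 < m.+1%:R ->
    (0 < #|graphs n m|)%N /\
    forall Q : pred {set {set 'I_n}},
      (forall H, Q H -> ~ @shattered n k R gamma gamma zeta theta H) ->
      #|[set H in graphs n m | Q H]|%:R <= e0 * #|graphs n m|%:R.
Proof.
move=> ep0 ep1.
have ep20 : 0 < eps / 2 by lra.
have ep21 : eps / 2 <= 1 / 2 by lra.
(* Half of [eps] is kept in reserve here, because rounding [d n / 2] down to [m] may push the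
   density slightly below the window. *)
have [kp [kp1 Hp]] := planted_summary ep20 ep21.
have [kc [kc1 Hc]] := colorings_lower_bound ep0 ep1.
have [kl [kl1 Hl]] := exists_ln_ge (100 / eps + 400).
exists (kp + kc + kl)%N => k kk d d1 d2.
have [kkp kkc kkl] : [/\ (kp <= k)%N, (kc <= k)%N & (kl <= k)%N].
  by clear - kk; split; lia.
have k1 : (1 < k)%N by exact: leq_trans kkp.
have lC := Hl k kkl.
have [l400 k8 _] := large_ln_bounds ep0 ep1 k1 lC.
have {Hp} [th [np [th0 Hp]]] := Hp k kkp.
have {}Hc := Hc k kkc.
have [K KE] : exists K : R, K = k%:R by exists k%:R.
have [l lE] : exists l : R, l = ln K by exists (ln K).
rewrite -KE -lE in l400 k8 lC d1 d2 Hp Hc.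
have el : 100 <= eps * l.
  have h : 100 / eps <= l by clear - lC; lra.
  by rewrite ler_pdivrMr // mulrC in h.
have K0 : 0 < K by clear - l400 k8; lra.
have l0 : 0 < l by clear - l400; lra.
have Kl0 : 0 < K * l by rewrite mulr_gt0.
have D1 : 1 <= K * l.
  have : K * 400 <= K * l by rewrite ler_pM2l.
  by clear - l400 k8; lra.
have [zeta zeta0 Ht] := touching_rare Kl0 th0.
(* Half of the gap between the exponents 12 and 11: one half makes bad colorings a small fraction,
   the other makes the exceptional sequences rare. *)
have gamma0 : 0 < l / (2 * K) by rewrite divr_gt0 // mulr_gt0.
exists (l / (2 * K)), zeta, th; split => // e0 e00.
pose c0 := expR (- (2 * (1 + 2 * (K * l)) * (K * l))).
have c00 : 0 < c0 by exact: expR_gt0.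
(* Three exceptional sets share the error, and [c0] is the price of passing from sequences to
   graphs. *)
have e10 : 0 < e0 * c0 / 3 by rewrite divr_gt0 // mulr_gt0.
have [e1 e1E] : exists e1, e1 = e0 * c0 / 3 by exists (e0 * c0 / 3).
rewrite -e1E in e10.
have [n1 {}Ht] := Ht _ e10; have [n2 {}Hc] := Hc _ e10.
have [n3 Hm] := poly_exp_small 0 gamma0 e10.
have [n4 Hn4] := exists_nat_ge (K * K + 4 / (eps * (K * l)) + 2 * (1 + 2 * (K * l))).
exists (np + n1 + n2 + n3 + n4).+1 => n m nn md md'.
have [nnp nn1 nn2 nn3 nn4] :
  [/\ (np <= n)%N, (n1 <= n)%N, (n2 <= n)%N, (n3 <= n)%N & (n4 <= n)%N].
  by clear - nn; split; lia.
have n0 : (0 < n)%N by exact: leq_trans nn.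
have nR : 0 < n%:R :> R by rewrite ltr0n.
have {}Hn4 : K * K + 4 / (eps * (K * l)) + 2 * (1 + 2 * (K * l)) <= n%:R.
  by apply: (le_trans Hn4); rewrite ler_nat.
have KK0 : 0 < K * K by rewrite mulr_gt0.
have eKl : 0 < eps * (K * l) by rewrite mulr_gt0.
have q40 : 0 < 4 / (eps * (K * l)) by rewrite divr_gt0.
have nK : K * K <= n%:R by clear - Hn4 q40 D1; lra.
have nD : 2 * (1 + 2 * (K * l)) <= n%:R by clear - Hn4 q40 KK0; lra.
have neps : 4 <= eps * (K * l) * n%:R.
  rewrite [leRHS]mulrC -ler_pdivrMr //; clear - Hn4 q40 KK0 D1; lra.
have hm : m%:R <= (1 - eps / 2) * (K * l) * n%:R.
  have h := ler_wpM2r (ltW nR) d2; clear - h md; lra.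
have ml : (1 + eps / 2) * (K * l) * n%:R <= 2 * m%:R.
  have h := ler_wpM2r (ltW nR) d1; have m1 : m.+1%:R = m%:R + 1 :> R by rewrite natr1.
  rewrite m1 in md'.
  by clear - h md' neps; lra.
have epsn : 0 <= eps * (K * l) * n%:R by rewrite mulr_ge0 // ltW.
have mu : 2 * m%:R <= 2 * (K * l) * n%:R by clear - hm epsn; lra.
have mD : m%:R <= K * l * n%:R by clear - mu; lra.
have hG := simple_fraction_ge D1 nD mD; rewrite -/c0 in hG.
have N0 : 0 < (n%:R ^+ 2) ^+ m :> R by rewrite !exprn_gt0.
have [N NE] : exists N : R, N = (n%:R ^+ 2) ^+ m by exists ((n%:R ^+ 2) ^+ m).
rewrite -NE in hG N0.
have G0 : (0 < #|graphs n m| * (m`! * 2 ^ m))%N.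
  by rewrite -(ltr0n R); apply: lt_le_trans hG; rewrite mulr_gt0.
split; first by move: G0; rewrite muln_gt0 => /andP[].
move=> Q HQ.
have [P HP] := Hp n m nnp ml mu.
have tb := Ht n m nn1 mD; rewrite -NE in tb; set T1 := [set e | _] in tb.
have cb := Hc n m nn2 hm; rewrite -NE in cb; set T2 := [set e | _] in cb.
set Zl := K ^+ n * (1 - K^-1) ^+ m * expR (- (11 * l * (n%:R / K))).
have Ki : 0 < 1 - K^-1 by rewrite subr_gt0 invf_lt1 //; clear - l400 k8; lra.
have Zl0 : 0 < Zl by rewrite !mulr_gt0 ?exprn_gt0 ?expR_gt0.
pose X3 := expR (- (l / (2 * K) * n%:R)) * Zl.
have X30 : 0 < X3 by rewrite mulr_gt0 ?expR_gt0.
have mk := bad_colorings_markov X30 (fun s => (HP s).1); set T3 := [set e | _] in mk.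
have t3 : #|T3|%:R <= e1 * N.
  have hm3 := Hm n nn3; rewrite expr0 mul1r in hm3.
  rewrite -(ler_pM2r X30); apply: (le_trans mk).
  have -> : k%:R ^+ n * (base R n k m * expR (- (12 * l * (n%:R / K)))) =
     expR (- (l / (2 * K) * n%:R)) * N * X3.
    rewrite /base exprMn -NE -KE /X3 /Zl.
    have -> : - (12 * l * (n%:R / K)) = - (l / (2 * K) * n%:R) +
       (- (l / (2 * K) * n%:R) + - (11 * l * (n%:R / K))) by field; rewrite gt_eqF.
    by rewrite !expRD; ring.
  rewrite ler_pM2r //; apply: ler_wpM2r => //; exact: ltW.
have sub : [set e : {ffun 'I_m -> 'I_n * 'I_n} | simple e && Q (graph_of e)] \subset
   T1 :|: T2 :|: T3.
  apply/subsetP => e; rewrite [e \in _]inE => /andP[se Qe].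
  apply/negPn/negP; rewrite !in_setU !negb_or => /andP[/andP[eT1 eT2] eT3].
  apply: (HQ _ Qe).
  have Zs : Zl <= #|[set t : {ffun 'I_n -> 'I_k} | proper t e]|%:R.
    rewrite leNgt; apply: contra eT2 => h; rewrite [e \in _]inE h andbT.
    by case/andP: se.
  have bs : #|[set s : {ffun 'I_n -> 'I_k} | proper s e && P s e]|%:R <= X3.
    by rewrite leNgt; apply: contra eT3 => h; rewrite [e \in _]inE.
  have XZ : X3 <= expR (- (l / (2 * K) * n%:R)) *
      #|[set t : {ffun 'I_n -> 'I_k} | proper t e]|%:R.
    by apply: ler_wpM2l; rewrite ?expR_ge0.
  apply: (@sequence_shattered R n k m e (fun s => P s e) th th zeta (l / (2 * K))
    (k.+1%:R ^+ k * expR (n%:R * (1 + eps / 2 / 8 * l)))) => //.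
  - move=> X Xz; rewrite ltNge; apply: contra eT1 => h; rewrite [e \in _]inE.
    by apply/existsP; exists X; rewrite Xz.
  - exact: le_trans XZ.
  - by move=> s; exact: (HP s).2.
  - exact: le_trans (basin_small ep0 ep1 KE lE l400 k8 el nK hm) XZ.
  by rewrite -(ltr0n R); exact: lt_le_trans Zs.
have cU : #|[set e : {ffun 'I_m -> 'I_n * 'I_n} | simple e && Q (graph_of e)]|%:R <=
    e0 * c0 * N.
  apply: (@le_trans _ _ (#|T1| + #|T2| + #|T3|)%:R).
    rewrite ler_nat; apply: (leq_trans (subset_leq_card sub)).
    apply: (leq_trans (leq_card_setU _ _)); rewrite leq_add2r; exact: leq_card_setU.
  rewrite !natrD.
  have -> : e0 * c0 * N = e1 * N + e1 * N + e1 * N by rewrite e1E; field.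
  by clear - tb cb t3; lra.
have := @bad_graphs_le n m Q; rewrite -(ler_nat R) => hb.
have M0 : 0 < (m`! * 2 ^ m)%:R :> R.
  by rewrite ltr0n; move: G0; rewrite muln_gt0 => /andP[].
rewrite -(ler_pM2r M0) -natrM; apply: (le_trans hb); apply: (le_trans cU).
rewrite -[leLHS]mulrA -[leRHS]mulrA -natrM; apply: ler_wpM2l; first exact: ltW.
by rewrite [c0 * N]mulrC.
Qed.

End Assembly.

From mathcomp Require Import all_classical all_reals all_analysis.

Import numFieldNormedType.Exports.

Local Open Scope classical_set_scope.

(** * Limit in [n] and the sequence [eps] *)

Lemma shatters_of_rare (R : realType) (k : nat) (d gamma zeta theta : R) :
  0 <= d -> 0 < gamma -> 0 < zeta -> 0 < theta ->
  (forall e0 : R, 0 < e0 -> exists n0 : nat, forall n m : nat, (n0 <= n)%N ->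
    m%:R <= d * n%:R / 2 -> d * n%:R / 2 < m.+1%:R ->
    (0 < #|graphs n m|)%N /\
    forall Q : pred {set {set 'I_n}},
      (forall H, Q H -> ~ @shattered n k R gamma gamma zeta theta H) ->
      #|finset.finset (fun H => (H \in graphs n m) && Q H)|%:R <= e0 * #|graphs n m|%:R) ->
  shatters R k (fun n : nat => Num.truncn (d * n%:R / 2)).
Proof.
move=> d0 g0 z0 t0 H; exists gamma, gamma, zeta, theta; split => //.
apply/cvgrPdist_le => e0 e00; have [n0 Hn0] := H e0 e00.
exists n0 => // n /= nn0; set m := Num.truncn _.
have dn : 0 <= d * n%:R / 2 by rewrite divr_ge0 // mulr_ge0.
have /andP[m1 m2] := truncn_itv dn.
have [G0 /(_ (fun G => ~~ `[< @shattered n k R gamma gamma zeta theta G >]))] :=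
  Hn0 n m nn0 m1 m2.
have h0 (G : {set {set 'I_n}}) :
    ~~ `[< @shattered n k R gamma gamma zeta theta G >] ->
    ~ @shattered n k R gamma gamma zeta theta G by move/asboolPn.
move=> /(_ h0) hb; rewrite /Gnm_prob.
set A := finset.finset _ in hb; set B := finset.finset _.
have GR : 0 < #|graphs n m|%:R :> R by rewrite ltr0n.
have AB : #|graphs n m|%:R = #|B|%:R + #|A|%:R :> R.
  rewrite -natrD -(cardsID (finset.finset
    (fun G => `[< @shattered n k R gamma gamma zeta theta G >])) (graphs n m)).
  congr ((_ + _)%:R); apply: eq_card => G; rewrite !finset.inE //.
  by rewrite andbC.
have -> : 1 - #|B|%:R / #|graphs n m|%:R = #|A|%:R / #|graphs n m|%:R :> R.
  have -> : #|B|%:R = #|graphs n m|%:R - #|A|%:R :> R by rewrite AB addrK.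
  by field; rewrite gt_eqF.
by rewrite ger0_norm ?divr_ge0 // ler_pdivrMr.
Qed.

Theorem theorem1 (R : realType) :
  exists eps : nat -> R,
    eps k @[k --> \oo] --> (0 : R) /\
    forall (k : nat) (d : R), (2 <= k)%N ->
      (1 + eps k) * (k%:R * ln k%:R) <= d ->
      d <= (2 - eps k) * (k%:R * ln k%:R) ->
      shatters R k (fun n : nat => Num.truncn (d * n%:R / 2)).
Proof.
have ep (j : nat) : 0 < (j.+2%:R)^-1 :> R /\ (j.+2%:R)^-1 <= 1 / 2 :> R.
  split; first by rewrite invr_gt0 ltr0n.
  by rewrite div1r lef_pV2 ?posrE ?ltr0n // (ler_nat R 2).
have [k0 Hk0] := choice (fun j => unshattered_rare (ep j).1 (ep j).2).
(* Diagonal choice: the margin [1 / (j + 2)] works from [k0 j] on, and [J k] is the successor of the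
   largest [j < k] already available at [k], or 0 if there is none. *)
pose J (k : nat) : nat := (\max_(j < k | (k0 j <= k)%N) j.+1)%N.
exists (fun k => ((J k).+1%:R)^-1); split.
  apply/cvgrPdist_le => e e0.
  have [j Hj] := exists_nat_ge e^-1.
  exists (maxn (k0 j) j.+1) => // k /=; rewrite geq_max => /andP[kk jk].
  have Jj : (j < J k)%N by exact: (@leq_bigmax_cond _ _ (fun i : 'I_k => i.+1) (Ordinal jk)).
  rewrite sub0r normrN ger0_norm ?invr_ge0 // -[leRHS]invrK.
  rewrite lef_pV2 ?posrE ?invr_gt0 ?ltr0n //; apply: (le_trans Hj).
  by rewrite ler_nat; apply: leq_trans (ltnW Jj) _.
move=> k d k2 d1 d2.
have kl0 : 0 < k%:R * ln k%:R :> R.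
  by rewrite mulr_gt0 ?ltr0n ?ln_gt0 ?(ltr_nat R 1) // ltnW.
have [J0|Jp] := posnP (J k).
  (* The default margin 1 makes the window for [d] empty, as [k ln k > 0]. *)
  by rewrite J0 invr1 in d1 d2; lra.
have : exists2 j : 'I_k, (k0 j <= k)%N & J k = j.+1.
  have [j0 Pj0|none] := pickP (fun j : 'I_k => (k0 j <= k)%N); last first.
    by move: Jp; rewrite /J big_pred0.
  have A0 : (0 < #|[pred j : 'I_k | (k0 j <= k)%N]|)%N by apply/card_gt0P; exists j0.
  have [j Pj Ej] := eq_bigmax_cond (fun i : 'I_k => i.+1) A0.
  by exists j => //; rewrite /J -Ej; apply: eq_bigl => i; rewrite inE.
case=> j kj Jk; rewrite Jk in d1 d2.
have [gamma [zeta [theta [[g0 z0 t0] H]]]] := Hk0 j k kj d d1 d2.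
apply: (@shatters_of_rare R k d gamma zeta theta) => //.
have [e1 _] := ep j; apply: le_trans d1; rewrite mulr_ge0 ?(ltW kl0) //; lra.
Qed.
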